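(* Let $s\in(0,1)$, $\gamma\in(0,1]$, $\mu>0$, $\mathsf f\in L^2(0,T;\mathbb H^{-s}(\Omega))$, $\mathsf u_0\in L^2(\Omega)$, $\mathsf u_d\in L^2(Q)$, $\mathsf a,\mathsf b\in L^2(Q)$ with $\mathsf a\le\mathsf b$ a.e. A control $\bar{\mathsf z}\in\mathsf Z_{\mathrm{ad}}$ is the optimal control of the problem of minimizing $$J(\mathsf u,\mathsf z)=\frac12\int_0^T\Big(\|\mathsf u-\mathsf u_d\|_{L^2(\Omega)}^2+\mu\|\mathsf z\|_{L^2(\Omega)}^2\Big)\,dt$$ over $\mathsf z\in\mathsf Z_{\mathrm{ad}}$ subject to $\mathsf u=\mathbf S\mathsf z$, if and only if $$(\mu\bar{\mathsf z}+\bar{\mathsf p},\mathsf z-\bar{\mathsf z})_{L^2(Q)}\ge0\qquad\forall\,\mathsf z\in\mathsf Z_{\mathrm{ad}},$$ where $\bar{\mathsf p}=\bar{\mathsf p}(\bar{\mathsf z})\in\mathbb W$ solves $$\partial_{T-t}^\gamma\bar{\mathsf p}+\mathcal L^s\bar{\mathsf p}=\bar{\mathsf u}-\mathsf u_d\ \text{ in }Q,\qquad\bar{\mathsf p}(T)=0\ \text{ in }\Omega,\qquad \bar{\mathsf u}=\mathbf S\bar{\mathsf z}.$$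
   Context: $\Omega\subset\mathbb R^n$ ($n\ge1$) is open, bounded and connected with polyhedral boundary, $T>0$, $Q=\Omega\times(0,T)$. $\mathcal Lw=-\mathrm{div}(A\nabla w)+cw$ with homogeneous Dirichlet boundary condition on $\partial\Omega$, where $0\le c\in L^\infty(\Omega)$ and $A\in C^{0,1}(\Omega,GL(n,\mathbb R))$ is symmetric and positive definite (the associated bilinear form is bounded and coercive). $\{(\lambda_k,\varphi_k)\}_{k\in\mathbb N}$ are the eigenpairs of $\mathcal L$, $\{\varphi_k\}$ an orthonormal basis of $L^2(\Omega)$, and $\mathcal L^sw=\sum_k\lambda_k^sw_k\varphi_k$ with $w_k=\int_\Omega w\varphi_k$; it extends to an isomorphism $\mathbb H^s(\Omega)\to\mathbb H^{-s}(\Omega)$, where $\mathbb H^s(\Omega)=[L^2(\Omega),H_0^1(\Omega)]_s$ and $\mathbb H^{-s}(\Omega)$ is its dual. For $\gamma\in(0,1)$ the left and right Caputo derivatives are formally $\partial_t^\gamma g(t)=\frac1{\Gamma(1-\gamma)}\int_0^t\frac{g'(r)}{(t-r)^\gamma}\,dr$ and $\partial_{T-t}^\gamma g(t)=-\frac1{\Gamma(1-\gamma)}\int_t^T\frac{g'(\xi)}{(\xi-t)^\gamma}\,d\xi$ (understood as $\frac{d}{dt}I_t^{1-\gamma}(g-g(0))$ and $-\frac{d}{dt}I_{T-t}^{1-\gamma}(g-g(T))$ for less regular functions, with $I_t^{\sigma},I_{T-t}^\sigma$ the left and right Riemann-Liouville integrals). For $\gamma=1$, $\partial_t^1=\partial_t$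 and $\partial_{T-t}^1=-\partial_t$. $\mathbb W=\{w\in L^\infty(0,T;L^2(\Omega))\cap L^2(0,T;\mathbb H^s(\Omega)):\partial_t^\gamma w\in L^2(0,T;\mathbb H^{-s}(\Omega))\}$. $\mathsf Z_{\mathrm{ad}}=\{\mathsf w\in L^2(Q):\mathsf a\le\mathsf w\le\mathsf b\text{ a.e. in }Q\}$. The control to state operator $\mathbf S$ maps $\mathsf z\in L^2(0,T;\mathbb H^{-s}(\Omega))$ to the unique solution $\mathsf u\in\mathbb W$ of $\partial_t^\gamma\mathsf u+\mathcal L^s\mathsf u=\mathsf f+\mathsf z$ in $Q$, $\mathsf u(0)=\mathsf u_0$ in $\Omega$. Solutions of the state equation and (after time reversal) of the adjoint equation are in $C([0,T];L^2(\Omega))$. *)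

(* Defs.v *)
From HB Require Import structures.
From mathcomp Require Import all_boot all_order all_algebra.
From mathcomp Require Import all_classical all_reals all_analysis.
Set Implicit Arguments.
Unset Strict Implicit.
Unset Printing Implicit Defensive.
Import Order.TTheory GRing.Theory Num.Theory.
Import numFieldNormedType.Exports.
Local Open Scope classical_set_scope.
Local Open Scope ring_scope.

(* 'rV[R]_n carries the product sigma-algebra, i.e. the Borel sets of R^n. *)

Section measurable_rV.
Context {R : realType} {n : nat}.

Let coord (i : 'I_n) (x : 'rV[R]_n) : measurableTypeR R := x ord0 i.

Let rV_set0 : g_sigma_preimage coord set0.
Proof. exact: sigma_algebra0. Qed.

Let rV_setC A : g_sigma_preimage coord A -> g_sigma_preimage coord (~` A).
Proof. exact: sigma_algebraC. Qed.

Let rV_bigcup (F : (set 'rV[R]_n)^nat) :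
  (forall i, g_sigma_preimage coord (F i)) ->
  g_sigma_preimage coord (\bigcup_i (F i)).
Proof. exact: sigma_algebra_bigcup. Qed.

HB.instance Definition _ := @isMeasurable.Build default_measure_display
  'rV[R]_n (g_sigma_preimage coord) rV_set0 rV_setC rV_bigcup.

Lemma measurable_coord (i : 'I_n) :
  measurable_fun [set: 'rV[R]_n]
    (fun x : 'rV[R]_n => x ord0 i : measurableTypeR R).
Proof.
move=> _ Y mY; rewrite setTI; apply: sub_sigma_algebra => /=.
rewrite -bigcup_seq/=; exists i => /=; first by rewrite mem_index_enum.
by exists Y => //; rewrite setTI.
Qed.

Lemma measurable_fun_rV d (T : measurableType d) (f : T -> 'rV[R]_n) :
  (forall i, measurable_fun [set: T] (fun x => f x ord0 i : measurableTypeR R)) ->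
  measurable_fun [set: T] f.
Proof.
move=> mf _ Y mY; rewrite setTI.
suff : (g_sigma_preimage coord) `<=` [set Z | measurable (f @^-1` Z)] by exact.
apply: smallest_sub.
  split => /=.
  - by rewrite preimage_set0.
  - by move=> A mA; rewrite setTD -preimage_setC; exact: measurableC.
  - by move=> F mF; rewrite /= preimage_bigcup; exact: bigcup_measurable.
move=> Z; rewrite -bigcup_seq/= => -[i _ [A mA <-]].
rewrite /= setTI.
by rewrite -[X in measurable X]setTI; exact: mf.
Qed.
End measurable_rV.

Section lebesgue_rV.
Context {R : realType}.

Definition rV_cons n (y : measurableTypeR R * 'rV[R]_n) : 'rV[R]_n.+1 :=
  \row_(i < n.+1) oapp (y.2 ord0) y.1 (unlift ord0 i).

Definition rV_uncons n (x : 'rV[R]_n.+1) : measurableTypeR R * 'rV[R]_n :=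
  (x ord0 ord0, \row_(i < n) x ord0 (lift ord0 i)).

Lemma rV_consK n : cancel (@rV_cons n) (@rV_uncons n).
Proof.
case=> a x; rewrite /rV_uncons /rV_cons mxE unlift_none /=; congr (_, _).
by apply/rowP => i; rewrite !mxE liftK.
Qed.

Lemma measurable_rV_cons n : measurable_fun [set: _] (@rV_cons n).
Proof.
apply: measurable_fun_rV => i.
case: (unliftP ord0 i) => [j ->|->].
- rewrite (_ : (fun _ => _) = (fun x : 'rV[R]_n => x ord0 j : measurableTypeR R) \o snd).
    apply: measurableT_comp; first exact: measurable_coord. by [].
  by apply/funext => x /=; rewrite mxE liftK.
- rewrite (_ : (fun _ => _) = fst); first by [].
  by apply/funext => x /=; rewrite mxE unlift_none.
Qed.

Lemma measurable_rV_uncons n : measurable_fun [set: _] (@rV_uncons n).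
Proof.
apply: measurable_fun_pair; first exact: measurable_coord.
apply: measurable_fun_rV => i.
rewrite (_ : (fun _ => _) = (fun x : 'rV[R]_n.+1 => x ord0 (lift ord0 i) : measurableTypeR R)).
  exact: measurable_coord.
by apply/funext => x; rewrite mxE.
Qed.

Section step.
Context n (m : {sigma_finite_measure set 'rV[R]_n -> \bar R}).

Definition lebesgue_rV_step : set 'rV[R]_n.+1 -> \bar R :=
  pushforward (lebesgue_measure \x m)%E (@rV_cons n).

Let step0 : lebesgue_rV_step set0 = 0%E.
Proof. by rewrite /lebesgue_rV_step /pushforward preimage_set0 measure0. Qed.

Let step_ge0 A : (0 <= lebesgue_rV_step A)%E.
Proof. by rewrite /lebesgue_rV_step /pushforward; exact: measure_ge0. Qed.

Let measurable_preimage A : measurable A -> measurable (@rV_cons n @^-1` A).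
Proof.
by move=> mA; rewrite -[X in measurable X]setTI; exact: measurable_rV_cons.
Qed.

Let step_sigma_additive : semi_sigma_additive lebesgue_rV_step.
Proof.
move=> F mF tF mUF; rewrite /lebesgue_rV_step /pushforward preimage_bigcup.
apply: measure_semi_sigma_additive.
- by move=> k; exact: measurable_preimage.
- apply/trivIsetP => /= i j _ _ ij; rewrite -preimage_setI.
  by move/trivIsetP : tF => /(_ _ _ _ _ ij) ->//; rewrite preimage_set0.
- by rewrite -preimage_bigcup; exact: measurable_preimage.
Qed.

HB.instance Definition _ := isMeasure.Build _ _ _ lebesgue_rV_step
  step0 step_ge0 step_sigma_additive.

Let step_sigma_finite : sigma_finite [set: 'rV[R]_n.+1] lebesgue_rV_step.
Proof.
have [F FT mF] : sigma_finite [set: measurableTypeR R * 'rV[R]_n]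
    (lebesgue_measure \x m)%E.
  have /sigma_finiteP[F [TF ndF Foo]] := sigma_finiteT (@lebesgue_measure R).
  have /sigma_finiteP[G [TG ndG Goo]] := sigma_finiteT m.
  exists (fun k => F k `*` G k).
    rewrite -setXTT TF TG predeqE => -[x y]; split.
      move=> [/= [i _ Fix] [j _ Gjy]]; exists (maxn i j) => //; split.
      - by move: x Fix; exact/subsetPset/ndF/leq_maxl.
      - by move: y Gjy; exact/subsetPset/ndG/leq_maxr.
    by move=> [k _ []/= ? ?]; split; exists k.
  move=> k; have [? ?] := Foo k; have [? ?] := Goo k.
  split; first exact: measurableX.
  by rewrite product_measure1E// lte_mul_pinfty// ge0_fin_numE.
exists (fun k => @rV_uncons n @^-1` F k).
  by rewrite -preimage_bigcup -FT preimage_setT.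
move=> k; have [mFk Fk] := mF k; split.
  by rewrite -[X in measurable X]setTI; exact: measurable_rV_uncons.
rewrite /lebesgue_rV_step /pushforward -comp_preimage.
rewrite (_ : _ \o _ = id) ?preimage_id//.
by apply/funext => y; exact: rV_consK.
Qed.

HB.instance Definition _ := Measure_isSigmaFinite.Build _ _ _ lebesgue_rV_step
  step_sigma_finite.

End step.

Fixpoint lebesgue_rV n : {sigma_finite_measure set 'rV[R]_n -> \bar R} :=
  match n with
  | 0 => dirac (0 : 'rV[R]_0)
  | m.+1 => lebesgue_rV_step (lebesgue_rV m)
  end.

Lemma lebesgue_rV_box n (A : 'I_n -> set (measurableTypeR R)) :
  (forall i, measurable (A i)) ->
  lebesgue_rV n [set x | forall i, A i (x ord0 i)] =
  (\prod_(i < n) lebesgue_measure (A i))%E.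
Proof.
elim: n A => [|n IHn] A mA.
  rewrite big_ord0 /= diracE mem_set//= => -[]//.
rewrite big_ord_recl -IHn//=.
rewrite -product_measure1E//=.
  rewrite /lebesgue_rV_step /pushforward; congr (product_measure1 _ _ _).
  apply/seteqP; split=> [[a x] /= H|[a x] [/= Ha Hx] i].
  - split => [|i /=]; first by have := H ord0; rewrite mxE unlift_none.
    by have := H (lift ord0 i); rewrite mxE liftK.
  - rewrite mxE; case: (unliftP ord0 i) => [j ->|->] //=; exact: Hx.
have -> : (fun x : 'rV[R]_n => forall i, A (lift ord0 i) (x ord0 i)) =
    \bigcap_(i in [set: 'I_n])
      ((fun x : 'rV[R]_n => x ord0 i : measurableTypeR R) @^-1` A (lift ord0 i)).
  by apply/seteqP; split => x /= H i; [move=> _|]; exact: H.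
apply: (@fin_bigcap_measurable _ _ 'I_n) => [|i _]; first exact: finite_finset.
by rewrite -[X in measurable X]setTI; exact: measurable_coord.
Qed.

End lebesgue_rV.

Section domain.
Context {R : realType} {n : nat}.
Implicit Type Omega : set 'rV[R]_n.

Definition dot (x y : 'rV[R]_n) : R := \sum_(i < n) x ord0 i * y ord0 i.

(* A closed convex polyhedral piece of a hyperplane. *)
Definition polyhedral_face (P : set 'rV[R]_n) : Prop :=
  exists (a : 'rV[R]_n) (b : R) (hs : seq ('rV[R]_n * R)), a != 0 /\
    P = [set x | dot a x = b /\ forall h, h \in hs -> dot h.1 x <= h.2].

Definition polyhedral_boundary Omega : Prop :=
  exists (N : nat) (P : 'I_N -> set 'rV[R]_n),
    (forall i, polyhedral_face (P i)) /\
    closure Omega `\` interior Omega = \bigcup_i P i.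

Definition polyhedral_domain Omega : Prop :=
  [/\ open Omega, bounded_set Omega, connected Omega &
      polyhedral_boundary Omega].

End domain.

(* Elements of L^2 spaces are represented by functions up to almost everywhere
   equality; the values outside of [D] are irrelevant ([f \_ D] is f extended
   by 0). *)

Section L2.
Context {d : measure_display} {X : measurableType d} {R : realType}.
Variables (m : {measure set X -> \bar R}) (D : set X).
Implicit Types f g : X -> R.

Definition L2 : set (X -> R) := [set f | (f \_ D) \in Lfun m 2%:E].

Definition L2dot f g : R := (\int[m]_(x in D) (f x * g x))%R.

Definition L2sqnorm f : \bar R := (\int[m]_(x in D) ((f x) ^+ 2)%:E)%E.

End L2.

Section test_functions.
Context {R : realType} {V : normedModType R}.
Implicit Type f : V -> R.

Fixpoint Cn (k : nat) f : Prop :=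
  continuous f /\
  if k is k'.+1 then
    forall v, (forall x, derivable f x v) /\ Cn k' (fun x => 'D_v f x)
  else True.

Definition test_function (U : set V) f : Prop :=
  [/\ forall k, Cn k f,
      compact (closure [set x | f x != 0]) &
      closure [set x | f x != 0] `<=` U].

End test_functions.

Section space.
Context {R : realType} {n : nat}.
Variable Omega : set 'rV[R]_n.

Local Notation Rn := 'rV[R]_n.
Local Notation leb := (lebesgue_rV n).

Local Notation L2O := (L2 leb Omega).
Local Notation ipO := (L2dot leb Omega).
Local Notation sqO := (L2sqnorm leb Omega).

Implicit Types (v w : Rn -> R) (G : Rn -> Rn).

(* [H10 w G]: w belongs to H^1_0(Omega), the closure of the test functions in
   H^1(Omega), and G is its weak gradient. *)
Definition H10 w G : Prop :=
  [/\ L2O w, forall i, L2O (fun x => G x ord0 i) &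
      exists psi : nat -> Rn -> R,
        [/\ forall j, test_function Omega (psi j),
            sqO (fun x => psi j x - w x) @[j --> \oo] --> 0%E &
            forall i, sqO (fun x => 'D_(delta_mx ord0 i) (psi j) x - G x ord0 i)
                        @[j --> \oo] --> 0%E]].

Definition H1sqnorm w G : \bar R :=
  (sqO w + \sum_(i < n) sqO (fun x => G x ord0 i))%E.

Variables (A : Rn -> 'M[R]_n) (c : Rn -> R).

Definition bilin v Gv w Gw : R :=
  \int[leb]_(x in Omega)
    (dot (Gv x *m A x) (Gw x) + c x * v x * w x).

Definition elliptic_operator : Prop :=
  [/\ exists M : R, forall x y, Omega x -> Omega y ->
        `|A x - A y| <= M * `|x - y|,
      forall x, Omega x ->
        [/\ A x \in unitmx, (A x)^T = A x &
            forall xi : Rn, xi != 0 -> 0 < dot (xi *m A x) xi],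
      measurable_fun Omega c /\
        exists M : R, \forall x \ae leb, Omega x -> 0 <= c x <= M,
      exists M : R, forall v Gv w Gw, H10 v Gv -> H10 w Gw ->
        (((bilin v Gv w Gw) ^+ 2)%:E <=
           M%:E * H1sqnorm v Gv * H1sqnorm w Gw)%E &
      exists2 alpha : R, 0 < alpha & forall w G, H10 w G ->
        (alpha%:E * H1sqnorm w G <= (bilin w G w G)%:E)%E].

Variables (lam : nat -> R) (phi : nat -> Rn -> R).

(* Weak eigenpairs: a(phi_k, v) = lam_k (phi_k, v) for all v in H^1_0. *)
Definition eigenpairs : Prop :=
  forall k, exists2 G, H10 (phi k) G &
    forall v Gv, H10 v Gv -> bilin (phi k) G v Gv = lam k * ipO (phi k) v.

Definition orthonormal_basis : Prop :=
  [/\ forall k, L2O (phi k),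
      forall j k, ipO (phi j) (phi k) = (j == k)%:R &
      forall w, L2O w ->
        sqO (fun x => w x - \sum_(k < N) ipO w (phi k) * phi k x)
          @[N --> \oo] --> 0%E].

(* The space H^s(Omega) = [L^2(Omega), H^1_0(Omega)]_s is the real (K-method)
    interpolation space with second index 2; the quadratic K-functional gives
    an equivalent norm that is Hilbertian. *)

Variable s : R.

Definition Ksq (t : R) w : \bar R :=
  ereal_inf [set e | exists v G, H10 v G /\
    e = (sqO (fun x => w x - v x)%R + (t ^+ 2)%:E * H1sqnorm v G)%E].

Definition Hs_sqnorm w : \bar R :=
  (\int[lebesgue_measure]_(t in `]0%R, +oo[)
     ((t `^ (- 1 - 2 * s))%:E * Ksq t w))%E.

Definition Hs : set (Rn -> R) := [set w | L2O w /\ (Hs_sqnorm w < +oo)%E].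

(* Elements of the dual H^{-s}(Omega) are functionals, only relevant on [Hs]. *)

Definition Hms_sqnorm (F : (Rn -> R) -> R) : \bar R :=
  ereal_sup [set ((F v) ^+ 2)%:E | v in [set v | Hs v /\ (Hs_sqnorm v <= 1)%E]].

Definition Hms : set ((Rn -> R) -> R) := [set F |
  (forall (a : R) v w, Hs v -> Hs w ->
     F (fun x => a * v x + w x) = a * F v + F w) /\
  (Hms_sqnorm F < +oo)%E].

(* The extension of L^s w = sum_k lam_k^s w_k phi_k to H^s -> H^{-s}. *)
Definition fracL w : (Rn -> R) -> R := fun v =>
  limn (series (fun k => lam k `^ s * ipO w (phi k) * ipO v (phi k))).

Variable T : R.

Local Notation I0T := (`]0, T[%classic : set (measurableTypeR R)).
Local Notation leb1 := (@lebesgue_measure R).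

Definition cylinder : set (Rn * measurableTypeR R) := Omega `*` I0T.

Local Notation lebQ := (leb \x leb1)%E.

Definition uncurryQ (w : R -> Rn -> R) : Rn * measurableTypeR R -> R :=
  fun y => w y.2 y.1.

Definition L2Q : set (R -> Rn -> R) :=
  [set w | L2 lebQ cylinder (uncurryQ w)].

Definition L2Qdot (v w : R -> Rn -> R) : R :=
  L2dot lebQ cylinder (uncurryQ v) (uncurryQ w).

Definition LinftyL2 (w : R -> Rn -> R) : Prop :=
  measurable_fun cylinder (uncurryQ w) /\
  exists M : R, \forall t \ae leb1, I0T t -> (sqO (w t) <= M%:E)%E.

Definition L2Hs (w : R -> Rn -> R) : Prop :=
  [/\ measurable_fun cylinder (uncurryQ w),
      \forall t \ae leb1, I0T t -> Hs (w t) &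
      (\int[leb1]_(t in I0T) Hs_sqnorm (w t) < +oo)%E].

(* Measurability is meant weakly, which for the dual of the separable space
   H^s(Omega) is the same as strongly (Pettis). *)
Definition L2Hms (F : R -> (Rn -> R) -> R) : Prop :=
  [/\ forall v, Hs v -> measurable_fun I0T (fun t => F t v),
      \forall t \ae leb1, I0T t -> Hms (F t) &
      (\int[leb1]_(t in I0T) Hms_sqnorm (F t) < +oo)%E].

Definition CL2 (w : R -> Rn -> R) : Prop :=
  forall t, t \in `[0, T] -> L2O (w t) /\
    sqO (fun x => w r x - w t x) @[r --> within `[0, T] (nbhs t)] --> 0%E.

(* The embedding of L^2(Q) into L^2(0,T; H^{-s}(Omega)). *)
Definition L2Q_functional (z : R -> Rn -> R) : R -> (Rn -> R) -> R :=
  fun t v => ipO (z t) v.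

Definition Gamma (x : R) : R :=
  \int[lebesgue_measure]_(t in `]0, +oo[) (t `^ (x - 1) * expR (- t)).

Definition RL_left (sigma : R) (g : R -> Rn -> R) : R -> Rn -> R :=
  fun t x => (Gamma sigma)^-1 *
    \int[leb1]_(r in `]0, t[) ((t - r) `^ (sigma - 1) * g r x).

Definition RL_right (sigma : R) (g : R -> Rn -> R) : R -> Rn -> R :=
  fun t x => (Gamma sigma)^-1 *
    \int[leb1]_(r in `]t, T[) ((r - t) `^ (sigma - 1) * g r x).

(* F in L^2(0,T; H^{-s}(Omega)) is the derivative of g in the sense of
   H^{-s}(Omega)-valued distributions on (0,T). *)
Definition distr_derivative (g : R -> Rn -> R) (F : R -> (Rn -> R) -> R) :=
  L2Hms F /\
  forall (eta : R -> R) v, test_function (I0T : set R^o) eta -> Hs v ->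
    \int[leb1]_(t in I0T) (derive1 eta t * ipO (g t) v) =
    - \int[leb1]_(t in I0T) (eta t * F t v).

Variable gamma : R.

(* For gamma < 1, d/dt I_t^{1 - gamma} (g - g(0)). *)
Definition caputo_left (g : R -> Rn -> R) (F : R -> (Rn -> R) -> R) : Prop :=
  L2O (g 0) /\
  distr_derivative
    (if gamma == 1 then g
     else RL_left (1 - gamma) (fun t x => g t x - g 0 x)) F.

(* For gamma < 1, - d/dt I_{T-t}^{1 - gamma} (g - g(T)). *)
Definition caputo_right (g : R -> Rn -> R) (F : R -> (Rn -> R) -> R) : Prop :=
  L2O (g T) /\
  distr_derivative
    (if gamma == 1 then fun t x => - g t x
     else fun t x => - RL_right (1 - gamma) (fun t x => g t x - g T x) t x) F.

Definition W (w : R -> Rn -> R) : Prop :=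
  [/\ LinftyL2 w, L2Hs w & exists F, caputo_left w F].

(* A solution is represented by its C([0,T]; L^2(Omega)) representative, which
   gives a meaning to the initial and terminal conditions. *)

Definition state_solution (f z : R -> (Rn -> R) -> R) (u0 : Rn -> R)
    (u : R -> Rn -> R) : Prop :=
  [/\ W u, CL2 u,
      \forall x \ae leb, Omega x -> u 0 x = u0 x &
      exists2 F, caputo_left u F &
        \forall t \ae leb1, I0T t ->
          forall v, Hs v -> F t v + fracL (u t) v = f t v + z t v].

Definition adjoint_solution (ubar ud p : R -> Rn -> R) : Prop :=
  [/\ W p, CL2 p,
      \forall x \ae leb, Omega x -> p T x = 0 &
      exists2 F, caputo_right p F &
        \forall t \ae leb1, I0T t ->
          forall v, Hs v ->
            F t v + fracL (p t) v = ipO (fun x => ubar t x - ud t x) v].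

Definition Zad (a b : R -> Rn -> R) : set (R -> Rn -> R) :=
  [set w | L2Q w /\
    \forall y \ae lebQ, cylinder y ->
      a y.2 y.1 <= w y.2 y.1 <= b y.2 y.1].

Definition cost (mu : R) (ud u z : R -> Rn -> R) : R :=
  2^-1 * \int[leb1]_(t in I0T)
    (fine (sqO (fun x => u t x - ud t x)) + mu * fine (sqO (z t))).

(* S z is required to be the unique solution in W only for admissible z: for
   gamma < 1/2 the state equation is not solvable in W for every right-hand side
   in L^2(0,T; H^{-s}(Omega)), already for a single mode, because the fractional
   integral of order gamma of an L^2(0,T) function need not be bounded. *)
Definition control_to_state (f : R -> (Rn -> R) -> R) (u0 : Rn -> R)
    (a b : R -> Rn -> R) (S : (R -> (Rn -> R) -> R) -> R -> Rn -> R) : Prop :=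
  forall z, Zad a b z ->
    state_solution f (L2Q_functional z) u0 (S (L2Q_functional z)) /\
    forall u, state_solution f (L2Q_functional z) u0 u ->
      \forall y \ae lebQ, cylinder y ->
        u y.2 y.1 = S (L2Q_functional z) y.2 y.1.

Definition optimal_control (mu : R) (ud a b : R -> Rn -> R)
    (S : (R -> (Rn -> R) -> R) -> R -> Rn -> R) (zbar : R -> Rn -> R) : Prop :=
  Zad a b zbar /\ forall z, Zad a b z ->
    cost mu ud (S (L2Q_functional zbar)) zbar <=
    cost mu ud (S (L2Q_functional z)) z.

End space.

(* Main.v *)
Require Import Defs.
From mathcomp Require Import all_boot all_order all_algebra.
From mathcomp Require Import all_classical all_reals all_analysis.
From mathcomp Require Import measurable_realfun.
From mathcomp Require Import ring lra.
Import Order.TTheory GRing.Theory Num.Theory.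
Import numFieldNormedType.Exports.
Set Implicit Arguments.
Unset Strict Implicit.
Unset Printing Implicit Defensive.
Local Open Scope classical_set_scope.
Local Open Scope ring_scope.

(** The idea is to expand everything in the eigenfunctions [phi k], to treat the
    resulting scalar equations by convolution on the time line, and to sum up
    again with Parseval's identity.

    Some multiple of [phi k] lies in the unit ball of H^s ([Hs_unit_multiple]).
    Testing with it turns the equations into scalar ones, in which the fractional
    power of the operator is the multiplication by [lam k `^ s] ([fracL_mode]).
    If y is such a mode and F the mode of its Caputo derivative, then the lemma of
    du Bois-Reymond ([weak_derivative_primitive]) turns the distributional identity
    into an integral equation of Abel type, and Abel's inversion gives
    y - y 0 = convol kappa F almost everywhere. Here kappa is a multiple of
    t ^ (gamma - 1), cut off at T; it is the same for all trajectories and modes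
    ([caputo_inversion], [mode_convolution]). The substitution t -> T - t carries
    the adjoint equation to a forward one, so that an adjoint mode q satisfies the
    same formula after time reversal.

    Convolution with kappa and its time reversal are dual to each other
    ([convol_duality]). For the modes y of u - ubar, d of ubar - ud, zeta of
    z - zbar and q of the adjoint state this means that the integrals of y * d and
    of zeta * q agree ([mode_reciprocity]): the data f and u0 cancel in u - ubar,
    and so do the terms with the eigenvalue. Summation over the modes gives the
    identity (u - ubar, ubar - ud) = (z - zbar, p) in L^2(Q) ([mode_pairing]).

    Hence the cost, which is quadratic, has the exact expansion
    J(u, z) - J(ubar, zbar) = (mu zbar + p, z - zbar)
      + (1/2) (|u - ubar|^2 + mu |z - zbar|^2)
    ([cost_expansion]). The variational inequality makes the right-hand side
    nonnegative. Conversely, in the expansion at zbar + tau (z - zbar) the first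
    term is linear in tau. The second one is quadratic, because a Volterra
    equation has only one solution, whence the state difference is multiplied by
    tau ([state_difference_scaling]). Dividing by tau and letting tau tend to 0
    leaves the variational inequality ([ge0_of_quadratic]). *)

(** * Integrals and square integrable functions *)

Section integral_complements.
Context d (X : measurableType d) (R : realType).
Variable m : {measure set X -> \bar R}.
Implicit Types (D : set X) (f g h : X -> R).

Lemma ae_all (P : X -> Prop) : (forall x, P x) -> {ae m, forall x, P x}.
Proof. by move=> hP; exact: aeW. Qed.

Lemma ae_imp (P Q : X -> Prop) : (forall x, P x -> Q x) ->
  {ae m, forall x, P x} -> {ae m, forall x, Q x}.
Proof. by move=> PQ; apply: filterS. Qed.

Lemma ae_imp2 (P Q S : X -> Prop) : (forall x, P x -> Q x -> S x) ->
  {ae m, forall x, P x} -> {ae m, forall x, Q x} -> {ae m, forall x, S x}.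
Proof. by move=> PQS; apply: filterS2. Qed.

Lemma ae_eq_Rintegral D f g : measurable D ->
  measurable_fun D f -> measurable_fun D g ->
  {ae m, forall x, D x -> f x = g x} ->
  \int[m]_(x in D) f x = \int[m]_(x in D) g x.
Proof.
move=> mD mf mg fg; congr fine; apply: ae_eq_integral => //.
- exact/measurable_EFinP.
- exact/measurable_EFinP.
- by apply: filterS fg => x fgx Dx; rewrite fgx.
Qed.

Lemma EFin_Rintegral D f : measurable D -> m.-integrable D (EFin \o f) ->
  (\int[m]_(x in D) f x)%:E = (\int[m]_(x in D) (f x)%:E)%E.
Proof. by move=> mD intf; rewrite fineK//; exact: integrable_fin_num. Qed.

Lemma integrable_add D f g : measurable D ->
  m.-integrable D (EFin \o f) -> m.-integrable D (EFin \o g) ->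
  m.-integrable D (EFin \o (fun x => f x + g x)).
Proof. by move=> mD; exact: integrableD. Qed.

Lemma integrable_scale D f (k : R) : measurable D ->
  m.-integrable D (EFin \o f) ->
  m.-integrable D (EFin \o (fun x => k * f x)).
Proof. by move=> mD; exact: integrableZl. Qed.

Lemma integrable_sub D f g : measurable D ->
  m.-integrable D (EFin \o f) -> m.-integrable D (EFin \o g) ->
  m.-integrable D (EFin \o (fun x => f x - g x)).
Proof. by move=> mD; exact: integrableB. Qed.

Lemma integrable_le D f g : measurable D -> measurable_fun D f ->
  (forall x, D x -> `|f x| <= g x) -> m.-integrable D (EFin \o g) ->
  m.-integrable D (EFin \o f).
Proof.
move=> mD mf fg; apply: le_integrable => //; first exact/measurable_EFinP.
by move=> x Dx /=; rewrite lee_fin (le_trans (fg _ Dx))// ler_norm.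
Qed.

Lemma integrable_ae_eq D f g : measurable D -> measurable_fun D g ->
  {ae m, forall x, D x -> f x = g x} ->
  m.-integrable D (EFin \o f) -> m.-integrable D (EFin \o g).
Proof.
move=> mD mg fg /integrableP[mf fi]; apply/integrableP; split.
  exact/measurable_EFinP.
move: fi; congr (_ < _)%E; apply: ae_eq_integral => //.
- exact: measurableT_comp.
- by apply: measurableT_comp => //; exact/measurable_EFinP.
- by apply: filterS fg => x fgx Dx; rewrite /= fgx.
Qed.

Lemma ae_le_Rintegral D f g : measurable D ->
  m.-integrable D (EFin \o f) -> m.-integrable D (EFin \o g) ->
  {ae m, forall x, D x -> f x <= g x} ->
  \int[m]_(x in D) f x <= \int[m]_(x in D) g x.
Proof.
move=> mD fi gi fg.
have [mf mg] : measurable_fun D f /\ measurable_fun D g.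
  by split; apply/measurable_EFinP; [exact: measurable_int fi|exact: measurable_int gi].
pose h x := Num.max (f x) (g x).
have mh : measurable_fun D h by exact: measurable_maxr.
have gh : {ae m, forall x, D x -> g x = h x}.
  by apply: ae_imp fg => x fgx Dx; rewrite /h max_r// fgx.
rewrite (ae_eq_Rintegral mD mg mh gh); apply: le_Rintegral => //.
  exact: (integrable_ae_eq mD mh gh gi).
by move=> x _; rewrite /h le_max lexx.
Qed.

Lemma Rintegral_norm_eq0 D f : measurable D -> m.-integrable D (EFin \o f) ->
  \int[m]_(x in D) `|f x| = 0 -> {ae m, forall x, D x -> f x = 0}.
Proof.
move=> mD fi f0; have mf : measurable_fun D (EFin \o f) by case/integrableP : fi.
have : (\int[m]_(x in D) `|(EFin \o f) x| = 0)%E.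
  by rewrite -(EFin_Rintegral mD (integrable_norm fi))/= f0.
move=> /(ae_eq_integral_abs m mD mf); apply: ae_imp => x fx Dx.
by have [] := fx Dx.
Qed.

(** The integral of a nonnegative function is a supremum over simple functions
    below it, hence monotone without measurability. Quantities such as
    [t => Hms_sqnorm (F t)] are not known to be measurable. *)
Lemma ge0_le_integral_nm D (f g : X -> \bar R) :
  (forall x, D x -> 0 <= f x)%E -> (forall x, D x -> f x <= g x)%E ->
  (\int[m]_(x in D) f x <= \int[m]_(x in D) g x)%E.
Proof.
move=> f0 fg.
have fg' x : ((f \_ D) x <= (g \_ D) x)%E.
  by rewrite !patchE; case: ifPn => // /set_mem /fg.
have f0' x : (0 <= (f \_ D) x)%E.
  by rewrite patchE; case: ifPn => // /set_mem /f0.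
rewrite !(integral_mkcond D).
rewrite !ge0_integralTE//; last by move=> x; exact: le_trans (fg' x).
apply: le_ereal_sup => _ [h hf <-]; exists h => // x.
exact: le_trans (hf x) (fg' x).
Qed.

End integral_complements.

Section L2_theory.
Context d (X : measurableType d) (R : realType).
Variable m : {measure set X -> \bar R}.
Variable D : set X.
Hypothesis mD : measurable D.
Implicit Types (f g h : X -> R).

Local Notation L2 := (L2 m D).
Local Notation "<< f , g >>" := (L2dot m D f g).
Local Notation sq := (L2sqnorm m D).

Lemma L2_measurable f : L2 f -> measurable_fun D f.
Proof.
move=> /andP[/[!inE]/= mf _]; exact/(measurable_restrictT _ mD).
Qed.

Lemma L2_integrable f : L2 f -> m.-integrable D (EFin \o (fun x => f x ^+ 2)).
Proof.
move=> /Lfun2_integrable_sqr fi.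
rewrite (integrable_mkcond _ mD); move: fi; congr (integrable _ _ _).
apply/funext => x /=; rewrite !patchE/=; case: ifPn => //.
by rewrite expr0n.
Qed.

Lemma L2_lty f : measurable_fun D f -> (sq f < +oo)%E -> L2 f.
Proof.
move=> mf ffin; rewrite /Defs.L2/= unfold_in /=.
apply/andP; split; rewrite inE/=; first exact/(measurable_restrictT _ mD).
rewrite /finite_norm unlock /=.
rewrite poweR_lty//; move: ffin; congr (_ < _)%E.
rewrite /L2sqnorm integral_mkcond; apply: eq_integral => x _.
rewrite !patchE; case: ifPn => _ /=.
  by rewrite powR_mulrn// -normrX ger0_norm// sqr_ge0.
by rewrite normr0 powR0.
Qed.

Lemma L2_sqr f : measurable_fun D f ->
  m.-integrable D (EFin \o (fun x => f x ^+ 2)) -> L2 f.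
Proof.
move=> mf /integrableP[_ fi]; apply: L2_lty => //; apply: le_lt_trans fi.
by apply: ge0_le_integral_nm => x _; rewrite ?lee_fin ?sqr_ge0// ler_norm.
Qed.

Lemma L2_mul f g : L2 f -> L2 g ->
  m.-integrable D (EFin \o (fun x => f x * g x)).
Proof.
move=> Lf Lg.
apply: (@integrable_le _ _ _ _ _ _ (fun x => f x ^+ 2 + g x ^+ 2)) => //.
- by apply: measurable_funM; exact: L2_measurable.
- move=> x _; rewrite normrM.
  have : 0 <= (`|f x| - `|g x|) ^+ 2 by exact: sqr_ge0.
  have := sqr_ge0 (`|f x|); have := sqr_ge0 (`|g x|).
  rewrite -[f x ^+ 2]real_normK ?num_real// -[g x ^+ 2]real_normK ?num_real//.
  nra.
- by apply: integrable_add => //; exact: L2_integrable.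
Qed.

Lemma L2_add f g : L2 f -> L2 g -> L2 (fun x => f x + g x).
Proof.
move=> Lf Lg; apply: L2_sqr.
  by apply: measurable_funD; exact: L2_measurable.
apply: (@integrable_le _ _ _ _ _ _
  (fun x => f x ^+ 2 + 2 * (f x * g x) + g x ^+ 2)) => //.
- by apply: measurable_funX; apply: measurable_funD; exact: L2_measurable.
- by move=> x _; rewrite ger0_norm ?sqr_ge0// sqrrD mulr2n; lra.
- apply: integrable_add => //; last exact: L2_integrable.
  apply: integrable_add => //; first exact: L2_integrable.
  by apply: integrable_scale => //; exact: L2_mul.
Qed.

Lemma L2_scale k f : L2 f -> L2 (fun x => k * f x).
Proof.
move=> Lf; apply: L2_sqr.
  by apply: measurable_funM => //; exact: L2_measurable.
under eq_fun do rewrite exprMn.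
by apply: integrable_scale => //; exact: L2_integrable.
Qed.

Lemma L2_sub f g : L2 f -> L2 g -> L2 (fun x => f x - g x).
Proof.
move=> Lf Lg; under eq_fun do rewrite -mulN1r.
by apply: L2_add => //; exact: L2_scale.
Qed.

Lemma L2_cst0 : L2 (fun=> 0).
Proof.
apply: L2_lty; first exact: measurable_cst.
by rewrite /L2sqnorm; under eq_integral do rewrite expr0n; rewrite integral0.
Qed.

Lemma L2_sum (I : Type) (s : seq I) (F : I -> X -> R) :
  (forall i, L2 (F i)) -> L2 (fun x => \sum_(i <- s) F i x).
Proof.
move=> LF; elim: s => [|i s IH].
  by under eq_fun do rewrite big_nil; exact: L2_cst0.
by under eq_fun do rewrite big_cons; apply: L2_add.
Qed.

Lemma L2dotC f g : <<f, g>> = <<g, f>>.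
Proof. by apply: eq_Rintegral => x _; rewrite mulrC. Qed.

Lemma L2dotDl f g h : L2 f -> L2 g -> L2 h ->
  <<(fun x => f x + g x), h>> = <<f, h>> + <<g, h>>.
Proof.
move=> Lf Lg Lh; rewrite -RintegralD//; try exact: L2_mul.
by apply: eq_Rintegral => x _; rewrite mulrDl.
Qed.

Lemma L2dotZl k f h : L2 f -> L2 h -> <<(fun x => k * f x), h>> = k * <<f, h>>.
Proof.
move=> Lf Lh; rewrite -RintegralZl//; last exact: L2_mul.
by apply: eq_Rintegral => x _; rewrite mulrA.
Qed.

Lemma L2dotBl f g h : L2 f -> L2 g -> L2 h ->
  <<(fun x => f x - g x), h>> = <<f, h>> - <<g, h>>.
Proof.
move=> Lf Lg Lh; rewrite -RintegralB//; try exact: L2_mul.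
by apply: eq_Rintegral => x _; rewrite mulrBl.
Qed.

Lemma L2dot_suml (I : Type) (s : seq I) (F : I -> X -> R) h :
  (forall i, L2 (F i)) -> L2 h ->
  <<(fun x => \sum_(i <- s) F i x), h>> = \sum_(i <- s) <<F i, h>>.
Proof.
move=> LF Lh; elim: s => [|i s IH].
  rewrite big_nil /L2dot; under eq_Rintegral do rewrite big_nil mul0r.
  by rewrite Rintegral_cst// mul0r.
rewrite big_cons -IH -L2dotDl//; last exact: L2_sum.
by congr L2dot; apply/funext => x; rewrite big_cons.
Qed.

Lemma L2sqnormE f : L2 f -> sq f = (<<f, f>>)%:E.
Proof.
move=> Lf; rewrite EFin_Rintegral//; last exact: L2_mul.
Qed.

Lemma L2dot_ge0 f : 0 <= <<f, f>>.
Proof. by apply: Rintegral_ge0 => x _; rewrite -expr2 sqr_ge0. Qed.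

Lemma L2_CauchySchwarz f g : L2 f -> L2 g -> <<f, g>> ^+ 2 <= <<f, f>> * <<g, g>>.
Proof.
move=> Lf Lg.
have quad (k : R) : 0 <= <<f, f>> - 2 * k * <<f, g>> + k ^+ 2 * <<g, g>>.
  have := L2dot_ge0 (fun x => f x - k * g x).
  have Lk := L2_scale k Lg; have LB := L2_sub Lf Lk.
  rewrite L2dotBl// (L2dotC f) (L2dotC (fun x => k * g x)) !L2dotBl//.
  rewrite !(L2dotZl,L2dotC _ (fun x => k * g x))// (L2dotC g f).
  by move=> h; apply: le_trans h _; rewrite le_eqVlt; apply/orP; left; apply/eqP; ring.
have := L2dot_ge0 g; rewrite le_eqVlt => /orP[/eqP g0|g0]; last first.
  have := quad (<<f, g>> / <<g, g>>).
  set a := <<f, g>>; set b := <<g, g>>; set c := <<f, f>>.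
  have -> : c - 2 * (a / b) * a + (a / b) ^+ 2 * b = (c * b - a ^+ 2) / b.
    by field; rewrite gt_eqF.
  by rewrite pmulr_lge0 ?invr_gt0// subr_ge0.
rewrite -g0 mulr0.
suff -> : <<f, g>> = 0 by rewrite expr0n.
apply/eqP/negP => /negP fg0.
(* If <<g, g>> = 0, the quadratic is affine and equals -1 at this point. *)
have := quad ((<<f, f>> + 1) / (2 * <<f, g>>)).
rewrite -g0 mulr0 addr0.
have -> : 2 * ((<<f, f>> + 1) / (2 * <<f, g>>)) * <<f, g>> = <<f, f>> + 1.
  by field.
lra.
Qed.

(** Cauchy-Schwarz, stated along a filter: it serves for the convergence of the
    eigenfunction expansion and for continuity in time. *)
Lemma L2dot_cvg0 (I : Type) (F : set_system I) (FF : Filter F) (f : I -> X -> R) g :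
  (forall i, L2 (f i)) -> L2 g ->
  sq (f i) @[i --> F] --> 0%E -> <<f i, g>> @[i --> F] --> 0.
Proof.
move=> Lf Lg f0.
have {}f0 : <<f i, f i>> @[i --> F] --> 0.
  move/fine_cvg : f0; rewrite (_ : fine \o _ = fun i => <<f i, f i>>)//.
apply: norm_cvg0.
have h : Num.sqrt (<<f i, f i>> * <<g, g>>) @[i --> F] --> 0.
  rewrite -[X in _ --> X]sqrtr0 -[X in Num.sqrt X](mul0r <<g, g>>).
  apply: (@cvg_comp _ _ _ _ _ _ (nbhs (0 * <<g, g>>))).
    by apply: cvgM f0 _; exact: cvg_cst.
  exact: sqrt_continuous.
apply: squeeze_cvgr (cvg_cst 0) h; near=> i.
rewrite normr_ge0/= -sqrtr_sqr ler_sqrt ?L2_CauchySchwarz//.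
by rewrite mulr_ge0// L2dot_ge0.
Unshelve. all: by end_near. Qed.

End L2_theory.

Section Rintegral_total.
Context d (X : measurableType d) (R : realType) (m : {measure set X -> \bar R}).
Variables (D : set X) (mD : measurable D).
Implicit Types f : X -> R.

(** The real-valued integral is the image by [fine] of the extended one, and
    [fine] sends infinite values to 0. Thanks to this convention the next lemmas
    hold for divergent integrals too. *)
Lemma Rintegral_nonintegrable f : measurable_fun D f ->
  ~ m.-integrable D (EFin \o f) -> \int[m]_(x in D) f x = 0.
Proof.
move=> mf nf; rewrite /Rintegral.
have : ~~ ((\int[m]_(x in D) (f x)%:E)%E \is a fin_num).
  apply/negP => ffin; apply: nf; apply/integrableP; split.
    exact/measurable_EFinP.
  by rewrite integral_fin_num_abs.
by case: (integral _ _ _).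
Qed.

Lemma Rintegral_scale (k : R) f : measurable_fun D f ->
  \int[m]_(x in D) (k * f x) = k * \int[m]_(x in D) f x.
Proof.
move=> mf; have [->|k0] := eqVneq k 0.
  by under eq_Rintegral do rewrite mul0r; rewrite Rintegral_cst// !mul0r.
have [fi|fi] := pselect (m.-integrable D (EFin \o f)); first exact: RintegralZl.
rewrite !Rintegral_nonintegrable ?mulr0//; first exact: measurable_funM.
move=> kfi; apply: fi; have := integrable_scale (k^-1) mD kfi.
by congr (integrable _ _ _); apply/funext => x /=; rewrite mulrA mulVf// mul1r.
Qed.

Lemma norm_Rintegral_le f : measurable_fun D f ->
  `|\int[m]_(x in D) f x| <= \int[m]_(x in D) `|f x|.
Proof.
move=> mf; have [fi|fi] := pselect (m.-integrable D (EFin \o f)).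
  exact: le_normr_Rintegral.
by rewrite Rintegral_nonintegrable// normr0 Rintegral_ge0.
Qed.

End Rintegral_total.

Section opposite.
Context d (X : measurableType d) (R : realType) (m : {measure set X -> \bar R}).
Variable D : set X.

(** Exchanging positive and negative parts; when one of the two
    is infinite both sides are 0, so the identity holds for any function. *)
Lemma Rintegral_opp (f : X -> R) :
  \int[m]_(x in D) (- f x) = - \int[m]_(x in D) f x.
Proof.
rewrite /Rintegral integralE [in RHS]integralE.
have -> : (\int[m]_(x in D) (fun x => (- f x)%:E)^\+ x =
    \int[m]_(x in D) (fun x => (f x)%:E)^\- x)%E.
  by apply: eq_integral => x _; rewrite funeposE funenegE.
have -> : (\int[m]_(x in D) (fun x => (- f x)%:E)^\- x =
    \int[m]_(x in D) (fun x => (f x)%:E)^\+ x)%E.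
  by apply: eq_integral => x _; rewrite funeposE funenegE /= opprK.
move: (\int[m]_(x in D) _)%E (\int[m]_(x in D) _)%E => [x| |] [y| |] //=; rewrite ?oppr0//.
by rewrite opprB.
Qed.

Lemma L2dot_oppl f g : L2dot m D (fun x => - f x) g = - L2dot m D f g.
Proof. by rewrite -Rintegral_opp; apply: eq_Rintegral => x _; rewrite mulNr. Qed.

End opposite.

Section lower_integral.
Import HBNNSimple.
Context d (X : measurableType d) (R : realType) (m : {measure set X -> \bar R}).
Variable D : set X.

(** Simple functions below the square of [a * f] are, up to the factor [a ^+ 2],
    simple functions below the square of [f]. The inequality thus holds for
    any [f], which is convenient for limits of H^1 approximations. *)
Lemma L2sqnorm_scale_le a (f : X -> R) :
  (L2sqnorm m D (fun x => a * f x)%R <= (a ^+ 2)%:E * L2sqnorm m D f)%E.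
Proof.
have [->|a0] := eqVneq a 0.
  rewrite expr0n mul0e /L2sqnorm; under eq_integral do rewrite mul0r expr0n.
  by rewrite integral0.
have a20 : 0 < a ^+ 2 by rewrite exprn_even_gt0.
have f20 x : (0 <= ((f x ^+ 2)%:E : \bar R))%E by rewrite lee_fin sqr_ge0.
rewrite /L2sqnorm.
rewrite [leLHS]integral_mkcond [in leRHS]integral_mkcond.
have p0 g x : (0 <= ((fun x => (g x ^+ 2)%:E) \_ D) x :> \bar R)%E.
  by rewrite patchE; case: ifP => // _; rewrite lee_fin sqr_ge0.
rewrite [leLHS]ge0_integralTE; last exact: p0.
apply: ge_ereal_sup => _ [h hf <-].
rewrite -integralT_nnsfun -lee_pdivrMl//.
have ia : (0 <= ((a ^+ 2)^-1)%:E :> \bar R)%E by rewrite lee_fin invr_ge0 ltW.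
rewrite -ge0_integralZl//; last 2 first.
- exact/measurable_EFinP.
- by move=> x _; rewrite lee_fin.
apply: ge0_le_integral_nm => x _.
  by rewrite mule_ge0// lee_fin.
rewrite lee_pdivrMl//; apply: le_trans (hf x) _.
rewrite !patchE; case: ifP => _; last by rewrite mule0.
by rewrite -EFinM exprMn.
Qed.

End lower_integral.

(** * Affine changes of variable on the line *)

Section affine_change_of_variable.
Context (R : realType).
Local Notation mu := (@lebesgue_measure R).

Let aff (k b : R) (x : R) : measurableTypeR R := k * x + b.

Let maff k b : measurable_fun [set: R] (aff k b).
Proof. by apply: measurable_funD => //; exact: measurable_funM. Qed.

Let affm k b := measure_function_pushforward__canonical__measure_function_Measure
  mu (maff k b).
Let lebesgue_aff (k b : R) (k0 : 0 < k) A : measurable A ->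
  mu A = mscale (NngNum (ltW k0)) (affm k b) A.
Proof.
move: A; apply: lebesgue_measure_unique => //= _ [[x y] _ <-] /=.
rewrite /mscale/= /pushforward.
rewrite (_ : aff k b @^-1` _ = `](x - b) / k, (y - b) / k]%classic); last first.
  apply/seteqP; split => z /=; rewrite !in_itv/= /aff.
    by rewrite ltr_pdivrMr// ler_pdivlMr// => /andP[? ?]; apply/andP; split; lra.
  by rewrite ltr_pdivrMr// ler_pdivlMr// => /andP[? ?]; apply/andP; split; lra.
rewrite !lebesgue_measure_itv/= !lte_fin.
rewrite ltr_pM2r ?invr_gt0// ltrD2r; case: ifPn => xy; last by rewrite mule0.
by rewrite -!EFinB -EFinM; congr EFin; field; rewrite gt_eqF.
Qed.

(** Lebesgue measure is determined by its values on intervals, so it agrees with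
    the rescaled image measure. *)
Lemma ge0_integral_affine (k b : R) (f : R -> \bar R) : 0 < k ->
  measurable_fun [set: R] f -> (forall x, 0 <= f x)%E ->
  (k%:E * \int[mu]_x f (k * x + b)%R = \int[mu]_x f x)%E.
Proof.
move=> k0 mf f0; rewrite [RHS](eq_measure_integral
  (mscale (NngNum (ltW k0)) (affm k b))); last first.
  by move=> A mA _; exact: lebesgue_aff.
rewrite ge0_integral_mscale//=; congr (_ * _)%E.
by rewrite ge0_integral_pushforward//=; exact: maff.
Qed.

Lemma ge0_integral_reflection (b : R) (f : R -> \bar R) :
  measurable_fun [set: R] f -> (forall x, 0 <= f x)%E ->
  (\int[mu]_x f (b - x)%R = \int[mu]_x f x)%E.
Proof.
move=> mf f0; rewrite -[RHS](@ge0_integral_affine 1 b)// mul1e.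
pose opp := -%R : R -> measurableTypeR R.
have mopp : measurable_fun [set: R] opp. exact: oppr_measurable.
rewrite [RHS](eq_measure_integral (
  measure_function_pushforward__canonical__measure_function_Measure
  mu mopp)); last by move=> A mA _; apply: esym; exact: lebesgue_measureN.
rewrite ge0_integral_pushforward//=.
- by apply: eq_integral => x _; rewrite /opp mul1r addrC.
- by apply: measurableT_comp => //; apply: measurable_funD.
Qed.

Let measurable_reflection (b : R) (f : R -> R) : measurable_fun [set: R] f ->
  measurable_fun [set: R] (fun x => f (b - x)).
Proof. by move=> mf; apply: measurableT_comp => //; by apply: measurable_funB. Qed.

Lemma Rintegral_reflection (b : R) (f : R -> R) : measurable_fun [set: R] f ->
  \int[mu]_x f (b - x) = \int[mu]_x f x.
Proof.
move=> mf; rewrite /Rintegral [in LHS]integralE [in RHS]integralE.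
have mE : measurable_fun [set: R] (EFin \o f) by exact/measurable_EFinP.
congr (fine (_ - _)%E).
- transitivity (\int[mu]_x (EFin \o f)^\+%E (b - x)%R)%E.
    by apply: eq_integral => x _; rewrite !funeposE.
  by rewrite ge0_integral_reflection//; exact: measurable_funepos.
- transitivity (\int[mu]_x (EFin \o f)^\-%E (b - x)%R)%E.
    by apply: eq_integral => x _; rewrite !funenegE.
  by rewrite ge0_integral_reflection//; exact: measurable_funeneg.
Qed.

Lemma integrable_reflection (b : R) (f : R -> R) :
  mu.-integrable [set: R] (EFin \o f) ->
  mu.-integrable [set: R] (EFin \o (fun x => f (b - x))).
Proof.
move=> /integrableP[/measurable_EFinP mf fi]; apply/integrableP; split.
  by apply/measurable_EFinP; apply: measurable_reflection.
rewrite (@ge0_integral_reflection b (fun x => `|(EFin \o f) x|%E))//.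
by apply/measurable_EFinP; exact: measurableT_comp.
Qed.

End affine_change_of_variable.

Section reflection.
Import HBNNSimple.
Context (R : realType).
Local Notation mu := (@lebesgue_measure R).
Local Notation mR := (measurableTypeR R).

(** Both sides are suprema of integrals of simple functions below the integrand,
    and reflection permutes these. As no measurability enters, this applies to the
    Riemann-Liouville integrals of a trajectory at once. *)
Lemma lower_integral_reflection (b : R) (f : R -> \bar R) : (forall x, 0 <= f x)%E ->
  (\int[mu]_x f (b - x)%R = \int[mu]_x f x)%E.
Proof.
have le (g : R -> \bar R) : (forall x, 0 <= g x)%E ->
    (\int[mu]_x g x <= \int[mu]_x g (b - x)%R)%E.
  move=> g0; rewrite [leLHS]ge0_integralTE//; apply: ge_ereal_sup => _ [h hg <-].
  rewrite -integralT_nnsfun.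
  have mh : measurable_fun [set: mR] (fun x : mR => (h x)%:E) by exact/measurable_EFinP.
  have h0 x : (0 <= (h x)%:E :> \bar R)%E by rewrite lee_fin.
  rewrite -(ge0_integral_reflection b mh h0).
  by apply: ge0_le_integral_nm => x _; [rewrite lee_fin|exact: hg].
move=> f0; apply/eqP; rewrite eq_le le// andbT.
apply: le_trans (le _ (fun x => f0 (b - x))) _.
by under eq_integral do rewrite subKr.
Qed.

Lemma Rintegral_itv_reflection (c a b : R) (f : R -> R) :
  \int[mu]_(r in (`]a, b[%classic : set mR)) f r =
  \int[mu]_(r in (`]c - b, c - a[%classic : set mR)) f (c - r).
Proof.
rewrite Rintegral_mkcond [RHS]Rintegral_mkcond.
set F := f \_ _.
have GE : (fun r => f (c - r)) \_ `]c - b, c - a[ = fun r => F (c - r).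
  apply/funext => r; rewrite /F !patchE.
  congr (if _ then _ else _); apply/idP/idP; rewrite !inE/= !in_itv/= => /andP[? ?];
    by apply/andP; split; lra.
rewrite GE /Rintegral [in LHS]integralE [in RHS]integralE; congr (fine (_ - _)%E).
  by rewrite -(lower_integral_reflection c)//; apply: eq_integral => x _; rewrite !funeposE.
by rewrite -(lower_integral_reflection c)//; apply: eq_integral => x _; rewrite !funenegE.
Qed.

End reflection.

(** * Fubini and convolution on the line *)

Section real_Fubini.
Context d1 d2 (X : measurableType d1) (Y : measurableType d2) (R : realType).
Variables (m1 : {sigma_finite_measure set X -> \bar R}).
Variables (m2 : {sigma_finite_measure set Y -> \bar R}).
Variable f : X * Y -> R.
Hypothesis intf : (m1 \x m2)%E.-integrable [set: X * Y] (EFin \o f).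

Let FE x : (\int[m2]_y f (x, y))%R = fine (fubini_F m2 (EFin \o f) x).
Proof. by []. Qed.

Let GE y : (\int[m1]_x f (x, y))%R = fine (fubini_G m1 (EFin \o f) y).
Proof. by []. Qed.

Let F_fin : {ae m1, forall x, fubini_F m2 (EFin \o f) x \is a fin_num}.
Proof.
have := integrable_ae measurableT (integrable_fubini_F intf).
by apply: filterS => x /(_ Logic.I).
Qed.

Let int_fubini_G : m2.-integrable [set: Y] (fubini_G m1 (EFin \o f)).
Proof.
apply/integrableP; split; first exact: (measurable_fubini_G intf).
have mf := measurable_int _ intf.
apply: le_lt_trans ((integrable21ltyP m1 m2 mf).1 intf).
apply: ge0_le_integral_nm => // y _; apply: le_abse_integral => //.
exact: (measurableT_comp mf (pair2_measurable y)).
Qed.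

Let G_fin : {ae m2, forall y, fubini_G m1 (EFin \o f) y \is a fin_num}.
Proof.
have := integrable_ae measurableT int_fubini_G.
by apply: filterS => x /(_ Logic.I).
Qed.

Lemma measurable_Rintegral_snd :
  measurable_fun [set: X] (fun x => \int[m2]_y f (x, y)).
Proof.
apply: measurableT_comp; first exact: fine_measurable.
exact: (measurable_fubini_F intf).
Qed.

Lemma measurable_Rintegral_fst :
  measurable_fun [set: Y] (fun y => \int[m1]_x f (x, y)).
Proof.
apply: measurableT_comp; first exact: fine_measurable.
exact: (measurable_fubini_G intf).
Qed.

Lemma Rintegral_snd_integrable :
  m1.-integrable [set: X] (EFin \o (fun x => \int[m2]_y f (x, y))).
Proof.
have /integrableP[mF Ffin] := integrable_fubini_F intf.
apply/integrableP; split; first exact/measurable_EFinP/measurable_Rintegral_snd.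
apply: le_lt_trans Ffin; apply: ge0_le_integral_nm => // x _ /=.
rewrite FE; case: (fubini_F _ _ _) => [r| |] //=; rewrite ?normr0 ?leey//.
Qed.

Lemma Rintegral_fst_integrable :
  m2.-integrable [set: Y] (EFin \o (fun y => \int[m1]_x f (x, y))).
Proof.
have /integrableP[mF Ffin] := int_fubini_G.
apply/integrableP; split; first exact/measurable_EFinP/measurable_Rintegral_fst.
apply: le_lt_trans Ffin; apply: ge0_le_integral_nm => // x _ /=.
rewrite GE; case: (fubini_G _ _ _) => [r| |] //=; rewrite ?normr0 ?leey//.
Qed.

Lemma Rintegral12_prod :
  \int[m1]_x (\int[m2]_y f (x, y)) = \int[(m1 \x m2)%E]_z f z.
Proof.
congr fine; rewrite -(integral12_prod_meas1 intf); apply: ae_eq_integral => //.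
- exact/measurable_EFinP/measurable_Rintegral_snd.
- exact: (measurable_fubini_F intf).
- by apply: filterS F_fin => x Fx _; rewrite FE fineK.
Qed.

Lemma Rintegral21_prod :
  \int[m2]_y (\int[m1]_x f (x, y)) = \int[(m1 \x m2)%E]_z f z.
Proof.
congr fine; rewrite -(integral21_prod_meas1 intf); apply: ae_eq_integral => //.
- exact/measurable_EFinP/measurable_Rintegral_fst.
- exact: (measurable_fubini_G intf).
- by apply: filterS G_fin => x Fx _; rewrite GE fineK.
Qed.

Lemma RFubini :
  \int[m1]_x (\int[m2]_y f (x, y)) = \int[m2]_y (\int[m1]_x f (x, y)).
Proof. by rewrite Rintegral12_prod Rintegral21_prod. Qed.

End real_Fubini.

Section convolution.
Context (R : realType).
Local Notation mu := (@lebesgue_measure R).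
Local Notation int f := (mu.-integrable [set: R] (EFin \o f)).
Implicit Types (k l f g : R -> R).

Definition convol k f (t : R) : R := \int[mu]_r (k (t - r) * f r).

Lemma measurable_subr_fun k : measurable_fun [set: R] k ->
  measurable_fun [set: R * R] (fun z : R * R => k (z.1 - z.2)).
Proof. by move=> mk; apply: measurableT_comp => //; exact: measurable_funB. Qed.

Lemma measurable_reflect k t : measurable_fun [set: R] k ->
  measurable_fun [set: R] (fun r => k (t - r)).
Proof. by move=> mk; apply: measurableT_comp => //; exact: measurable_funB. Qed.

Lemma measurable_translate k t : measurable_fun [set: R] k ->
  measurable_fun [set: R] (fun r => k (r - t)).
Proof. by move=> mk; apply: measurableT_comp => //; exact: measurable_funB. Qed.

Lemma int_measurable f : int f -> measurable_fun [set: R] f.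
Proof. by move=> /integrableP[/measurable_EFinP]. Qed.

Lemma ge0_integral_translation (b : R) (f : R -> \bar R) :
  measurable_fun [set: R] f -> (forall x, 0 <= f x)%E ->
  (\int[mu]_x f (x - b)%R = \int[mu]_x f x)%E.
Proof.
move=> mf f0; rewrite -[RHS](@ge0_integral_affine _ 1 (- b))// mul1e.
by apply: eq_integral => x _; rewrite mul1r.
Qed.

(** Tonelli's theorem: the double integral of the norm is the product of the two
    L^1 norms. Everything below about convolutions of integrable functions rests
    on this. *)
Lemma convol_kernel_integrable k f : int k -> int f ->
  (mu \x mu)%E.-integrable [set: R * R]
    (EFin \o (fun z : R * R => k (z.1 - z.2) * f z.2)).
Proof.
move=> ik f_int.
have mk := int_measurable ik; have mf := int_measurable f_int.
have mkf : measurable_fun [set: R * R] (fun z : R * R => k (z.1 - z.2) * f z.2).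
  apply: measurable_funM; first exact: measurable_subr_fun.
  exact: measurableT_comp.
apply/integrable21ltyP; first exact/measurable_EFinP.
under eq_integral => r _.
  under eq_integral do rewrite /= normrM EFinM.
  rewrite ge0_integralZr//=; last first.
    apply/measurable_EFinP/measurableT_comp => //; exact: measurable_translate.
  rewrite (@ge0_integral_translation r (fun x => `|k x|%:E))//; last first.
    exact/measurable_EFinP/measurableT_comp.
  over.
rewrite ge0_integralZl//=; last 2 first.
  exact/measurable_EFinP/measurableT_comp.
  by apply: integral_ge0 => x _.
move/integrableP : ik => [_ ik]; move/integrableP : f_int => [_ fi].
by apply: lte_mul_pinfty => //; rewrite ?integral_ge0// ge0_fin_numE// integral_ge0.
Qed.

Lemma convol_integrable k f : int k -> int f -> int (convol k f).
Proof. by move=> ik f_int; exact: (Rintegral_snd_integrable (convol_kernel_integrable ik f_int)). Qed.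

Lemma convol_ae_integrable k f : int k -> int f ->
  {ae mu, forall t, int (fun r => k (t - r) * f r)}.
Proof. by move=> ik f_int; exact: (ae_integrable1 (convol_kernel_integrable ik f_int)). Qed.

Lemma Rintegral_translation (b : R) f : measurable_fun [set: R] f ->
  \int[mu]_x f (x - b) = \int[mu]_x f x.
Proof.
move=> mf; rewrite -[RHS](Rintegral_reflection (- b))//.
rewrite -[RHS](Rintegral_reflection 0)//; last exact: measurable_reflect.
by apply: eq_Rintegral => x _; congr f; lra.
Qed.

Lemma convolC k f t : measurable_fun [set: R] k -> measurable_fun [set: R] f ->
  convol k f t = convol f k t.
Proof.
move=> mk mf; rewrite /convol.
rewrite -(Rintegral_reflection t)/=.
  by apply: eq_Rintegral => r _; rewrite mulrC; congr (_ * k _); lra.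
by apply: measurable_funM => //; exact: measurable_reflect.
Qed.

Lemma convolA k l f : int k -> int l -> int f ->
  {ae mu, forall t, convol k (convol l f) t = convol (convol k l) f t}.
Proof.
move=> ik il f_int.
have mk := int_measurable ik; have mf := int_measurable f_int.
have ml := int_measurable il.
have [ikn iln ifn] : [/\ int (Num.norm \o k), int (Num.norm \o l) & int (Num.norm \o f)].
  by split; exact: integrable_norm.
have ilf := convol_kernel_integrable iln ifn.
have iclf := convol_integrable iln ifn.
have lf_fin : {ae mu, forall u,
    (\int[mu]_r `|l (u - r) * f r|%:E = (convol (Num.norm \o l) (Num.norm \o f) u)%:E)%E}.
  apply: ae_imp (convol_ae_integrable iln ifn) => u hu.
  rewrite EFin_Rintegral//; apply: eq_integral => r _ /=.
  by rewrite normrM.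
apply: ae_imp (convol_ae_integrable ikn iclf) => t kt.
pose h (w : R * R) := k (t - w.1) * (l (w.1 - w.2) * f w.2).
have mlf : measurable_fun [set: R * R] (fun w : R * R => l (w.1 - w.2) * f w.2).
  apply: measurable_funM; first exact: measurable_subr_fun.
  exact: measurableT_comp.
have mh : measurable_fun [set: R * R] h.
  apply: measurable_funM => //.
  exact: (measurableT_comp (measurable_reflect t mk) measurable_fst).
(* At such [t] the double integral of [h] converges absolutely: its inner integral
   is, up to the factor k, the convolution of the norms of [l] and [f] for almost every [u]. *)
have ht : (mu \x mu)%E.-integrable [set: R * R] (EFin \o h).
  apply/integrable12ltyP; first exact/measurable_EFinP.
  have /integrableP[mkt] := kt; apply: le_lt_trans.
  rewrite le_eqVlt; apply/orP; left; apply/eqP.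
  transitivity (\int[mu]_u (`|k (t - u)|%:E * \int[mu]_r `|l (u - r) * f r|%:E))%E.
    apply: eq_integral => u _; rewrite -ge0_integralZl//=.
    - by apply: eq_integral => r _; rewrite /h normrM EFinM.
    - apply/measurable_EFinP/measurableT_comp => //.
      by apply: measurable_funM => //; exact: measurable_reflect.
  apply: ae_eq_integral => //.
  - apply: emeasurable_funM.
      by apply/measurable_EFinP/measurableT_comp => //; exact: measurable_reflect.
    pose H (w : R * R) := `|l (w.1 - w.2) * f w.2|%:E.
    have mH : measurable_fun [set: R * R] H.
      exact/measurable_EFinP/measurableT_comp.
    have H0 w : (0 <= H w)%E by rewrite lee_fin.
    exact: (measurable_fun_fubini_tonelli_F (m2 := mu) H mH H0).
  - exact: measurableT_comp.
  apply: ae_imp lf_fin => u -> _ /=.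
  rewrite -EFinM [X in _ = X%:E]ger0_norm// mulr_ge0//.
  by apply: Rintegral_ge0 => x _ /=; rewrite mulr_ge0.
rewrite /convol; transitivity (\int[mu]_u (\int[mu]_r h (u, r))).
  apply: eq_Rintegral => u _; rewrite -Rintegral_scale//.
  by apply: measurable_funM => //; exact: measurable_reflect.
rewrite (RFubini ht)//; apply: eq_Rintegral => r _.
rewrite mulrC -Rintegral_scale//; last first.
  by apply: measurable_funM => //; exact: measurable_reflect.
rewrite -[RHS](Rintegral_translation r); last first.
  apply: measurable_funM => //; apply: measurable_funM => //.
  exact: measurable_reflect.
apply: eq_Rintegral => u _; rewrite /h/=.
have -> : t - r - (u - r) = t - u by lra.
by ring.
Qed.

Lemma convol_L1_norm k f : int k -> int f ->
  \int[mu]_t `|convol k f t| <= (\int[mu]_t `|k t|) * (\int[mu]_t `|f t|).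
Proof.
move=> ik f_int.
have ikn := integrable_norm ik; have ifn := integrable_norm f_int.
have mk := int_measurable ik; have mf := int_measurable f_int.
have iconv := convol_kernel_integrable ikn ifn.
apply: (@le_trans _ _ (\int[mu]_t convol (Num.norm \o k) (Num.norm \o f) t)).
  apply: le_Rintegral => //.
  - exact/integrable_norm/convol_integrable.
  - exact: convol_integrable.
  move=> t _; apply: le_trans; first apply: norm_Rintegral_le => //.
    by apply: measurable_funM => //; exact: measurable_reflect.
  by under eq_Rintegral do rewrite normrM.
rewrite /convol (RFubini iconv)/=.
rewrite -Rintegral_scale//; last exact: measurableT_comp.
rewrite le_eqVlt; apply/orP; left; apply/eqP; apply: eq_Rintegral => r _; rewrite mulrC.
rewrite -(@Rintegral_translation r (Num.norm \o k)); last exact: measurableT_comp.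
rewrite -Rintegral_scale//; last first.
  apply: (@measurable_translate (Num.norm \o k)); exact: measurableT_comp.
by apply: eq_Rintegral => t _; rewrite mulrC.
Qed.

Definition causal f := forall t, t <= 0 -> f t = 0.

Lemma convol_causal k f : causal k -> causal f -> causal (convol k f).
Proof.
move=> ck cf t t0; rewrite /convol (@eq_Rintegral _ _ _ mu setT (cst 0)).
  by rewrite Rintegral_cst// mul0r.
move=> r _; have [r0|r0] := leP r 0; first by rewrite cf// mulr0.
by rewrite ck ?mul0r//; lra.
Qed.

(** For causal functions the convolution at [t] only sees values before [t]. This
    is why kernels may be cut off at [T]. *)
Lemma convol_local T k k' f f' : 0 < T -> causal k -> causal f ->
  (forall t, t < T -> k t = k' t) -> (forall t, t < T -> f t = f' t) ->
  forall t, t < T -> convol k f t = convol k' f' t.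
Proof.
move=> T0 ck cf kk ff t tT; apply: eq_Rintegral => r _.
have [r0|r0] := leP r 0.
  by rewrite -ff ?(le_lt_trans r0)// cf// !mulr0.
rewrite -kk; last by lra.
have [rT|rT] := ltP r T; first by rewrite ff.
by rewrite ck ?mul0r//; lra.
Qed.

Lemma convol_scaler k f (a : R) t : measurable_fun [set: R] k ->
  measurable_fun [set: R] f -> convol k (fun r => a * f r) t = a * convol k f t.
Proof.
move=> mk mf; rewrite /convol -Rintegral_scale//.
  by apply: eq_Rintegral => r _; rewrite mulrCA.
by apply: measurable_funM => //; exact: measurable_reflect.
Qed.

(** Young's inequality in the form |k f g| <= |k| (f^2 + g^2), with [f] and [g]
    taken at the two time variables. *)
Lemma convol_square_kernel k f g : int k ->
  measurable_fun [set: R] f -> int (fun t => f t ^+ 2) ->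
  measurable_fun [set: R] g -> int (fun t => g t ^+ 2) ->
  (mu \x mu)%E.-integrable [set: R * R]
    (EFin \o (fun z : R * R => k (z.1 - z.2) * (f z.2 * g z.1))).
Proof.
move=> ik mf if2 mg ig2.
have mk := int_measurable ik; have ikn := integrable_norm ik.
have mkn := int_measurable ikn.
have i1 := convol_kernel_integrable ikn if2.
have i2 : (mu \x mu)%E.-integrable [set: R * R]
    (EFin \o (fun z : R * R => (Num.norm \o k) (z.1 - z.2) * g z.1 ^+ 2)).
  apply/integrable12ltyP.
    apply/measurable_EFinP/measurable_funM.
      exact: (measurable_subr_fun mkn).
    apply: measurable_funX; exact: (measurableT_comp mg measurable_fst).
  under eq_integral => t _.
    under eq_integral do rewrite /= normrM normr_id (ger0_norm (sqr_ge0 _)) EFinM.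
    rewrite ge0_integralZr//=; last 2 first.
      apply/measurable_EFinP; exact: (measurable_reflect t mkn).
      by rewrite lee_fin sqr_ge0.
    rewrite (@ge0_integral_reflection _ t (fun x => `|k x|%:E))//; last first.
      exact/measurable_EFinP.
    over.
  rewrite ge0_integralZl//=; last 3 first.
    by apply/measurable_EFinP; exact: measurable_funX.
    by move=> x _; rewrite lee_fin sqr_ge0.
    by apply: integral_ge0 => x _.
  move/integrableP : ik => [_ ik]; move/integrableP : ig2 => [_ fi].
  apply: lte_mul_pinfty => //; rewrite ?integral_ge0//.
    by rewrite ge0_fin_numE// integral_ge0.
  apply: le_lt_trans fi; apply: ge0_le_integral_nm => x _.
    by rewrite lee_fin sqr_ge0.
  by rewrite lee_fin ler_norm.
apply: (integrable_le _ _ _ (integrable_add _ i1 i2)) => //.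
  apply: measurable_funM; first exact: measurable_subr_fun.
  apply: measurable_funM; first exact: (measurableT_comp mf measurable_snd).
  exact: (measurableT_comp mg measurable_fst).
move=> [t r] _ /=; rewrite -mulrDr normrM ler_wpM2l// normrM.
have := sqr_ge0 (`|f r| - `|g t|); have := sqr_ge0 (`|f r|).
have := sqr_ge0 (`|g t|).
rewrite -[f r ^+ 2]real_normK ?num_real// -[g t ^+ 2]real_normK ?num_real//.
nra.
Qed.

(** The transpose of the convolution with [k] is its conjugate by the time
    reversal t -> T - t. This is how the backward adjoint equation meets the
    forward state equation. *)
Lemma convol_duality T k f g : int k ->
  measurable_fun [set: R] f -> int (fun t => f t ^+ 2) ->
  measurable_fun [set: R] g -> int (fun t => g t ^+ 2) ->
  \int[mu]_t (convol k f t * g t) =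
  \int[mu]_r (f r * convol k (fun t => g (T - t)) (T - r)).
Proof.
move=> ik mf if2 mg ig2; have mk := int_measurable ik.
transitivity (\int[mu]_t (\int[mu]_r (k (t - r) * (f r * g t)))).
  apply: eq_Rintegral => t _; rewrite mulrC -Rintegral_scale//; last first.
    by apply: measurable_funM => //; exact: measurable_reflect.
  by apply: eq_Rintegral => r _; ring.
rewrite (RFubini (convol_square_kernel ik mf if2 mg ig2))/=.
apply: eq_Rintegral => r _; rewrite -Rintegral_scale//; last first.
  by apply: measurable_funM; exact: measurable_reflect.
rewrite -[LHS](Rintegral_reflection T); last first.
  apply: measurable_funM; first exact: measurable_translate.
  exact: measurable_funM.
apply: eq_Rintegral => t _.
have -> : T - t - r = T - r - t by lra.
by ring.
Qed.

Lemma convol_continuous T k f (M : R) : int k -> causal k ->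
  measurable_fun [set: R] f -> (forall t, `|f t| <= M) ->
  (forall t, t < T -> {for t, continuous f}) ->
  forall t, t < T -> {for t, continuous (convol k f)}.
Proof.
move=> ik ck mf fM cf t tT.
have mk := int_measurable ik.
have -> : convol k f = fun t => \int[mu]_r (k r * f (t - r)).
  by apply/funext => x; rewrite convolC//; apply: eq_Rintegral => r _; rewrite mulrC.
have M0 : 0 <= M by exact: le_trans (fM 0).
have ikM : int (fun r => M * `|k r|) by apply: integrable_scale => //; exact: integrable_norm.
have mkf x : measurable_fun [set: R] (fun r => k r * f (x - r)).
  by apply: measurable_funM => //; exact: measurable_reflect.
have dom x r : `|k r * f (x - r)| <= M * `|k r|.
  by rewrite normrM mulrC ler_wpM2r.
have ikf x : int (fun r => k r * f (x - r)).
  apply: integrable_le; [exact: measurableT|exact: mkf| |exact: ikM].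
  by move=> r _; exact: dom.
apply: (@continuity_under_integral R _ _ mu (fun x r => k r * f (x - r))
  [set: R] measurableT (t - 1) T _ _ (fun r => M * `|k r|)) => //.
- apply: ae_all => r _ x /set_mem; rewrite /= in_itv/= => /andP[_ xT].
  have [r0|r0] := leP r 0.
    rewrite /= (ck _ r0) /continuous_at mul0r.
    by under eq_fun do rewrite mul0r; exact: cvg_cst.
  apply: cvgM; first exact: cvg_cst.
  apply: (@continuous_comp _ _ _ (fun z => z - r) f).
    by apply: cvgB => //; exact: cvg_cst.
  by apply: cf; lra.
- by move=> x _; apply: ae_all => r _; exact: dom.
- by rewrite inE/= in_itv/=; apply/andP; split; lra.
Qed.

(** With the weight exp (- M t) both [f] and the kernel are damped, and for large
    [M] the damped kernel has an L^1 norm small enough to make the convolution a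
    contraction. *)
Lemma volterra_uniqueness T k f (a : R) : int k -> int f -> causal k -> causal f ->
  (forall t, T <= t -> f t = 0) ->
  {ae mu, forall t, t < T -> f t = a * convol k f t} ->
  {ae mu, forall t, f t = 0}.
Proof.
move=> ik f_int ck cf fT fE.
have mk := int_measurable ik; have mf := int_measurable f_int.
pose w (M : R) (g : R -> R) t := expR (- M * t) * g t.
have mw M g : measurable_fun [set: R] g -> measurable_fun [set: R] (w M g).
  move=> mg; apply: measurable_funM => //.
  by apply: measurableT_comp => //; exact: measurable_funM.
have w_le M g t : 0 <= M -> causal g -> `|w M g t| <= `|g t|.
  move=> M0 cg; have [t0|t0] := leP t 0; first by rewrite /w cg// mulr0.
  rewrite /w normrM ger0_norm ?expR_ge0// ler_piMl//.
  by rewrite -expR0 ler_expR mulNr oppr_le0 mulr_ge0// ltW.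
have iw M g : 0 <= M -> causal g -> int g -> int (w M g).
  move=> M0 cg ig; apply: (integrable_le _ _ _ (integrable_norm ig)) => //.
    by apply: mw; exact: int_measurable.
  by move=> t _; exact: w_le.
have wconv M t : w M (convol k f) t = convol (w M k) (w M f) t.
  rewrite /w /convol -Rintegral_scale//; last first.
    by apply: measurable_funM => //; exact: measurable_reflect.
  apply: eq_Rintegral => r _.
  have -> : - M * t = - M * (t - r) + - M * r by ring.
  by rewrite expRD; ring.
(* For a causal kernel the damped norms tend to 0 by dominated convergence. *)
have [M M0 aM] : exists2 M, 0 <= M & `|a| * \int[mu]_t `|w M k t| < 1.
  have : (\int[mu]_t `|w n%:R k t|) @[n --> \oo] --> 0.
    have [] := @dominated_convergence _ _ _ mu [set: R] measurableT
      (fun n t => `|w n%:R k t|%:E) (cst 0%E) (fun t => `|k t|%:E).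
    - move=> n; apply/measurable_EFinP/measurableT_comp => //; exact: mw.
    - by [].
    - apply: ae_all => t _; rewrite /=.
      suff h : `|w n%:R k t| @[n --> \oo] --> 0.
        by apply/fine_cvgP; split => //; exact: nearW.
      have [t0|t0] := leP t 0.
        by rewrite /w ck//; under eq_fun do rewrite mulr0 normr0; exact: cvg_cst.
      have wE : (fun n : nat => `|w n%:R k t|) = (fun n => expR (- t) ^+ n * `|k t|).
        apply/funext => n; rewrite /w normrM ger0_norm ?expR_ge0//.
        by rewrite mulNr -mulrN expRM_natl.
      have e0 : expR (- t) ^+ n @[n --> \oo] --> 0.
        by apply: cvg_expr; rewrite ger0_norm ?expR_ge0// -expR0 ltr_expR oppr_lt0.
      by have := cvgM e0 (cvg_cst `|k t|); rewrite mul0r wE; exact.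
    - exact: integrable_norm.
    - apply: ae_all => t n _ /=; rewrite lee_fin normr_id; exact: w_le.
    by move=> _ _; rewrite integral0 => /fine_cvg; exact.
  move=> wlim; have : (`|a| * \int[mu]_t `|w n%:R k t|) @[n --> \oo] --> 0.
    by rewrite -[X in _ --> X](mulr0 `|a|); apply: cvgM wlim; exact: cvg_cst.
  move=> /cvgr_lt /(_ 1 ltr01) [N _ /(_ N (leqnn N)) aN].
  by exists N%:R.
have N0 : \int[mu]_t `|w M f t| = 0.
  have : \int[mu]_t `|w M f t| <= `|a| * \int[mu]_t `|convol (w M k) (w M f) t|.
    have icw := convol_integrable (iw _ _ M0 ck ik) (iw _ _ M0 cf f_int).
    have iwf := iw _ _ M0 cf f_int.
    rewrite -Rintegral_scale//; last exact: int_measurable (integrable_norm icw).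
    apply: ae_le_Rintegral => //; first exact: integrable_norm.
      by apply: integrable_scale => //; exact: integrable_norm.
    apply: ae_imp fE => t ft _; rewrite -normrM -wconv.
    have [tT|Tt] := ltP t T; last by rewrite /w fT// mulr0 normr0.
    by rewrite /w ft// mulrCA.
  have := convol_L1_norm (iw _ _ M0 ck ik) (iw _ _ M0 cf f_int).
  have : 0 <= \int[mu]_t `|w M f t| by exact: Rintegral_ge0.
  have := normr_ge0 a.
  move: aM; set A := `|a|; set K := \int[mu]_t _; set N := \int[mu]_t _.
  set C := \int[mu]_t _ => aM A0 N0 CKN NAC.
  have : N <= A * K * N by rewrite -mulrA (le_trans NAC)// ler_wpM2l.
  by nra.
apply: ae_imp (Rintegral_norm_eq0 measurableT (iw _ _ M0 cf f_int) N0) => t.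
by move=> /(_ Logic.I)/eqP; rewrite /w mulf_eq0 gt_eqF ?expR_gt0//= => /eqP.
Qed.

End convolution.

(** * Smooth cut-off functions *)

Section smooth_functions.
Context (R : realType).
Implicit Types (f g : R -> R) (k n : nat) (x v a b : R).

Local Notation Cn := (@Cn R R^o).
Definition smooth f := forall k, Cn k f.

(** The test functions of the distributional derivative must be smooth in the sense
    of [Cn], whose directional derivatives reduce to the usual one on the line. *)
Lemma derive_dirE f x v : derivable f x 1 -> 
  derivable f x v /\ 'D_v f x = v * 'D_1 f x.
Proof.
move=> df1; have df := (derivable1_diffP _ _).1 df1.
split; first exact: diff_derivable.
by rewrite deriveE// (deriv1E df1) derive1E.
Qed.

Lemma Cn_cont k f : Cn k f -> continuous f.
Proof. by case: k => [[]|k []]. Qed.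

Lemma Cn_derivable k f x v : Cn k.+1 f -> derivable f x v.
Proof. by move=> [_ /(_ v)[]]. Qed.

Lemma Cn_derive k f v : Cn k.+1 f -> Cn k (fun x => 'D_v f x).
Proof. by move=> [_ /(_ v)[]]. Qed.

Lemma Cn_pred k f : Cn k.+1 f -> Cn k f.
Proof.
elim: k f => [|k IH] f; first by case.
by move=> [cf df]; split => // v; have [dfv cdf] := df v; split => //; exact: IH.
Qed.

Lemma Cn_intro k f :
  (forall x v, derivable f x v) -> (forall v, Cn k (fun x => 'D_v f x)) ->
  Cn k.+1 f.
Proof.
move=> df cf; split; last by move=> v; split.
by move=> x; apply: differentiable_continuous; apply/derivable1_diffP; exact: df.
Qed.

Lemma Cn_cst k a : Cn k (fun=> a).
Proof.
elim: k a => [|k IH] a; first by split => // x; exact: cvg_cst.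
apply: Cn_intro => [x v|v]; first exact: derivable_cst.
by under eq_fun do rewrite derive_cst; exact: IH.
Qed.

Lemma Cn_add k f g : Cn k f -> Cn k g -> Cn k (fun x => f x + g x).
Proof.
elim: k f g => [|k IH] f g.
  by move=> [cf _] [cg _]; split => // x; apply: cvgD; [exact: cf|exact: cg].
move=> cf cg; apply: Cn_intro => [x v|v].
  by apply: derivableD; [exact: Cn_derivable cf|exact: Cn_derivable cg].
rewrite (_ : (fun x => _) = fun x => 'D_v f x + 'D_v g x).
  by apply: IH; exact: Cn_derive.
apply/funext => x; rewrite (@deriveD _ _ _ f g)//.
- exact: Cn_derivable cf.
- exact: Cn_derivable cg.
Qed.

Lemma Cn_mul k f g : Cn k f -> Cn k g -> Cn k (fun x => f x * g x).
Proof.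
elim: k f g => [|k IH] f g.
  by move=> [cf _] [cg _]; split => // x; apply: cvgM; [exact: cf|exact: cg].
move=> cf cg; apply: Cn_intro => [x v|v].
  by apply: derivableM; [exact: Cn_derivable cf|exact: Cn_derivable cg].
rewrite (_ : (fun x => _) = fun x => f x * 'D_v g x + g x * 'D_v f x).
  by apply: Cn_add; apply: IH; (exact: Cn_derive || exact: Cn_pred).
apply/funext => x; rewrite (@deriveM _ _ f g)//.
- exact: Cn_derivable cf.
- exact: Cn_derivable cg.
Qed.

Lemma Cn_inv k f : (forall x, f x != 0) -> Cn k f -> Cn k (fun x => (f x)^-1).
Proof.
move=> f0; elim: k => [|k IH].
  by move=> [cf _]; split => // x; apply: cvgV => //; exact: cf.
move=> cf; apply: Cn_intro => [x v|v].
  by apply: derivableV => //; exact: Cn_derivable cf.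
have cfV := IH (Cn_pred cf).
rewrite (_ : (fun x => _) = fun x => (- 1) * ((f x)^-1 * (f x)^-1) * 'D_v f x).
  apply: Cn_mul; last exact: Cn_derive.
  by apply: Cn_mul; [exact: Cn_cst|exact: Cn_mul].
apply/funext => x; rewrite deriveV//; last exact: Cn_derivable cf.
by rewrite /GRing.scale/= mulN1r expr2 invfM.
Qed.

Lemma Cn_derive1 k f (f' : R -> R) :
  (forall x, is_derive x 1 f (f' x)) -> Cn k f' -> Cn k.+1 f.
Proof.
move=> ff' cf'.
have df x v : derivable f x v /\ 'D_v f x = v * f' x.
  have [dx Dx] := ff' x; have [? ->] := @derive_dirE f x v dx.
  by rewrite Dx.
apply: Cn_intro => [x v|v]; first by case: (df x v).
rewrite (_ : (fun x => _) = fun x => v * f' x).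
  by apply: Cn_mul => //; exact: Cn_cst.
by apply/funext => x; case: (df x v).
Qed.

Lemma is_derive_affine f (f' a b x : R) :
  is_derive (a * x + b) 1 f f' ->
  is_derive x 1 (fun y => f (a * y + b)) (a * f').
Proof.
move=> ff'.
have dg : is_derive x 1 (fun y : R => a * y + b) a.
  have := is_deriveD (is_deriveZ a (is_derive_id (x : R^o) 1)) (is_derive_cst (b : R^o) (x : R^o) 1).
  by rewrite addr0 /GRing.scale/= mulr1.
have [h1 h2] := @is_derive1_comp R f (fun y : R => a * y + b) x f' a ff' dg.
apply: DeriveDef => //.
by rewrite h2 mulrC.
Qed.

Lemma Cn_affine k f a b : Cn k f -> Cn k (fun x => f (a * x + b)).
Proof.
elim: k f => [|k IH] f.
  move=> [cf _]; split => // x; apply: (@continuous_comp _ _ _ (fun x => a * x + b) f).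
    by apply: cvgD; [apply: cvgM => //; exact: cvg_cst|exact: cvg_cst].
  exact: cf.
move=> cf.
apply: (@Cn_derive1 _ _ (fun x => a * 'D_1 f (a * x + b))).
  move=> x; apply: is_derive_affine; apply: DeriveDef => //.
  exact: Cn_derivable cf.
apply: Cn_mul; first exact: Cn_cst.
by apply: (IH (fun x => 'D_1 f x)); exact: Cn_derive.
Qed.

(** The family x ^ (- n) exp (- 1 / x) is stable under derivation up to linear
    combinations, so that the smoothness of its members is proved for all of them at
    once. *)
Definition flat n x : R := if 0 < x then x ^- n * expR (- x^-1) else 0.

(** One term of the exponential series at 1 / x beats the factor x ^ (- n). *)
Lemma flat_le n x : 0 < x -> flat n x <= n.+1`!%:R * x.
Proof.
move=> x0; rewrite /flat x0.
have := @expR_ge1Dxn R (x^-1) n; rewrite invr_ge0 => /(_ (ltW x0)) h.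
have {}h : (x^-1) ^+ n.+1 / n.+1`!%:R <= expR (x^-1).
  by apply: le_trans h; rewrite lerDr.
have f0 : 0 < n.+1`!%:R :> R by rewrite ltr0n fact_gt0.
rewrite expRN; set e := expR _ in h *.
have e0 : 0 < e by exact: expR_gt0.
rewrite ler_pdivrMr// -exprVn.
have -> : x^-1 ^+ n = x^-1 ^+ n.+1 / n.+1`!%:R * (n.+1`!%:R * x).
  by rewrite exprSr; field; rewrite !gt_eqF.
by rewrite [leRHS]mulrC ler_wpM2r// mulr_ge0// ltW.
Qed.

Lemma flat_ge0 n x : 0 <= flat n x.
Proof.
rewrite /flat; case: ifPn => // x0.
by rewrite mulr_ge0 ?expR_ge0// invr_ge0 exprn_ge0// ltW.
Qed.

Lemma flat_gt0 x : 0 < x -> 0 < flat 0 x.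
Proof. by move=> x0; rewrite /flat x0 expr0 invr1 mul1r expR_gt0. Qed.

Lemma flat_le0 n x : x <= 0 -> flat n x = 0.
Proof. by rewrite /flat ltNge => ->. Qed.

Let is_derive_flat_gt0 n x : 0 < x ->
  is_derive x 1 (fun y => y ^- n * expR (- y^-1))
    (- n%:R * flat n.+1 x + flat n.+2 x).
Proof.
move=> x0; have xn0 : x != 0 by rewrite gt_eqF.
pose g (z : R) : R := z ^+ n * expR (- z).
have dV : is_derive x 1 (fun y : R => y^-1) (- x ^- 2).
  apply: DeriveDef; first exact: derivableV.
  by rewrite deriveV// derive_id /GRing.scale/= mulr1.
have dg (z : R) : is_derive z 1 g ((n%:R * z ^+ n.-1 - z ^+ n) * expR (- z)).
  have dN : is_derive z 1 (fun y : R => - y) (-1).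
    exact: (is_deriveN (is_derive_id (z : R^o) 1)).
  have dE := @is_derive1_comp R expR (fun y : R => - y) z _ _ (is_derive_expR (- z)) dN.
  have dX := @is_deriveX R R^o id n z 1 1 (is_derive_id (z : R^o) 1).
  have := is_deriveM dX dE; rewrite /GRing.scale/=.
  have -> : (id : R -> R) ^+ n * (expR \o (fun y => - y)) = g.
    by apply/funext => y; rewrite /g fctE/= exprfctE.
  by move=> [hd hv]; apply: DeriveDef => //; rewrite hv exprfctE/=; ring.
have [h1 h2] := @is_derive1_comp R g (fun y : R => y^-1) x _ _ (dg _) dV.
have E : (fun y : R => y ^- n * expR (- y^-1)) = g \o (fun y => y^-1).
  by apply/funext => y; rewrite /g/= exprVn.
rewrite E; apply: DeriveDef => //; rewrite h2 /flat x0.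
case: n {g dg h1 h2 E} => [|n]; rewrite -!exprVn /=; first by field.
by rewrite !exprS; field.
Qed.

Let is_derive_flat_0 n : is_derive (0 : R) 1 (flat n) 0.
Proof.
suff h : h^-1 *: ((flat n \o shift 0) (h *: (1 : R^o)) - flat n 0) @[h --> 0^'] --> 0.
  by apply: DeriveDef; [apply/cvg_ex; exists 0|exact: cvg_lim h].
apply: norm_cvg0.
have C0 : n.+2`!%:R * `|h| @[h --> (0 : R)^'] --> 0.
  rewrite -[X in _ --> X](mulr0 (n.+2`!%:R)); apply: cvgM; first exact: cvg_cst.
  rewrite -[X in _ --> X](@normr0 _ R); apply: cvg_norm.
  exact: nbhs_dnbhs.
apply: squeeze_cvgr (cvg_cst 0) C0; near=> h; rewrite normr_ge0/=.
rewrite addr0 (@flat_le0 _ 0)// subr0 /GRing.scale/= mulr1.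
have [h0|h0] := leP h 0; first by rewrite flat_le0// mulr0 normr0 mulr_ge0.
rewrite ger0_norm ?mulr_ge0 ?invr_ge0 ?flat_ge0 ?(ltW h0)//.
rewrite (gtr0_norm h0); apply: le_trans (flat_le n.+1 h0).
by rewrite /flat h0 -!exprVn exprS mulrA.
Unshelve. all: by end_near. Qed.

Lemma is_derive_flat n x :
  is_derive x 1 (flat n) (- n%:R * flat n.+1 x + flat n.+2 x).
Proof.
have [x0|x0|->] := ltgtP x 0.
- rewrite !flat_le0 ?(ltW x0)// mulr0 addr0.
  apply: (@near_eq_is_derive _ _ _ (cst 0)).
  near=> y; rewrite flat_le0//; near: y.
  by apply: filterS (lt_nbhsl x0) => z; exact: ltW.
- apply: near_eq_is_derive (is_derive_flat_gt0 n x0).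
  near=> y; rewrite /flat ifT//; near: y.
  exact: lt_nbhsr.
- by rewrite !flat_le0// mulr0 addr0; exact: is_derive_flat_0.
Unshelve. all: by end_near. Qed.

Lemma Cn_flat k n : Cn k (flat n).
Proof.
elim: k n => [|k IH] n.
  split => // x; apply: differentiable_continuous; apply/derivable1_diffP.
  by have [] := is_derive_flat n x.
apply: Cn_derive1 (is_derive_flat n) _.
by apply: Cn_add => //; apply: Cn_mul => //; exact: Cn_cst.
Qed.

Definition step x : R := flat 0 x / (flat 0 x + flat 0 (1 - x)).

Let den_gt0 x : 0 < flat 0 x + flat 0 (1 - x).
Proof.
have [x0|x0] := ltP 0 x; first by rewrite ltr_pwDl ?flat_gt0 ?flat_ge0.
by rewrite ltr_wpDl ?flat_ge0// flat_gt0//; lra.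
Qed.

Lemma step_le0 x : x <= 0 -> step x = 0.
Proof. by move=> x0; rewrite /step flat_le0// mul0r. Qed.

Lemma step_ge1 x : 1 <= x -> step x = 1.
Proof.
move=> x1; rewrite /step (@flat_le0 _ (1 - x)) ?subr_le0// addr0 divff//.
by rewrite gt_eqF// flat_gt0//; lra.
Qed.

Lemma step_itv x : 0 <= step x <= 1.
Proof.
rewrite /step divr_ge0 ?flat_ge0 ?(ltW (den_gt0 _))//=.
by rewrite ler_pdivrMr// mul1r lerDl flat_ge0.
Qed.

Lemma smooth_step : smooth step.
Proof.
move=> k; apply: Cn_mul; first exact: Cn_flat.
apply: Cn_inv => [x|]; first by rewrite gt_eqF.
apply: Cn_add; first exact: Cn_flat.
rewrite (_ : (fun x => _) = fun x => flat 0 (-1 * x + 1)).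
  exact: (@Cn_affine k (flat 0)) (Cn_flat k 0).
by apply/funext => x; rewrite mulN1r addrC.
Qed.

End smooth_functions.

Section test_function_reflection.
Context (R : realType).
Local Notation mR := (measurableTypeR R).

Lemma test_function_reflection (T : R) (eta : R -> R) :
  test_function ((`]0, T[%classic : set mR) : set R^o) eta ->
  test_function ((`]0, T[%classic : set mR) : set R^o) (fun t => eta (T - t)) /\
  forall t, derive1 (fun t => eta (T - t)) t = - derive1 eta (T - t).
Proof.
move=> [ceta keta etaT].
have E : (fun t => eta (T - t)) = (fun t => eta (-1 * t + T)).
  by apply/funext => t; congr eta; ring.
have cr : continuous (fun t : R^o => T - t : R^o).
  by move=> t; apply: cvgB; [exact: cvg_cst|exact: cvg_id].
have sub : closure [set t : R^o | eta (T - t) != 0] `<=`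
    [set T - t | t in closure [set t : R^o | eta t != 0]].
  move=> t ct; exists (T - t); last by rewrite subKr.
  move=> B /(cr t) nB; have [y [/= y0 By]] := ct _ nB.
  by exists (T - y).
split.
  split.
  - by move=> k; rewrite E; exact: (Cn_affine (-1) T (ceta k)).
  - apply: subclosed_compact sub; first exact: closed_closure.
    by apply: continuous_compact keta; exact: continuous_subspaceT.
  - by move=> t /sub[r /etaT] /=; rewrite !in_itv/= => /andP[? ?] <-; apply/andP; split; lra.
move=> t; rewrite E derive1E.
have de (x : R^o) : is_derive x 1 (eta : R^o -> R^o) ('D_1 eta x).
  by apply: DeriveDef => //; exact: Cn_derivable (ceta 1%N).
have := @is_derive_affine _ eta ('D_1 eta (-1 * t + T)) (-1) T t (de (-1 * t + T)).
by move=> [_ ->]; rewrite derive1E !mulN1r addrC.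
Qed.

End test_function_reflection.

(** * The lemma of du Bois-Reymond *)

Section du_Bois_Reymond.
Context (R : realType).
Local Notation mu := (@lebesgue_measure R).
Implicit Types (a b e t x T : R).

Let dstep (x : R) : R := 'D_1 (@step R) x.

Let step_is_derive (x : R) : is_derive x 1 (@step R) (dstep x).
Proof. apply: DeriveDef => //. exact: (@Cn_derivable R 0%N (@step R) x 1 (@smooth_step R 1%N)). Qed.

Let dstep_continuous : continuous dstep.
Proof. exact: (Cn_cont (Cn_derive 1 (@smooth_step R 1%N))). Qed.

Let dstep_out x : (x < 0) || (1 < x) -> dstep x = 0.
Proof.
move=> /orP[x0|x1].
  rewrite /dstep (@near_eq_derive _ _ _ _ (cst (0 : R))) ?derive_cst//.
  near=> y; rewrite step_le0//; near: y.
  by apply: filterS (lt_nbhsl x0) => z; exact: ltW.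
rewrite /dstep (@near_eq_derive _ _ _ _ (cst (1 : R))) ?derive_cst//.
near=> y; rewrite step_ge1//; near: y.
by apply: filterS (lt_nbhsr x1) => z; exact: ltW.
Unshelve. all: by end_near. Qed.

Let dstep_bounded : exists K, forall x, `|dstep x| <= K.
Proof.
have cn : {within `[0, 1], continuous (fun x => `|dstep x|)}.
  apply: continuous_subspaceT => x; apply: cvg_norm; exact: dstep_continuous.
have [c _ cmax] := EVT_max ler01 cn.
exists (`|dstep c|) => x.
have [x0|x0] := ltP x 0; first by rewrite dstep_out ?x0// normr0.
have [x1|x1] := ltP 1 x; first by rewrite dstep_out ?x1 ?orbT// normr0.
by apply: cmax; rewrite in_itv/= x0.
Qed.

(** A smooth version of the step from 0 to 1 on [a, a + e]. Its derivative is an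
    approximation of the Dirac mass at [a], and the difference of two ramps
    approximates the indicator of an interval. *)
Definition ramp a e t : R := step (e^-1 * t + - (a / e)).

Lemma smooth_ramp a e : smooth (ramp a e).
Proof. by move=> k; apply: (@Cn_affine _ k (@step R)); exact: smooth_step. Qed.

Let rampE a e t : e^-1 * t + - (a / e) = (t - a) / e.
Proof. by rewrite mulrBl [t / e]mulrC. Qed.

Lemma ramp_le a e t : 0 < e -> t <= a -> ramp a e t = 0.
Proof.
move=> e0 ta; rewrite /ramp rampE step_le0// pmulr_lle0 ?invr_gt0//; lra.
Qed.

Lemma ramp_ge a e t : 0 < e -> a + e <= t -> ramp a e t = 1.
Proof. by move=> e0 ta; rewrite /ramp rampE step_ge1// ler_pdivlMr// mul1r; lra. Qed.

Lemma ramp_itv a e t : 0 <= ramp a e t <= 1.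
Proof. exact: step_itv. Qed.

Let dramp a e t : R := e^-1 * dstep (e^-1 * t + - (a / e)).

Let is_derive_ramp a e t : is_derive t 1 (ramp a e) (dramp a e t).
Proof. by apply: is_derive_affine; exact: step_is_derive. Qed.

Let derive1_ramp a e t : derive1 (ramp a e) t = dramp a e t.
Proof. by rewrite derive1E; have [_ ->] := is_derive_ramp a e t. Qed.

Let dramp_continuous a e : continuous (dramp a e).
Proof.
move=> t; apply: cvgM; first exact: cvg_cst.
apply: (@continuous_comp _ _ _ (fun t => e^-1 * t + - (a / e)) dstep).
  by apply: cvgD; [apply: cvgM => //; exact: cvg_cst|exact: cvg_cst].
exact: dstep_continuous.
Qed.

Let dramp_out a e t : 0 < e -> (t < a) || (a + e < t) -> dramp a e t = 0.
Proof.
move=> e0 h; rewrite /dramp rampE dstep_out ?mulr0//.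
move: h => /orP[h|h]; apply/orP; [left|right].
  by rewrite pmulr_llt0 ?invr_gt0//; lra.
by rewrite ltr_pdivlMr// mul1r; lra.
Qed.

Variables (T : R) (G F : R -> R).
Local Notation I := (`]0, T[%classic : set (measurableTypeR R)).
Hypothesis cG : forall t, 0 < t < T -> {for t, continuous G}.
Hypothesis intF : mu.-integrable I (EFin \o F).
Hypothesis GF : forall eta : R -> R, test_function (I : set R^o) eta ->
  \int[mu]_(t in I) (derive1 eta t * G t) = - \int[mu]_(t in I) (eta t * F t).

Let mI : measurable I. Proof. exact: measurable_itv. Qed.

Let mJ a e : measurable (`[a, a + e]%classic : set (measurableTypeR R)).
Proof. exact: measurable_itv. Qed.

Let mF : measurable_fun I F.
Proof. by apply/measurable_EFinP; case/integrableP : intF. Qed.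

Let sub_I a e : 0 < a -> a + e < T -> `[a, a + e]%classic `<=` I.
Proof.
move=> a0 aT t /=; rewrite !in_itv/= => /andP[at1 t2].
by apply/andP; split; lra.
Qed.

Let drampG_int a e : 0 < a -> 0 < e -> a + e < T ->
  mu.-integrable `[a, a + e] (EFin \o (fun t => dramp a e t * G t)).
Proof.
move=> a0 e0 aT; apply: continuous_compact_integrable; first exact: segment_compact.
apply: continuous_in_subspaceT => t /set_mem /(sub_I a0 aT) /=.
rewrite in_itv/= => tI; apply: cvgM; first exact: dramp_continuous.
exact: cG.
Qed.

Let drampG_restrict a e : 0 < a -> 0 < e -> a + e < T ->
  (fun t => dramp a e t * G t) \_ I = (fun t => dramp a e t * G t) \_ `[a, a + e].
Proof.
move=> a0 e0 aT; apply/funext => t; rewrite !patchE.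
have [tae|tae] := boolP (t \in (`[a, a + e]%classic : set R)).
  by rewrite ifT// inE; apply: (sub_I a0 aT); rewrite inE in tae.
case: ifPn => // _; rewrite dramp_out ?mul0r//.
move: tae; rewrite notin_setE/= in_itv/= => /negP; rewrite negb_and -!ltNge.
by [].
Qed.

Let drampG_intI a e : 0 < a -> 0 < e -> a + e < T ->
  mu.-integrable I (EFin \o (fun t => dramp a e t * G t)).
Proof.
move=> a0 e0 aT; apply/(integrable_mkcond _ mI).
have := (integrable_mkcond _ (mJ a e)).1 (drampG_int a0 e0 aT).
by rewrite !restrict_EFin drampG_restrict.
Qed.

Let int_dramp a e : 0 < e -> \int[mu]_(t in `[a, a + e]) dramp a e t = 1.
Proof.
move=> e0; have ae : a < a + e by rewrite ltrDl.
have cr : continuous (ramp a e).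
  exact: (Cn_cont (smooth_ramp a e 0%N)).
rewrite /Rintegral (@continuous_FTC2 _ _ (ramp a e))//.
- by rewrite (@ramp_le a e a)// (@ramp_ge a e (a + e))// sube0.
- by apply: continuous_subspaceT; exact: dramp_continuous.
- split.
  + by move=> t _; have [] := is_derive_ramp a e t.
  + by apply: cvg_at_right_filter; exact: cr.
  + by apply: cvg_at_left_filter; exact: cr.
Qed.

Let dist_dramp a e K w : 0 < a -> 0 < e -> a + e < T ->
  (forall x, `|dstep x| <= K) ->
  (forall t, a <= t <= a + e -> `|G t - G a| <= w) ->
  `|\int[mu]_(t in I) (dramp a e t * G t) - G a| <= K * w.
Proof.
move=> a0 e0 aT dK Gw.
have md : measurable_fun [set: R] (dramp a e).
  exact: continuous_measurable_fun (@dramp_continuous a e).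
have id : mu.-integrable `[a, a + e] (EFin \o dramp a e).
  apply: continuous_compact_integrable; first exact: segment_compact.
  by apply: continuous_subspaceT; exact: dramp_continuous.
rewrite Rintegral_mkcond drampG_restrict// -Rintegral_mkcond.
have -> : G a = \int[mu]_(t in `[a, a + e]) (G a * dramp a e t).
  by rewrite RintegralZl// int_dramp// mulr1.
have iGa : mu.-integrable `[a, a + e] (EFin \o (fun t => G a * dramp a e t)).
  exact: integrable_scale.
rewrite -RintegralB//; last exact: drampG_int.
have i1 := integrable_sub (mJ a e) (drampG_int a0 e0 aT) iGa.
apply: le_trans; first exact: le_normr_Rintegral.
apply: (@le_trans _ _ (\int[mu]_(t in `[a, a + e]) (K * w / e))).
  apply: le_Rintegral => //.
  - exact: integrable_norm i1.
  - apply: continuous_compact_integrable; first exact: segment_compact.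
    by apply: continuous_subspaceT => x; exact: cvg_cst.
  move=> t /=; rewrite in_itv/= => tae.
  have -> : dramp a e t * G t - G a * dramp a e t = dramp a e t * (G t - G a) by ring.
  rewrite normrM /dramp normrM (@gtr0_norm _ e^-1) ?invr_gt0//.
  have -> : K * w / e = e^-1 * K * w by ring.
  apply: ler_pM => //; first by rewrite mulr_ge0// invr_ge0 ltW.
    by rewrite ler_wpM2l// invr_ge0 ltW.
  exact: Gw.
rewrite Rintegral_cst; last exact: mJ.
rewrite /= lebesgue_measure_itv/= lte_fin ltrDl e0/=.
by rewrite le_eqVlt; apply/orP; left; apply/eqP; field; rewrite gt_eqF.
Qed.

Let ramp_average a d : 0 < a -> 0 < d -> a + d < T ->
  \int[mu]_(t in I) (dramp a (d * harmonic n) t * G t) @[n --> \oo] --> G a.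
Proof.
move=> a0 d0 aT; have [K dK] := dstep_bounded.
have K0 : 0 <= K by exact: le_trans (dK 0).
apply/cvgrPdist_le => eps eps0.
have aI : 0 < a < T by rewrite a0/=; lra.
have K1 : 0 < K + 1 by rewrite ltr_wpDl.
have /cvgrPdist_le/(_ (eps / (K + 1)))[|r r0 Gr] := cG aI.
  by rewrite divr_gt0.
have dh : d * harmonic n @[n --> \oo] --> 0.
  rewrite -[X in _ --> X](mulr0 d); apply: cvgM; first exact: cvg_cst.
  exact: cvg_harmonic.
have hn (n : nat) : ((0 : R) < @harmonic R n) && (@harmonic R n <= 1).
  by rewrite /harmonic/= invr_gt0 ltr0n/= invf_le1// ler1n.
near=> n.
have dn0 : 0 < d * harmonic n by rewrite mulr_gt0//; case/andP: (hn n).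
have dnd : d * harmonic n <= d by case/andP: (hn n) => _ h1; apply: ler_piMr => //; exact: ltW.
have dnr : d * harmonic n < r by near: n; move/cvgr_lt : dh; apply.
rewrite distrC; apply: le_trans (dist_dramp (w := eps / (K + 1)) a0 dn0 _ dK _) _.
- by lra.
- move=> t /andP[at1 t2]; rewrite distrC; apply: Gr => /=.
  by rewrite ler0_norm; lra.
- by rewrite mulrA ler_pdivrMr// mulrC ler_wpM2l ?ltW//; lra.
Unshelve. all: by end_near. Qed.

Let test_ramp a b e : 0 < a -> a < b -> 0 < e -> b + e < T ->
  test_function (I : set R^o) (fun t => ramp a e t - ramp b e t).
Proof.
move=> a0 ab e0 bT.
have sub : closure [set x : R^o | ramp a e x - ramp b e x != 0] `<=` `[a, b + e].
  have /closure_id -> : closed (`[a, b + e]%classic : set R^o) by exact: itv_closed.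
  apply: closureS => t /=; apply: contraNP; rewrite in_itv/= => /negP.
  rewrite negb_and -!ltNge => /orP[ta|tb].
    by rewrite !ramp_le ?subr0//; lra.
  by rewrite !ramp_ge ?subrr//; lra.
split.
- move=> k; under eq_fun do rewrite -mulN1r.
  apply: Cn_add; first exact: smooth_ramp.
  by apply: Cn_mul; [exact: Cn_cst|exact: smooth_ramp].
- apply: subclosed_compact sub; first exact: closed_closure.
  exact: segment_compact.
- apply: subset_trans sub _ => t /=; rewrite !in_itv/= => /andP[? ?].
  by apply/andP; split; lra.
Qed.

(** The difference of the ramps at [a] and [b] is a test function; as their width
    shrinks, the left side of the weak identity tends to G a - G b, and the right
    side to minus the integral of [F] over the interval. *)
Lemma weak_derivative_primitive a b : 0 < a -> a < b -> b < T ->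
  G b - G a = \int[mu]_(t in `]a, b]) F t.
Proof.
move=> a0 ab bT.
pose d := (T - b) / 2; have d0 : 0 < d by rewrite divr_gt0// subr_gt0.
have bdT : b + d < T by rewrite /d; lra.
have adT : a + d < T by lra.
have hn (n : nat) : ((0 : R) < @harmonic R n) && (@harmonic R n <= 1).
  by rewrite /harmonic/= invr_gt0 ltr0n/= invf_le1// ler1n.
have b0 : 0 < b by exact: lt_trans ab.
pose en n : R := d * harmonic n.
have en0 n : 0 < en n by rewrite mulr_gt0//; case/andP: (hn n).
have end_ n : en n <= d by case/andP: (hn n) => _ h1; apply: ler_piMr => //; exact: ltW.
have en_cvg : en n @[n --> \oo] --> 0.
  rewrite -[X in _ --> X](mulr0 d); apply: cvgM; first exact: cvg_cst.
  exact: cvg_harmonic.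
pose eta n t := ramp a (en n) t - ramp b (en n) t.
have eta1 n t : derive1 (eta n) t = dramp a (en n) t - dramp b (en n) t.
  have [h1 h2] := is_deriveB (is_derive_ramp a (en n) t) (is_derive_ramp b (en n) t).
  by rewrite derive1E h2.
have LHS : (- \int[mu]_(t in I) (eta n t * F t)) @[n --> \oo] --> G a - G b.
  suff -> : (fun n => - \int[mu]_(t in I) (eta n t * F t)) =
      (fun n => \int[mu]_(t in I) (dramp a (en n) t * G t) -
                \int[mu]_(t in I) (dramp b (en n) t * G t)).
    exact: cvgB (ramp_average a0 d0 adT) (ramp_average b0 d0 bdT).
  apply/funext => n.
  rewrite -GF; last by apply: test_ramp => //; have := end_ n; lra.
  rewrite -RintegralB//.
  - by apply: eq_Rintegral => t _; rewrite eta1 mulrBl.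
  - by apply: drampG_intI => //; have := end_ n; rewrite /en; lra.
  - by apply: drampG_intI => //; have := end_ n; rewrite /en; lra.
have RHS : (\int[mu]_(t in I) (eta n t * F t)) @[n --> \oo] -->
    \int[mu]_(t in I) ((F \_ `]a, b]) t).
  have [|||||iF _] := @dominated_convergence _ _ _ mu I mI
      (fun n t => (eta n t * F t)%:E) (fun t => ((F \_ `]a, b]) t)%:E)
      (fun t => `|F t|%:E).
  - move=> n; apply/measurable_EFinP/measurable_funM => //.
    apply: measurable_funTS; apply: continuous_measurable_fun.
    by case: (test_ramp a0 ab (en0 n) (le_lt_trans (lerD (lexx b) (end_ n)) bdT)) => /(_ 0%N)[].
  - apply/measurable_EFinP/measurable_restrict => //.
    apply: measurable_funS mF => //; exact: subIsetl.
  - apply: ae_all => t tI; suff h : eta n t * F t @[n --> \oo] --> (F \_ `]a, b]) t.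
      by apply/fine_cvgP; split => //; exact: nearW.
    have ev c : c < t -> \forall n \near \oo, ramp c (en n) t = 1.
      move=> ct; near=> n; rewrite ramp_ge//.
      suff : en n < t - c by lra.
      by near: n; move/cvgr_lt : en_cvg; apply; rewrite subr_gt0.
    have [ta|at1] := leP t a.
      rewrite patchE ifF; last by apply/negbTE; rewrite notin_setE/= in_itv/=; lra.
      rewrite (_ : (fun n => _) = cst 0); first exact: cvg_cst.
      by apply/funext => n; rewrite /eta !ramp_le ?subr0 ?mul0r//; lra.
    rewrite -[X in _ --> X]mul1r.
    apply: cvg_near_cst.
    have [tb|bt] := leP t b.
      rewrite patchE ifT; last by rewrite inE/= in_itv/= at1 tb.
      near=> n; rewrite /eta (@ramp_le b)// subr0.
      by rewrite (near (ev a at1) n).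
    rewrite patchE ifF; last by apply/negbTE; rewrite notin_setE/= in_itv/=; lra.
    near=> n; rewrite /eta (near (ev a at1) n)// (near (ev b bt) n)//.
    by rewrite subrr mul0r mulr0.
  - exact: integrable_norm intF.
  - apply: ae_all => t n tI; rewrite lee_fin normrM ler_piMl// ler_norml.
    have := ramp_itv a (en n) t; have := ramp_itv b (en n) t.
    by rewrite /eta; lra.
  by rewrite -(EFin_Rintegral mI iF) => /fine_cvg.
have E := cvg_unique _ LHS (cvgN RHS).
rewrite -opprB E// opprK -Rintegral_mkcondr.
congr Rintegral; apply/seteqP; split => t /=; first by case.
by rewrite !in_itv/= => /andP[? ?]; split => //; apply/andP; split; lra.
Unshelve. all: by end_near. Qed.

End du_Bois_Reymond.

(** * Power kernels *)

Section power_integrals.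
Context (R : realType).
Local Notation mu := (@lebesgue_measure R).
Local Notation mR := (measurableTypeR R).
Local Notation int f := (mu.-integrable [set: R] (EFin \o f)).
Implicit Types (a b p t T : R).

Lemma integral_powR a b p : 0 < a -> a < b -> p + 1 != 0 ->
  (\int[mu]_(t in `[a, b]) (t `^ p)%:E =
   ((b `^ (p + 1) - a `^ (p + 1)) / (p + 1))%:E)%E.
Proof.
move=> a0 ab p1.
have dF t : 0 < t -> is_derive t 1 (fun t => (p + 1)^-1 * t `^ (p + 1)) (t `^ p).
  move=> t0; have := is_deriveZ ((p + 1)^-1) (is_derive1_powR (p + 1) t0).
  by rewrite /GRing.scale/= mulrA mulVf// mul1r addrK.
have cF t : 0 < t -> {for t, continuous (fun t => (p + 1)^-1 * t `^ (p + 1))}.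
  move=> t0; apply: differentiable_continuous; apply/derivable1_diffP.
  by have [] := dF t t0.
rewrite (@continuous_FTC2 _ _ (fun t => (p + 1)^-1 * t `^ (p + 1)))//.
- by rewrite -EFinB; congr EFin; ring.
- apply: continuous_in_subspaceT => t /set_mem; rewrite /= in_itv/= => /andP[at1 _].
  have t0 : 0 < t by exact: lt_le_trans at1.
  apply: differentiable_continuous; apply/derivable1_diffP.
  by have [] := is_derive1_powR p t0.
- split.
  + move=> t; rewrite in_itv/= => /andP[at1 _].
    by have [] := dF t (lt_trans a0 at1).
  + by apply: cvg_at_right_filter; exact: cF.
  + by apply: cvg_at_left_filter; apply: cF; exact: lt_trans ab.
- move=> t; rewrite in_itv/= => /andP[at1 _]; rewrite derive1E.
  by have [_ ->] := dF t (lt_trans a0 at1).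
Qed.

(** Monotone convergence, used to pass to improper integrals of powers. *)
Lemma integral_bigcup_le (F : (set mR)^nat) (f : R -> R) (C : \bar R) :
  nondecreasing_seq F -> (forall n, measurable (F n)) ->
  measurable_fun [set: R] f -> (forall n t, F n t -> 0 <= f t) ->
  (forall n, \int[mu]_(t in F n) (f t)%:E <= C)%E ->
  (\int[mu]_(t in \bigcup_n F n) (f t)%:E <= C)%E.
Proof.
move=> ndF mF mf f0 FC.
have mFf n : measurable_fun (F n) (fun t => (f t)%:E).
  by apply/measurable_EFinP; exact: measurable_funTS.
have Ff0 n t : F n t -> (0 <= (f t)%:E)%E by move=> /f0; rewrite lee_fin.
have h := @ge0_nondecreasing_set_cvg_integral _ _ _ F (fun t => (f t)%:E) mu ndF mF mFf Ff0.
rewrite -(cvg_lim _ h)//; apply: lime_le; first by apply/cvg_ex; eexists; exact: h.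
exact: nearW.
Qed.

Lemma integral_powR_near0 p T : -1 < p -> 0 < T ->
  (\int[mu]_(t in `]0%R, T]) (t `^ p)%:E <= (T `^ (p + 1) / (p + 1))%:E)%E.
Proof.
move=> p1 T0; have p10 : 0 < p + 1 by lra.
pose F n : set mR := `[T * harmonic n.+1, T]%classic.
have hn n : (0 < @harmonic R n.+1) /\ (@harmonic R n.+1 < 1).
  by rewrite /harmonic/= invr_gt0 ltr0n/= invf_lt1// ltr1n.
have -> : `]0, T]%classic = \bigcup_n F n.
  apply/seteqP; split => [t /=|t [n _] /=]; rewrite /F/= !in_itv/=.
    move=> /andP[t0 tT].
    have : T * @harmonic R n @[n --> \oo] --> 0.
      rewrite -[X in _ --> X](mulr0 T); apply: cvgM; first exact: cvg_cst.
      exact: cvg_harmonic.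
    move=> /cvgr_lt /(_ t t0) [N _ /(_ N.+1 (leqnSn N))] /ltW tN.
    by exists N => //=; rewrite /F/= in_itv/= tN tT.
  move=> /andP[t1 ->]; rewrite andbT; apply: lt_le_trans t1.
  by rewrite mulr_gt0//; case: (hn n).
apply: integral_bigcup_le => //.
- move=> m n mn; apply/subsetPset => t; rewrite /F/= !in_itv/= => /andP[h ->].
  rewrite andbT; apply: le_trans h; apply: ler_wpM2l; first exact: ltW.
  by rewrite /harmonic/= lef_pV2 ?posrE// ler_nat !ltnS.
- by move=> n; exact: measurable_itv.
- by move=> n t _; exact: powR_ge0.
move=> n; have [h0 h1] := hn n.
rewrite integral_powR ?gt_eqF//; last 2 first.
- by rewrite mulr_gt0.
- by rewrite gtr_pMr.
rewrite lee_fin ler_wpM2r ?invr_ge0 ?(ltW p10)//.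
by rewrite gerBl powR_ge0.
Qed.

Lemma integral_powR_infty p : p < -1 ->
  (\int[mu]_(t in `[1%R, +oo[) (t `^ p)%:E <= (- (p + 1)^-1)%:E)%E.
Proof.
move=> p1; have p10 : p + 1 < 0 by lra.
pose F n : set mR := `[1, n.+2%:R]%classic.
have -> : `[1, +oo[%classic = \bigcup_n F n.
  apply/seteqP; split => [t /=|t [n _] /=]; rewrite /F/= !in_itv/= ?andbT; last first.
    by case/andP.
  move=> t1; exists (Num.truncn t) => //=; rewrite /F/= in_itv/= t1/=.
  rewrite (le_trans (ltW (truncnS_gt t)))// ler_nat.
  by [].
apply: integral_bigcup_le => //.
- move=> m n mn; apply/subsetPset => t; rewrite /F/= !in_itv/= => /andP[-> h].
  by rewrite (le_trans h)// ler_nat !ltnS.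
- by move=> n; exact: measurable_itv.
- by move=> n t _; exact: powR_ge0.
move=> n; rewrite integral_powR ?lt_eqF//; last by rewrite ltr1n.
rewrite lee_fin powR1 mulrBl mul1r gerDr.
by rewrite mulr_ge0_le0 ?powR_ge0// invr_le0 ltW.
Qed.

(** The cut-off at [T] makes the powers integrable on the whole line, and does not
    change causal convolutions on (0, T). *)
Definition trunc_pow p T t : R := if 0 < t < T then t `^ p else 0.

Lemma trunc_powE p T : trunc_pow p T = (@powR R ^~ p) \_ `]0, T[.
Proof.
apply/funext => t; rewrite patchE /trunc_pow.
by congr (if _ then _ else _); apply/idP/idP; rewrite inE/= in_itv.
Qed.

Lemma trunc_pow_ge0 p T t : 0 <= trunc_pow p T t.
Proof. by rewrite /trunc_pow; case: ifPn => // _; exact: powR_ge0. Qed.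

Lemma causal_trunc_pow p T : causal (trunc_pow p T).
Proof. by move=> t t0; rewrite /trunc_pow ltNge t0. Qed.

Lemma measurable_trunc_pow p T : measurable_fun [set: R] (trunc_pow p T).
Proof.
have mI : measurable (`]0, T[%classic : set mR) by exact: measurable_itv.
rewrite trunc_powE; apply/(measurable_restrictT _ mI).
by apply: measurable_funTS; exact: measurable_powR.
Qed.

Lemma trunc_pow_integrable p T : -1 < p -> 0 < T -> int (trunc_pow p T).
Proof.
move=> p1 T0; apply/integrableP; split.
  apply/measurable_EFinP; exact: measurable_trunc_pow.
apply: le_lt_trans (ltry (T `^ (p + 1) / (p + 1))).
apply: le_trans (integral_powR_near0 p1 T0).
rewrite [leRHS]integral_mkcond; apply: ge0_le_integral_nm => // t _.
rewrite /= ger0_norm ?trunc_pow_ge0// patchE /trunc_pow.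
case: ifPn => [/andP[t0 tT]|_].
  by rewrite mem_set//= in_itv/= t0 ltW.
by case: ifPn => // _; rewrite lee_fin powR_ge0.
Qed.

Lemma ae_exists_itv (P : R -> Prop) a b : a < b -> {ae mu, forall t, P t} ->
  exists2 t, a < t < b & P t.
Proof.
move=> ab [N [mN N0 PN]]; apply: contrapT => nP.
have abN : `]a, b[%classic `<=` (N : set mR).
  move=> t; rewrite /= in_itv/= => tab; apply: PN => /= Pt.
  by apply: nP; exists t.
have : (mu `]a, b[ <= mu N)%E by apply: le_measure => //; rewrite inE.
rewrite N0 /= lebesgue_measure_itv/= lte_fin ab -EFinB lee_fin; lra.
Qed.

(** The two kernels have total homogeneity -1, so their convolution is homogeneous
    of degree 0. The constant is the Beta integral B(gamma, 1 - gamma). *)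
Lemma convol_trunc_pow (gamma T : R) : 0 < gamma < 1 -> 0 < T ->
  exists2 B, 0 < B & forall t, 0 < t < T ->
    convol (trunc_pow (gamma - 1) T) (trunc_pow (- gamma) T) t = B.
Proof.
move=> /andP[g0 g1] T0.
pose w v : R := trunc_pow (gamma - 1) 1 (1 - v) * trunc_pow (- gamma) 1 v.
have mw : measurable_fun [set: R] w.
  apply: measurable_funM; last exact: measurable_trunc_pow.
  exact: (measurable_reflect 1 (measurable_trunc_pow (gamma - 1) 1)).
have w0 v : 0 <= w v by rewrite mulr_ge0 ?trunc_pow_ge0.
have scaling t r : 0 < t < T ->
    trunc_pow (gamma - 1) T (t - r) * trunc_pow (- gamma) T r =
    t^-1 * w (t^-1 * r + 0).
  move=> /andP[t0 tT]; rewrite addr0 /w /trunc_pow.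
  have [r0|r0] := leP r 0.
    have h : t^-1 * r <= 0 by rewrite pmulr_rle0 ?invr_gt0.
    have -> : (0 < t^-1 * r < 1) = false by rewrite ltNge h.
    by rewrite !mulr0.
  rewrite mulr_gt0 ?invr_gt0//=.
  have -> : (0 < 1 - t^-1 * r) = (0 < t - r).
    by rewrite !subr_gt0 mulrC ltr_pdivrMr// mul1r.
  have [tr|tr] /= := ltP 0 (t - r); last by rewrite !mul0r mulr0.
  have -> : t - r < T by lra.
  have -> : r < T by lra.
  have -> : 1 - t^-1 * r < 1 by rewrite gtrBl mulr_gt0 ?invr_gt0.
  have -> : t^-1 * r < 1 by rewrite mulrC ltr_pdivrMr// mul1r; lra.
  have e1 : t - r = t * (1 - t^-1 * r) by field; rewrite gt_eqF.
  have e2 : r = t * (t^-1 * r) by rewrite mulrA mulfV ?gt_eqF// mul1r.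
  rewrite e1 {2}e2 !powRM ?mulr_ge0 ?invr_ge0 ?(ltW t0) ?(ltW r0)//; last first.
    by rewrite subr_ge0 mulrC ler_pdivrMr// mul1r; lra.
  rewrite mulrACA -powRD ?(gt_eqF t0) ?implybT//.
  have -> : gamma - 1 - gamma = -1 by ring.
  by rewrite powR_inv1 ?ltW.
have mwa t : measurable_fun [set: R] (fun r => w (t^-1 * r + 0)).
  apply: measurableT_comp => //.
  by apply: measurable_funD => //; exact: measurable_funM.
have affE t : 0 < t -> (\int[mu]_r (t^-1 * w (t^-1 * r + 0))%:E = \int[mu]_v (w v)%:E)%E.
  move=> t0; rewrite -[RHS](@ge0_integral_affine R t^-1 0 (fun v => (w v)%:E)).
  - rewrite -ge0_integralZl//.
    + by apply/measurable_EFinP; exact: mwa.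
    + by move=> r _; rewrite lee_fin.
    + by rewrite lee_fin invr_ge0 ltW.
  - by rewrite invr_gt0.
  - exact/measurable_EFinP.
  - by move=> v; rewrite lee_fin.
have convE t : 0 < t < T ->
    convol (trunc_pow (gamma - 1) T) (trunc_pow (- gamma) T) t = \int[mu]_v w v.
  move=> tT; have t0 : 0 < t by case/andP : tT.
  by congr fine; under eq_integral do rewrite scaling//; exact: affE.
(* The convolution converges at some point, and then the Beta integral does. *)
have iw : int w.
  have i1 : int (trunc_pow (gamma - 1) T) by apply: trunc_pow_integrable => //; lra.
  have i2 : int (trunc_pow (- gamma) T) by apply: trunc_pow_integrable => //; lra.
  have [t tT ti] := ae_exists_itv T0 (convol_ae_integrable i1 i2).
  have t0 : 0 < t by case/andP : tT.
  apply/integrableP; split; first exact/measurable_EFinP.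
  under eq_integral do rewrite /= ger0_norm//.
  rewrite -(affE t t0); case/integrableP : ti => _.
  congr (_ < _)%E; apply: eq_integral => r _; rewrite /= scaling// ger0_norm//.
  by rewrite mulr_ge0// invr_ge0 ltW.
exists (\int[mu]_v w v) => //.
(* Both exponents are negative, so that [w] is at least 1 on (0, 1). *)
have : \int[mu]_(v in `]0, 1[) (1 : R) <= \int[mu]_(v in `]0, 1[) w v.
  apply: le_Rintegral => //.
  - apply/integrableP; split; first exact/measurable_EFinP.
    under eq_integral do rewrite /= normr1.
    by rewrite integral_cst//= lebesgue_measure_itv/= lte_fin ltr01 -EFinB mul1e ltry.
  - exact: integrableS iw.
  move=> v /=; rewrite in_itv/= /w /trunc_pow => /andP[v0 v1].
  have -> : 0 < 1 - v < 1 by apply/andP; split; lra.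
  rewrite v0 v1/= -[leLHS]mulr1; apply: ler_pM => //.
  - rewrite -[leLHS](powRr0 (1 - v)); apply: ger_powR; lra.
  - rewrite -[leLHS](powRr0 v); apply: ger_powR; lra.
rewrite Rintegral_cst// /= lebesgue_measure_itv/= lte_fin ltr01 /= subr0 mulr1.
rewrite Rintegral_mkcond (_ : w \_ _ = w); first by apply: lt_le_trans.
apply/funext => v; rewrite patchE; case: ifPn => //.
rewrite notin_setE/= in_itv/= /w /trunc_pow => /negP/negbTE ->.
by rewrite mulr0.
Qed.

End power_integrals.

(** * Inversion of the Caputo derivative *)

Section abel_inversion.
Context (R : realType).
Local Notation mu := (@lebesgue_measure R).
Local Notation mR := (measurableTypeR R).
Local Notation int f := (mu.-integrable [set: R] (EFin \o f)).
Implicit Types (k f h F Y G : R -> R) (t T b : R).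

Local Notation one T := (trunc_pow 0 T).

Lemma one_integrable T : 0 < T -> int (one T).
Proof. by move=> T0; apply: trunc_pow_integrable => //; rewrite ltrN10. Qed.

Lemma convol_one T h t : int h -> causal h -> 0 < t < T ->
  convol (one T) h t = \int[mu]_(r in `[0, t]) h r.
Proof.
move=> ih ch /andP[t0 tT].
have iht (a b : itv_bound R) : mu.-integrable [set` Interval a b] (EFin \o h).
  by apply: integrableS ih => //; exact: measurable_itv.
rewrite -Rintegral_itv_bndo_bndc// -Rintegral_itv_obnd_cbnd//.
rewrite Rintegral_mkcond; apply: eq_Rintegral => r _.
rewrite patchE /trunc_pow powRr0.
have [r0|r0] := leP r 0.
  by rewrite ch// mulr0; case: ifPn.
have -> : (r \in (`]0, t[%classic : set R)) = (r < t).
  by apply/idP/idP; rewrite inE/= in_itv/= r0.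
have [rt|tr] := ltP r t.
  by rewrite ifT ?mul1r//; apply/andP; split; lra.
by rewrite ifF ?mul0r//; apply/negbTE; rewrite negb_and -!leNgt subr_le0 tr.
Qed.

(** The primitive is continuous, hence zero everywhere on (0, T), and Lebesgue's
    differentiation theorem recovers [h]. *)
Lemma Rintegral_itv_eq0 h T : int h ->
  {ae mu, forall t, 0 < t < T -> \int[mu]_(r in `[0, t]) h r = 0} ->
  {ae mu, forall t, 0 < t < T -> h t = 0}.
Proof.
move=> ih h0.
have iht (a b : itv_bound R) : mu.-integrable [set` Interval a b] (EFin \o h).
  by apply: integrableS ih => //; exact: measurable_itv.
pose P t := \int[mu]_(r in `[0, t]) h r.
have P0 t : 0 < t < T -> P t = 0.
  move=> /andP[t0 tT].
  have : {within `[0, T], continuous P}.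
    by apply: parameterized_integral_continuous (iht _ _); rewrite ltW// (lt_trans t0).
  have T0 : 0 < T by exact: lt_trans tT.
  move=> /(continuous_within_itvP _ T0)[cP _ _].
  have {}cP : {for t, continuous P} by apply: cP; rewrite in_itv/= t0 tT.
  apply/eqP/negP => /negP Pt.
  have Pt0 : 0 < `|P t| by rewrite normr_gt0.
  have /cvgrPdist_lt/(_ _ Pt0)[r /= r0 rP] := cP.
  pose a := Num.max 0 (t - r); pose b := Num.min T (t + r).
  have ab : a < b by rewrite /a /b gt_max !lt_min; apply/andP; split; apply/andP; split; lra.
  have [x /andP[ax xb] Px] := ae_exists_itv ab h0.
  have [x0 xr] : 0 < x /\ t - r < x by move: ax; rewrite /a gt_max => /andP[].
  have [xT xr'] : x < T /\ x < t + r by move: xb; rewrite /b lt_min => /andP[].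
  have : `|t - x| < r by rewrite ltr_distlC; apply/andP; split; lra.
  by move=> /rP; rewrite /P Px ?x0// subr0 ltxx.
have lh : locally_integrable [set: R] h.
  by have := integrable_locally measurableT ih; rewrite patch_setT.
apply: ae_imp (FTC1 (a := BLeft 0) (fun y => iht _ _) lh) => t dP t0T.
have t0 : 0 < t by case/andP : t0T.
have [] := dP t0 => _ <-; rewrite derive1E.
rewrite (@near_eq_derive _ _ _ _ (cst (0 : R))) ?derive_cst//.
case/andP : t0T => _ tT; near=> x; apply: P0; apply/andP; split; near: x.
- exact: lt_nbhsr.
- exact: lt_nbhsl.
Unshelve. all: by end_near. Qed.

Lemma convol_scalel k f (a t : R) : measurable_fun [set: R] k ->
  measurable_fun [set: R] f -> convol (fun x => a * k x) f t = a * convol k f t.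
Proof.
move=> mk mf; rewrite /convol -Rintegral_scale//.
  by apply: eq_Rintegral => r _; rewrite mulrA.
by apply: measurable_funM => //; exact: measurable_reflect.
Qed.

Lemma convol_sub k f h : int k -> int f -> int h ->
  {ae mu, forall t, convol k (fun r => f r - h r) t = convol k f t - convol k h t}.
Proof.
move=> ik iff ih.
apply: ae_imp2 (convol_ae_integrable ik iff) (convol_ae_integrable ik ih) => t tf th.
rewrite /convol -RintegralB//; apply: eq_Rintegral => r _.
by rewrite mulrBr.
Qed.

Lemma bounded_support_integrable T Y (M : R) : 0 < T ->
  measurable_fun [set: R] Y -> (forall t, `|Y t| <= M) ->
  causal Y -> (forall t, T <= t -> Y t = 0) -> int Y.
Proof.
move=> T0 mY YM cY YT.
apply: (@integrable_le _ mR R mu setT Y (fun t => M * one T t)) => //; last first.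
  by apply: integrable_scale => //; exact: one_integrable.
move=> t _.
rewrite /trunc_pow powRr0; have [t0|t0] := leP t 0.
  by rewrite cY// normr0 mulr0.
have [tT|Tt] := ltP t T; first by rewrite mulr1.
by rewrite YT// normr0 mulr0.
Qed.

(** The function whose derivative is the Caputo derivative of a function with
    increment [Y]: the fractional integral of [Y], or [Y] itself for the exponent 1.
    The constant [c] stands for 1 / Gamma (1 - gamma). *)
Definition caputo_primitive (gamma c T : R) Y t : R :=
  if gamma == 1 then Y t else c * convol (trunc_pow (- gamma) T) Y t.

(** What is used of the increment of a continuous mode. At [T] there may be a jump
    to the value 0 of the extension. *)
Definition admissible T Y : Prop :=
  [/\ measurable_fun [set: R] Y, exists M, forall t, `|Y t| <= M,
      forall t, t < T -> {for t, continuous Y}, causal Y &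
      forall t, T <= t -> Y t = 0].

Lemma caputo_primitive_continuous (gamma c T : R) Y : 0 < gamma <= 1 -> 0 < T ->
  admissible T Y ->
  forall t, t < T -> {for t, continuous (caputo_primitive gamma c T Y)}.
Proof.
move=> /andP[g0 g1] T0 [mY [M YM] cY _ _] t tT; rewrite /caputo_primitive.
have [_|gn1] := eqVneq gamma 1; first exact: cY.
apply: cvgM; first exact: cvg_cst.
apply: (@convol_continuous _ T _ _ M) => //.
- by apply: trunc_pow_integrable => //; rewrite ltrN2 lt_neqAle gn1.
- exact: causal_trunc_pow.
Qed.

Lemma caputo_primitive_causal (gamma c T : R) Y : causal Y ->
  causal (caputo_primitive gamma c T Y).
Proof.
move=> cY t t0; rewrite /caputo_primitive; case: ifPn => _; first exact: cY.
by rewrite convol_causal ?mulr0//; exact: causal_trunc_pow.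
Qed.

(** Two functions with the same weak derivative differ by a constant, and the
    constant is 0 because both sides vanish at 0+. The summand [d] accounts for the
    initial value, which for the exponent 1 is part of [G]. *)
Lemma caputo_primitiveE (gamma c T : R) Y F G (d : R) : 0 < gamma <= 1 -> 0 < T ->
  admissible T Y -> int F -> causal F ->
  (forall t, 0 < t < T -> G t = caputo_primitive gamma c T Y t + d) ->
  (forall eta : R -> R, test_function ((`]0, T[%classic : set mR) : set R^o) eta ->
    \int[mu]_(t in (`]0, T[%classic : set mR)) (derive1 eta t * G t) =
    - \int[mu]_(t in (`]0, T[%classic : set mR)) (eta t * F t)) ->
  forall t, 0 < t < T -> caputo_primitive gamma c T Y t = convol (one T) F t.
Proof.
move=> g01 T0 aY iF cF GE GF b /andP[b0 bT].
have [_ _ _ cY _] := aY.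
pose H := caputo_primitive gamma c T Y.
have cH := caputo_primitive_continuous (c := c) g01 T0 aY.
have iht (u v : itv_bound R) : mu.-integrable [set` Interval u v] (EFin \o F).
  by apply: integrableS iF => //; exact: measurable_itv.
pose P t := \int[mu]_(r in `[0, t]) F r.
have HP a : 0 < a -> a < b -> H b - P b = H a - P a.
  move=> a0 ab.
  have := @weak_derivative_primitive R T (fun t => H t + d) F _ (iht _ _) _ a b a0 ab bT.
  have PB : P b - P a = \int[mu]_(t in `]a, b]) F t.
    by apply: Rintegral_itvB; rewrite ?bnd_simp// ltW.
  have cancel_d (x y q r e : R) : x + e - (y + e) = q - r -> x - q = y - r by lra.
  rewrite -PB => h; apply: (cancel_d _ _ _ _ d); apply: h.
    move=> t /andP[t0 tT]; apply: cvgD; last exact: cvg_cst.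
    exact: cH.
  move=> eta teta; rewrite -GF//; apply: eq_Rintegral => t; rewrite inE/= in_itv/= => tI.
  by rewrite GE.
rewrite convol_one ?b0//; apply/eqP; rewrite -subr_eq0 -/(H b) -/(P b); apply/eqP.
have cst1 : (H b - P b) @[a --> (0 : R)^'+] --> H b - P b by exact: cvg_cst.
have H0 : H a @[a --> (0 : R)^'+] --> H 0.
  by apply: cvg_at_right_filter; exact: cH.
have P0 : P a @[a --> (0 : R)^'+] --> 0.
  apply: cvg_at_right_filter.
  exact: (parameterized_integral_cvg_left (b := b) b0 (iht _ _)).
have lim0 : (H a - P a) @[a --> (0 : R)^'+] --> H 0 - 0 by exact: cvgB.
rewrite /H caputo_primitive_causal// subr0 -/H in lim0.
apply: (cvg_unique _ cst1) => //.
apply: cvg_trans lim0; apply: near_eq_cvg; near=> a.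
have [a0 ab] : 0 < a /\ a < b.
  by split; near: a; [exact: nbhs_right_gt|exact: nbhs_right_lt].
exact: esym (HP a a0 ab).
Unshelve. all: by end_near. Qed.

(** After convolution with x ^ (gamma - 1) the left side becomes a constant times
    the primitive of [Y], and the right side the primitive of the convolution with
    [F]; then differentiate. *)
Lemma abel_inversion (gamma c T : R) : 0 < gamma < 1 -> c != 0 -> 0 < T ->
  exists kappa, [/\ int kappa, causal kappa & forall Y F, int Y -> causal Y ->
    int F -> causal F ->
    (forall t, 0 < t < T ->
      c * convol (trunc_pow (- gamma) T) Y t = convol (one T) F t) ->
    {ae mu, forall t, 0 < t < T -> Y t = convol kappa F t}].
Proof.
move=> g01 c0 T0; have [B B0 BE] := convol_trunc_pow g01 T0.
case/andP : g01 => g0 g1.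
pose kap := trunc_pow (gamma - 1) T; pose k := trunc_pow (- gamma) T.
have ikap : int kap by apply: trunc_pow_integrable => //; lra.
have ik : int k by apply: trunc_pow_integrable => //; lra.
have i1 := one_integrable T0.
have [ck ckap c1] : [/\ causal k, causal kap & causal (one T)].
  by split; exact: causal_trunc_pow.
have cB0 : c * B != 0 by rewrite mulf_neq0// gt_eqF.
exists (fun x => (c * B)^-1 * kap x); split.
- exact: integrable_scale.
- by move=> t t0; rewrite ckap// mulr0.
move=> Y F iY cY iF cF YF.
have [mk mkap m1] : [/\ measurable_fun [set: R] k, measurable_fun [set: R] kap &
    measurable_fun [set: R] (one T)] by split; exact: int_measurable.
have [mY mF] := (int_measurable iY, int_measurable iF).
have ikY := convol_integrable ik iY; have ikF := convol_integrable ikap iF.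
have icBY : int (fun r => c * B * Y r) by exact: integrable_scale.
have ih := integrable_sub measurableT icBY ikF.
have ch : causal (fun r => c * B * Y r - convol kap F r).
  by move=> t t0; rewrite cY// convol_causal// mulr0 subr0.
have : {ae mu, forall t, 0 < t < T ->
    convol (one T) (fun r => c * B * Y r - convol kap F r) t = 0}.
  have A : {ae mu, forall t,
      convol kap (convol k Y) t = convol (convol kap k) Y t /\
      convol kap (convol (one T) F) t = convol (convol kap (one T)) F t}.
    by apply: ae_imp2 (convolA ikap ik iY) (convolA ikap i1 iF) => t; split.
  have A' : {ae mu, forall t,
      convol (one T) (convol kap F) t = convol (convol (one T) kap) F t /\
      convol (one T) (fun r => c * B * Y r - convol kap F r) t =
      convol (one T) (fun r => c * B * Y r) t - convol (one T) (convol kap F) t}.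
    by apply: ae_imp2 (convolA i1 ikap iF) (convol_sub i1 icBY ikF) => t; split.
  apply: ae_imp2 A A' => t [a1 a2] [a3 ->] t0T.
  case/andP: (t0T) => t0 tT.
  have E1 : convol kap (fun r => c * convol k Y r) t = convol kap (convol (one T) F) t.
    apply: (@convol_local _ T) => // [r r0|r rT].
      by rewrite convol_causal// mulr0.
    have [r0|r0] := leP r 0; first by rewrite !convol_causal// mulr0.
    by rewrite YF// r0.
  rewrite convol_scaler// in E1; last exact: int_measurable.
  have E2 : convol (convol kap k) Y t = B * convol (one T) Y t.
    rewrite -convol_scalel//; apply: (@convol_local _ T) => //.
      exact: convol_causal.
    move=> r rT; have [r0|r0] := leP r 0.
      by rewrite convol_causal// c1// mulr0.
    by rewrite BE ?r0// /trunc_pow r0 rT powRr0 mulr1.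
  have E3 : convol kap (one T) = convol (one T) kap.
    by apply/funext => r; exact: convolC.
  rewrite convol_scaler// a3 -E3 -a2 -E1 a1 E2; ring.
move=> h0.
have : {ae mu, forall t, 0 < t < T -> c * B * Y t - convol kap F t = 0}.
  apply: Rintegral_itv_eq0 => //; apply: ae_imp h0 => t h0 t0T.
  by rewrite -(convol_one ih ch t0T); exact: h0.
apply: ae_imp => t h t0T; rewrite convol_scalel//.
by rewrite -(subr0_eq (h t0T)) mulKf.
Qed.

(** The kernel is chosen before the data: all the trajectories and modes to be
    compared later on are represented by the same one. *)
Lemma caputo_inversion (gamma c T : R) : 0 < gamma <= 1 -> c != 0 -> 0 < T ->
  exists kappa, [/\ int kappa, causal kappa & forall Y F G d,
    admissible T Y -> int F -> causal F ->
    (forall t, 0 < t < T -> G t = caputo_primitive gamma c T Y t + d) ->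
    (forall eta : R -> R, test_function ((`]0, T[%classic : set mR) : set R^o) eta ->
      \int[mu]_(t in (`]0, T[%classic : set mR)) (derive1 eta t * G t) =
      - \int[mu]_(t in (`]0, T[%classic : set mR)) (eta t * F t)) ->
    {ae mu, forall t, 0 < t < T -> Y t = convol kappa F t}].
Proof.
move=> g01 c0 T0; have [g1|gn1] := eqVneq gamma 1.
  exists (one T); split; [exact: one_integrable|exact: causal_trunc_pow|].
  move=> Y F G d aY iF cF GE GF; apply: ae_all => t tT.
  have := caputo_primitiveE g01 T0 aY iF cF GE GF tT.
  by rewrite /caputo_primitive g1 eqxx.
have [kap [ikap ckap kapE]] : exists kappa, [/\ int kappa, causal kappa & forall Y F, int Y -> causal Y ->
    int F -> causal F ->
    (forall t, 0 < t < T ->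
      c * convol (trunc_pow (- gamma) T) Y t = convol (one T) F t) ->
    {ae mu, forall t, 0 < t < T -> Y t = convol kappa F t}].
  apply: abel_inversion => //; case/andP : g01 => -> /=.
  by rewrite lt_neqAle gn1.
exists kap; split => // Y F G d aY iF cF GE GF.
have [mY [M YM] _ cY YT] := aY.
apply: kapE => //; first exact: bounded_support_integrable YM cY YT.
move=> t tT; have := caputo_primitiveE g01 T0 aY iF cF GE GF tT.
by rewrite /caputo_primitive (negbTE gn1).
Qed.

End abel_inversion.

(** * Duality and homogeneity for one mode *)

Section scalar_modes.
Context (R : realType).
Local Notation mu := (@lebesgue_measure R).
Local Notation mR := (measurableTypeR R).
Local Notation int f := (mu.-integrable [set: R] (EFin \o f)).
Variables (T : R) (T0 : 0 < T).
Implicit Types (f g y q F E zeta d : R -> R) (a lam tau : R).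

(** The extension by 0 makes Volterra integrals on (0, T) convolutions on the line. *)
Definition L2time f := [/\ measurable_fun [set: R] f,
  int (fun t => f t ^+ 2) & forall t, ~~ (0 < t < T) -> f t = 0].

Lemma L2timeP f : L2time f -> L2 mu [set: R] f.
Proof. by move=> [mf f2 _]; apply: (@L2_sqr _ mR). Qed.

Lemma L2time_causal f : L2time f -> causal f.
Proof. by move=> [_ _ fE] t t0; apply: fE; rewrite ltNge t0. Qed.

Lemma L2time_of f : L2 mu [set: R] f -> (forall t, ~~ (0 < t < T) -> f t = 0) ->
  L2time f.
Proof.
by move=> Lf f0; split => //; [exact: (L2_measurable _ Lf)|exact: (L2_integrable _ Lf)].
Qed.

Lemma L2time_sub f g : L2time f -> L2time g -> L2time (fun t => f t - g t).
Proof.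
move=> Lf Lg; apply: L2time_of; first exact: L2_sub (L2timeP Lf) (L2timeP Lg).
by case: Lf Lg => [_ _ f0] [_ _ g0] t tT; rewrite f0// g0// subr0.
Qed.

Lemma L2time_scale a f : L2time f -> L2time (fun t => a * f t).
Proof.
move=> Lf; apply: L2time_of; first exact: L2_scale (L2timeP Lf).
by case: Lf => [_ _ f0] t tT; rewrite f0// mulr0.
Qed.

Lemma L2time_mul_integrable f g : L2time f -> L2time g -> int (fun t => f t * g t).
Proof. by move=> Lf Lg; apply: (@L2_mul _ mR); [|exact: L2timeP Lf|exact: L2timeP Lg]. Qed.

Lemma L2time_integrable f : L2time f -> int f.
Proof.
move=> [mf f2 f0].
have i1 := one_integrable T0.
apply: (@integrable_le _ mR R mu setT f (fun t => trunc_pow 0 T t + f t ^+ 2)) => //.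
  move=> t _; rewrite /trunc_pow powRr0; case: ifPn => [_|tT].
    have := sqr_ge0 (`|f t| - 1); have := normr_ge0 (f t).
    by rewrite -[f t ^+ 2]real_normK ?num_real//; nra.
  by rewrite f0// normr0 expr0n addr0.
exact: integrable_add.
Qed.

Lemma ae_reflection (P : R -> Prop) : {ae mu, forall t, P t} ->
  {ae mu, forall t, P (T - t)}.
Proof.
move=> [N [mN N0 PN]].
have mN' : measurable ((fun t : R => (T - t : mR)) @^-1` N : set mR).
  have mf : measurable_fun [set: mR] (fun t : mR => (T - t : mR)).
    by apply: measurable_funB.
  by rewrite -[X in measurable X]setTI; exact: mf.
exists ((fun t : R => (T - t : mR)) @^-1` N); split => //.
- have mI : measurable_fun [set: R] (fun x : R => (\1_N x)%:E : \bar R).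
    exact/measurable_EFinP.
  have e (A : set mR) : measurable A -> (\int[mu]_x (\1_A x)%:E = mu A)%E.
    by move=> mA; rewrite integral_indic// setIT.
  have p0 (x : R) : (0 <= (\1_N x)%:E :> \bar R)%E by rewrite lee_fin.
  apply: etrans N0; rewrite -(e N mN) -(ge0_integral_reflection T mI p0).
  by rewrite -(e _ mN'); apply: eq_integral => t _; rewrite !indicE.
- by move=> t /= nPt; apply: (PN (T - t)).
Qed.

(** [F] and [E] are the right-hand sides of a forward and of a backward equation
    with solutions [y] and [q]. *)
Lemma mode_duality kappa y q F E : int kappa ->
  L2time F -> L2time E -> measurable_fun [set: R] y -> measurable_fun [set: R] q ->
  {ae mu, forall t, 0 < t < T -> y t = convol kappa F t} ->
  {ae mu, forall t, 0 < t < T -> q (T - t) = convol kappa (fun r => E (T - r)) t} ->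
  \int[mu]_t (y t * E t) = \int[mu]_t (F t * q t).
Proof.
move=> ik LF LE my mq yE qE.
have [mF F2 F0] := LF; have [mE E2 E0] := LE.
have ikF := convol_integrable ik (L2time_integrable LF).
have LE' := integrable_reflection T (L2time_integrable LE).
have ikE := convol_integrable ik LE'.
have mFq : measurable_fun [set: R] (fun t => F t * q t) by exact: measurable_funM.
transitivity (\int[mu]_t (convol kappa F t * E t)).
  apply: (@ae_eq_Rintegral _ mR) => //.
  - exact: measurable_funM.
  - by apply: measurable_funM => //; exact: int_measurable ikF.
  apply: ae_imp yE => t h _; have [tT|tT] := boolP (0 < t < T).
    by rewrite h.
  by rewrite E0// !mulr0.
rewrite (convol_duality T)//.
rewrite -[LHS](Rintegral_reflection T); last first.
  apply: measurable_funM => //.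
  by apply: (measurable_reflect T); exact: int_measurable ikE.
rewrite -[RHS](Rintegral_reflection T)//.
have mFr := measurable_reflect T mF.
apply: (@ae_eq_Rintegral _ mR) => //.
- apply: measurable_funM => //.
  by under eq_fun do rewrite subKr; exact: int_measurable ikE.
- by apply: measurable_funM => //; exact: measurable_reflect.
apply: ae_imp qE => t h _; rewrite subKr; have [tT|tT] := boolP (0 < t < T).
  by rewrite h.
by rewrite F0 ?mul0r//; apply: contra tT => /andP[? ?]; apply/andP; split; lra.
Qed.

(** In the duality between [y], [E] and [F], [q] both sides contain the integral of
    [lam * y * q], which cancels. *)
Lemma mode_reciprocity kappa lam y q zeta d F E : int kappa ->
  L2time y -> L2time q -> L2time zeta -> L2time d -> L2time F -> L2time E ->
  {ae mu, forall t, 0 < t < T -> F t = zeta t - lam * y t} ->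
  {ae mu, forall t, 0 < t < T -> E t = d t - lam * q t} ->
  {ae mu, forall t, 0 < t < T -> y t = convol kappa F t} ->
  {ae mu, forall t, 0 < t < T -> q (T - t) = convol kappa (fun r => E (T - r)) t} ->
  \int[mu]_t (y t * d t) = \int[mu]_t (zeta t * q t).
Proof.
move=> ik Ly Lq Lz Ld LF LE FE EE yE qE.
have [[my _ y0] [mq _ q0]] := (Ly, Lq).
have [[mz _ z0] [md _ d0]] := (Lz, Ld).
have [[mF _ F0] [mE _ E0]] := (LF, LE).
have iyq := L2time_mul_integrable Ly Lq.
have iyd := L2time_mul_integrable Ly Ld.
have izq := L2time_mul_integrable Lz Lq.
have ilyq : int (fun t => lam * (y t * q t)) by exact: integrable_scale.
have := mode_duality ik LF LE my mq yE qE.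
have -> : \int[mu]_t (y t * E t) = \int[mu]_t (y t * d t - lam * (y t * q t)).
  apply: (@ae_eq_Rintegral _ mR) => //.
  - exact: measurable_funM.
  - by apply: measurable_funB; [|apply: measurable_funM => //]; exact: measurable_funM.
  apply: ae_imp EE => t h _; have [tT|tT] := boolP (0 < t < T).
    by rewrite h//; ring.
  by rewrite y0// !mul0r mulr0 subr0.
have -> : \int[mu]_t (F t * q t) = \int[mu]_t (zeta t * q t - lam * (y t * q t)).
  apply: (@ae_eq_Rintegral _ mR) => //.
  - exact: measurable_funM.
  - by apply: measurable_funB; [|apply: measurable_funM => //]; exact: measurable_funM.
  apply: ae_imp FE => t h _; have [tT|tT] := boolP (0 < t < T).
    by rewrite h//; ring.
  by rewrite q0// !mulr0 subr0.
rewrite !RintegralB//; lra.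
Qed.

(** The defect y2 - tau y1 solves a homogeneous Volterra equation. *)
Lemma mode_scaling kappa lam tau y1 y2 zeta1 zeta2 F1 F2 : int kappa -> causal kappa ->
  L2time y1 -> L2time y2 -> L2time F1 -> L2time F2 ->
  {ae mu, forall t, 0 < t < T -> F1 t = zeta1 t - lam * y1 t} ->
  {ae mu, forall t, 0 < t < T -> F2 t = zeta2 t - lam * y2 t} ->
  {ae mu, forall t, 0 < t < T -> zeta2 t = tau * zeta1 t} ->
  {ae mu, forall t, 0 < t < T -> y1 t = convol kappa F1 t} ->
  {ae mu, forall t, 0 < t < T -> y2 t = convol kappa F2 t} ->
  {ae mu, forall t, y2 t = tau * y1 t}.
Proof.
move=> ik ck Ly1 Ly2 LF1 LF2 FE1 FE2 zE yE1 yE2.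
have Lw := L2time_sub Ly2 (L2time_scale tau Ly1).
pose w t := y2 t - tau * y1 t; rewrite -/w in Lw.
have [iF1 iF2] := (L2time_integrable LF1, L2time_integrable LF2).
have iw := L2time_integrable Lw.
have [mF1 mk] := (int_measurable iF1, int_measurable ik).
have [mw mF2] := (int_measurable iw, int_measurable iF2).
have itF1 : int (fun t => tau * F1 t) by exact: integrable_scale.
have Fw : {ae mu, forall t, F2 t - tau * F1 t = - lam * w t}.
  have FE12 : {ae mu, forall t, 0 < t < T ->
      F1 t = zeta1 t - lam * y1 t /\ F2 t = zeta2 t - lam * y2 t}.
    by apply: ae_imp2 FE1 FE2 => t h1 h2 tT; split; [exact: h1|exact: h2].
  apply: ae_imp2 FE12 zE => t h zt; have [tT|tT] := boolP (0 < t < T).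
    by have [-> ->] := h tT; rewrite zt// /w; ring.
  case: LF1 LF2 Lw => [_ _ F10] [_ _ F20] [_ _ w0].
  by rewrite F10// F20// w0// !mulr0 subrr.
have wE : {ae mu, forall t, t < T -> w t = - lam * convol kappa w t}.
  have yE12 : {ae mu, forall t, 0 < t < T ->
      y1 t = convol kappa F1 t /\ y2 t = convol kappa F2 t}.
    by apply: ae_imp2 yE1 yE2 => t h1 h2 tT; split; [exact: h1|exact: h2].
  apply: ae_imp2 yE12 (convol_sub ik iF2 itF1) => t h ct tT.
  have [t0|t0] := leP t 0.
    have cw := L2time_causal Lw.
    by rewrite cw// convol_causal// mulr0.
  have [e1 e2] : y1 t = convol kappa F1 t /\ y2 t = convol kappa F2 t by apply: h; rewrite t0.
  rewrite {1}/w e1 e2 -convol_scaler// -ct -convol_scaler//.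
  apply: (@ae_eq_Rintegral _ mR) => //.
  - apply: measurable_funM; first exact: measurable_reflect.
    by apply: measurable_funB => //; exact: measurable_funM.
  - apply: measurable_funM; first exact: measurable_reflect.
    exact: measurable_funM.
  by apply: ae_imp Fw => r -> _.
have cw := L2time_causal Lw.
have wT t : T <= t -> w t = 0.
  by move=> Tt; case: Lw => [_ _]; apply; rewrite negb_and -!leNgt Tt orbT.
apply: ae_imp (volterra_uniqueness ik iw ck cw wT wE) => t /eqP.
by rewrite subr_eq0 => /eqP.
Qed.

End scalar_modes.

(** * Slices of the space-time cylinder *)

(** The sigma-algebra on row vectors is generated by the coordinates, and an open set is a
    countable union of boxes with rational centres and radii 1 / (m + 1). *)
Lemma open_rV_measurable (R : realType) n (U : set 'rV[R]_n) :
  open U -> measurable U.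
Proof.
move=> oU.
pose box (p : 'rV[rat]_n * nat) : set 'rV[R]_n :=
  [set x | forall i, `|x ord0 i - ratr (p.1 ord0 i)| < p.2.+1%:R^-1].
have mbox p : measurable (box p).
  have -> : box p = \bigcap_(i in [set: 'I_n])
      ((fun x : 'rV[R]_n => x ord0 i : measurableTypeR R) @^-1`
        (ball (ratr (p.1 ord0 i) : R) p.2.+1%:R^-1)).
    apply/seteqP; split => x h i; last by have := h i Logic.I; rewrite /= distrC.
    by move=> _; have := h i; rewrite /= distrC.
  apply: fin_bigcap_measurable => [|i _]; first exact: finite_finset.
  by rewrite -[X in measurable X]setTI; apply: measurable_coord => //; exact: measurable_ball.
have -> : U = \bigcup_p (if `[< box p `<=` U >] then box p else set0).
  apply/seteqP; split => [x Ux|x [p _]]; last by case: asboolP => // pU /pU.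
  have /nbhs_ballP[e /= e0 eU] : nbhs x U by apply: open_nbhs_nbhs; split.
  have e20 : 0 < e / 2 by rewrite divr_gt0.
  have [m me] : exists m, m.+1%:R^-1 < e / 2.
    have := @cvg_harmonic R => /cvgr_lt /(_ _ e20) [N _ /(_ N (leqnn N))] hN.
    by exists N.
  have m0 : 0 < m.+1%:R^-1 :> R by rewrite invr_gt0.
  have qex (i : 'I_n) : exists q : rat, `|x ord0 i - ratr q| < m.+1%:R^-1.
    have /rat_in_itvoo[q] : x ord0 i - m.+1%:R^-1 < x ord0 i + m.+1%:R^-1 by rewrite ltrBlDr -addrA ltrDl addr_gt0.
    by rewrite in_itv/= => h; exists q; rewrite ltr_distlC.
  have [q hq] := choice qex.
  exists (\row_i q i, m) => //; rewrite asboolT.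
    by move=> i /=; rewrite mxE; exact: hq.
  move=> y yq; apply: eU; split => // i j; rewrite ord1.
  have := yq j; have := hq j; rewrite /= mxE => xq yq'.
  rewrite /ball/= (le_lt_trans (ler_distD (ratr (q j)) _ _))//.
  rewrite [`|ratr _ - _|]distrC (splitr e) ltrD//; exact: lt_trans me.
apply: countable_bigcupT_measurable => // p.
by case: asboolP => // _; exact: measurable0.
Qed.

Section space_time.
Context (R : realType) (n : nat).
Variables (Omega : set 'rV[R]_n) (T : R).
Hypotheses (oOmega : open Omega) (T0 : 0 < T).

Local Notation Rn := 'rV[R]_n.
Local Notation leb := (lebesgue_rV n).
Local Notation leb1 := (@lebesgue_measure R).
Local Notation mR := (measurableTypeR R).
Local Notation lebQ := (leb \x leb1)%E.
Local Notation L2O := (L2 leb Omega).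
Local Notation ipO := (L2dot leb Omega).
Local Notation sqO := (L2sqnorm leb Omega).
Local Notation I0T := (`]0, T[%classic : set mR).
Local Notation cyl := (cylinder Omega T).
Local Notation L2Q := (L2Q Omega T).
Local Notation L2Qdot := (L2Qdot Omega T).

Lemma mOmega : measurable Omega. Proof. exact: open_rV_measurable. Qed.

Lemma mI0T : measurable I0T. Proof. exact: measurable_itv. Qed.

Lemma measurable_slab (D : set mR) : measurable D ->
  measurable (Omega `*` D : set (Rn * mR)).
Proof. by move=> mD; apply: measurableX => //; exact: mOmega. Qed.

Lemma mcyl : measurable (cyl : set (Rn * mR)).
Proof. exact: measurable_slab mI0T. Qed.

Section slab.
Variables (D : set mR) (mD : measurable D).
Implicit Types h : Rn * mR -> R.

(** Integrals over the slab are treated as integrals over the product space of the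
    extension by 0, to which the Fubini theorems apply. *)
Lemma slab_patch h x t : (h \_ (Omega `*` D)) (x, t) =
  (((fun t => ((fun x => h (x, t)) \_ Omega) x)) \_ D) t.
Proof.
rewrite !patchE in_setX; have [tD|tD] := boolP (t \in D).
  by rewrite andbT.
by rewrite andbF.
Qed.

Let mslab : measurable (Omega `*` D : set (Rn * mR)).
Proof. exact: measurable_slab. Qed.

Lemma measurable_slice_space h t : measurable_fun (Omega `*` D) h -> D t ->
  measurable_fun Omega (fun x => h (x, t)).
Proof.
move=> /(measurable_restrictT _ mslab) mh Dt; apply/(measurable_restrictT _ mOmega).
have := measurableT_comp mh (pair2_measurable t); rewrite (_ : _ \o _ = (fun x => h (x, t)) \_ Omega)//.
by apply/funext => x; rewrite /= slab_patch patchE mem_set.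
Qed.

Lemma measurable_slice_time h x : measurable_fun (Omega `*` D) h -> Omega x ->
  measurable_fun D (fun t => h (x, t)).
Proof.
move=> /(measurable_restrictT _ mslab) mh Ox; apply/(measurable_restrictT _ mD).
have := measurableT_comp mh (pair1_measurable x); rewrite (_ : _ \o _ = (fun t => h (x, t)) \_ D)//.
apply/funext => t; rewrite /= slab_patch !patchE; case: ifPn => // _.
by rewrite mem_set.
Qed.

Lemma slice_tonelli h : measurable_fun (Omega `*` D) h -> (forall y, 0 <= h y) ->
  measurable_fun D (fun t => \int[leb]_(x in Omega) (h (x, t))%:E)%E /\
  (\int[lebQ]_(y in Omega `*` D) (h y)%:E =
   \int[leb1]_(t in D) \int[leb]_(x in Omega) (h (x, t))%:E)%E.
Proof.
move=> mh h0; pose hp y := ((h \_ (Omega `*` D)) y)%:E.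
have mhp : measurable_fun [set: Rn * mR] hp.
  exact/measurable_EFinP/(measurable_restrictT _ mslab).
have hp0 y : (0 <= hp y)%E.
  by rewrite /hp patchE; case: ifP => _; rewrite lee_fin.
have G t : (\int[leb]_x hp (x, t) =
    ((fun t => \int[leb]_(x in Omega) (h (x, t))%:E) \_ D) t)%E.
  rewrite patchE; case: ifPn => tD.
    rewrite [RHS]integral_mkcond; apply: eq_integral => x _.
    by rewrite /hp slab_patch !patchE tD; case: ifP.
  rewrite -[RHS](integral0 leb setT); apply: eq_integral => x _.
  by rewrite /hp slab_patch patchE (negbTE tD).
split.
  apply/(measurable_restrictT _ mD); rewrite -(funext G).
  exact: (measurable_fun_fubini_tonelli_G (m1 := leb) hp mhp hp0).
rewrite integral_mkcond [RHS]integral_mkcond -(funext G).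
rewrite -(fubini_tonelli2 (m1 := leb) (m2 := leb1) hp mhp hp0).
by apply: eq_integral => y _; rewrite /hp !patchE; case: ifP.
Qed.

Section integrable_slab.
Variable h : Rn * mR -> R.
Hypothesis ih : lebQ.-integrable (Omega `*` D) (EFin \o h).

Let hp := h \_ (Omega `*` D).

Let ihp : lebQ.-integrable [set: Rn * mR] (EFin \o hp).
Proof. by have := (integrable_mkcond _ mslab).1 ih; rewrite restrict_EFin. Qed.

Let hpE t : (fun x => hp (x, t)) = if t \in D then (fun x => h (x, t)) \_ Omega else cst 0.
Proof. by apply/funext => x; rewrite /hp slab_patch patchE; case: ifPn. Qed.

Let RG t : \int[leb]_x hp (x, t) = ((fun t => \int[leb]_(x in Omega) h (x, t)) \_ D) t.
Proof.
rewrite patchE; have := hpE t; case: ifPn => tD e.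
  by rewrite [RHS]Rintegral_mkcond -e.
rewrite (_ : (fun x => hp (x, t)) = cst 0)//.
by rewrite Rintegral_cst// mul0r.
Qed.

Lemma slice_integrable : leb1.-integrable D (EFin \o (fun t => \int[leb]_(x in Omega) h (x, t))).
Proof.
apply/(integrable_mkcond _ mD); rewrite restrict_EFin.
have := Rintegral_fst_integrable ihp.
by congr (integrable _ _ (EFin \o _)); apply/funext => t; exact: RG.
Qed.

Lemma Rintegral_slice : \int[lebQ]_(y in Omega `*` D) h y =
  \int[leb1]_(t in D) (\int[leb]_(x in Omega) h (x, t)).
Proof.
rewrite Rintegral_mkcond [RHS]Rintegral_mkcond -(Rintegral21_prod ihp).
by apply: eq_Rintegral => t _; exact: RG.
Qed.

Lemma slice_ae_integrable :
  {ae leb1, forall t, D t -> leb.-integrable Omega (EFin \o (fun x => h (x, t)))}.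
Proof.
apply: ae_imp (ae_integrable2 ihp) => t it Dt.
apply/(integrable_mkcond _ mOmega); rewrite restrict_EFin.
by move: it; rewrite (_ : (fun x => _) = EFin \o (fun x => hp (x, t)))// hpE mem_set.
Qed.

Lemma Rintegral_slice_swap :
  \int[leb]_(x in Omega) (\int[leb1]_(t in D) h (x, t)) =
  \int[leb1]_(t in D) (\int[leb]_(x in Omega) h (x, t)) /\
  measurable_fun Omega (fun x => \int[leb1]_(t in D) h (x, t)).
Proof.
have RF x : \int[leb1]_t hp (x, t) = ((fun x => \int[leb1]_(t in D) h (x, t)) \_ Omega) x.
  rewrite patchE; case: ifPn => xO.
    rewrite [RHS]Rintegral_mkcond; apply: eq_Rintegral => t _.
    by rewrite /hp slab_patch !patchE xO.
  rewrite (_ : (fun t => hp (x, t)) = cst 0) ?Rintegral_cst ?mul0r//.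
  by apply/funext => t; rewrite /hp slab_patch !patchE (negbTE xO); case: ifP.
split.
  rewrite Rintegral_mkcond [RHS]Rintegral_mkcond.
  rewrite -(funext RF) -(funext RG); exact: RFubini ihp.
apply/(measurable_restrictT _ mOmega).
by rewrite -(funext RF); exact: measurable_Rintegral_snd ihp.
Qed.

End integrable_slab.
End slab.

Implicit Types (u w z g : R -> Rn -> R) (v f : Rn -> R).

Lemma L2Q_slice w : L2Q w -> {ae leb1, forall t, I0T t -> L2O (w t)}.
Proof.
move=> Lw; have := slice_ae_integrable mI0T (L2_integrable mcyl Lw).
apply: ae_imp => t iw It; apply: (L2_sqr mOmega); last exact: iw.
exact: (measurable_slice_space mI0T (L2_measurable mcyl Lw) It).
Qed.

Lemma L2Q_ipO_integrable u w : L2Q u -> L2Q w ->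
  leb1.-integrable I0T (EFin \o (fun t => ipO (u t) (w t))).
Proof. by move=> Lu Lw; exact: (slice_integrable mI0T (L2_mul mcyl Lu Lw)). Qed.

Lemma L2QdotE u w : L2Q u -> L2Q w ->
  L2Qdot u w = \int[leb1]_(t in I0T) ipO (u t) (w t).
Proof. by move=> Lu Lw; exact: (Rintegral_slice mI0T (L2_mul mcyl Lu Lw)). Qed.

Lemma L2Q_sqnormE u : measurable_fun cyl (uncurryQ u) ->
  measurable_fun I0T (fun t => sqO (u t)) /\
  L2sqnorm lebQ cyl (uncurryQ u) = (\int[leb1]_(t in I0T) sqO (u t))%E.
Proof.
move=> mu_; apply: (slice_tonelli mI0T (h := fun y => uncurryQ u y ^+ 2)).
  exact: measurable_funX.
by move=> y; exact: sqr_ge0.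
Qed.

Lemma measurable_space v : measurable_fun Omega v ->
  measurable_fun [set: Rn * mR] (fun y => (v \_ Omega) y.1).
Proof.
move=> /(measurable_restrictT _ mOmega) mv.
exact: (measurableT_comp mv measurable_fst).
Qed.

Lemma measurable_space_slab (D : set mR) v : measurable D -> measurable_fun Omega v ->
  measurable_fun (Omega `*` D : set (Rn * mR)) (fun y => v y.1).
Proof.
move=> mD mv; apply: eq_measurable_fun (measurable_funTS (measurable_space mv)).
by move=> y; rewrite in_setX => /andP[y1 _]; rewrite patchE y1.
Qed.

Lemma integral_I0T_cst (M : R) : (\int[leb1]_(t in I0T) M%:E = (M * T)%:E)%E.
Proof.
rewrite integral_cst//.
by rewrite /= lebesgue_measure_itv/= lte_fin T0 -EFinB subr0 -EFinM.
Qed.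

Lemma L2Q_const v : L2O v -> L2Q (fun=> v).
Proof.
move=> Lv.
have mv : measurable_fun cyl (uncurryQ (fun=> v)).
  exact: (measurable_space_slab mI0T (L2_measurable mOmega Lv)).
apply: (L2_lty mcyl) => //; rewrite (L2Q_sqnormE mv).2.
by rewrite (L2sqnormE mOmega Lv) integral_I0T_cst ltry.
Qed.

Lemma LinftyL2_L2Q u : LinftyL2 Omega T u -> L2Q u.
Proof.
move=> [mu_ [M uM]]; apply: (L2_lty mcyl) => //.
have [msq ->] := L2Q_sqnormE mu_.
apply: (@le_lt_trans _ _ (\int[leb1]_(t in I0T) (Num.max 0 M)%:E)%E).
  apply: ae_ge0_le_integral => //.
  - by move=> t _; apply: integral_ge0 => x _; rewrite lee_fin sqr_ge0.
  - by move=> t _; rewrite lee_fin le_max lexx.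
  - apply: ae_imp uM => t uM It; apply: le_trans (uM It) _.
    by rewrite lee_fin le_max lexx orbT.
by rewrite integral_I0T_cst ltry.
Qed.

(** Fubini: the integrand is dominated by |om| (|g|^2 + |v|^2), which is integrable
    because the trajectory is bounded in L^2. This turns the fractional integral of
    a trajectory into that of its modes. *)
Lemma ipO_time_integral (D : set mR) (om : R -> R) g v (C M : R) :
  measurable D -> D `<=` I0T -> leb1.-integrable D (EFin \o om) ->
  measurable_fun cyl (uncurryQ g) ->
  {ae leb1, forall t, I0T t -> (sqO (g t) <= M%:E)%E} -> L2O v ->
  ipO (fun x => C * \int[leb1]_(r in D) (om r * g r x)) v =
  C * \int[leb1]_(r in D) (om r * ipO (g r) v).
Proof.
move=> mD DI iom mg gM Lv.
have mv := L2_measurable mOmega Lv.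
have mom : measurable_fun D om by apply/measurable_EFinP; case/integrableP : iom.
have mslab := measurable_slab mD.
have mgD : measurable_fun (Omega `*` D) (uncurryQ g).
  apply: measurable_funS mg; first exact: mcyl.
  by move=> [x t] [Ox Dt]; split => //; exact: DI.
have momD : measurable_fun (Omega `*` D : set (Rn * mR)) (fun y => om y.2).
  apply: eq_measurable_fun (measurable_funTS (measurableT_comp
    ((measurable_restrictT _ mD).1 mom) measurable_snd)).
  by move=> y; rewrite in_setX => /andP[_ y2]; rewrite /= patchE y2.
have mvD := measurable_space_slab mD mv.
pose h (y : Rn * mR) := om y.2 * (uncurryQ g y * v y.1).
have mh : measurable_fun (Omega `*` D) h.
  by apply: measurable_funM => //; exact: measurable_funM.
pose V := ipO v v; pose M' := Num.max 0 M.
have ih : lebQ.-integrable (Omega `*` D) (EFin \o h).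
  apply/integrableP; split; first exact/measurable_EFinP.
  have mnh : measurable_fun (Omega `*` D) (fun y => `|h y|) by exact: measurableT_comp.
  have nh0 y : 0 <= `|h y| by [].
  have [mG ->] := slice_tonelli mD mnh nh0.
  have iB : leb1.-integrable D (EFin \o (fun r => (M' + V) * `|om r|)).
    by apply: integrable_scale => //; exact: integrable_norm.
  apply: (@le_lt_trans _ _ (\int[leb1]_(r in D) ((M' + V) * `|om r|)%:E)%E); last first.
    exact: integrable_lty iB.
  have MV : 0 <= M' + V by rewrite addr_ge0 ?L2dot_ge0// le_max lexx.
  apply: ae_ge0_le_integral => //.
  - by move=> t _; apply: integral_ge0 => x _.
  - by move=> t _; rewrite lee_fin mulr_ge0.
  - by case/integrableP : iB.
  apply: ae_imp gM => r gr Dr; have Ir := DI _ Dr.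
  have mgr := measurable_slice_space mD mgD Dr; rewrite /uncurryQ/= in mgr.
  have mgv : measurable_fun Omega (fun x => `|g r x * v x|).
    by apply: measurableT_comp => //; exact: measurable_funM.
  have -> : (\int[leb]_(x in Omega) `|h (x, r)|%:E =
      `|om r|%:E * \int[leb]_(x in Omega) `|g r x * v x|%:E)%E.
    rewrite -ge0_integralZl//; last 2 first.
      exact: mOmega.
      exact/measurable_EFinP.
    by apply: eq_integral => x _; rewrite /h/= normrM EFinM.
  rewrite mulrC EFinM lee_wpmul2l//.
  apply: (@le_trans _ _ (sqO (g r) + sqO v)%E); last first.
    rewrite EFinD leeD//; last by rewrite (L2sqnormE mOmega Lv).
    by apply: le_trans (gr Ir) _; rewrite lee_fin le_max lexx orbT.
  rewrite -ge0_integralD//; first last.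
  - by apply/measurable_EFinP; exact: measurable_funX.
  - by move=> x _; rewrite lee_fin sqr_ge0.
  - by apply/measurable_EFinP; exact: measurable_funX.
  - by move=> x _; rewrite lee_fin sqr_ge0.
  - exact: mOmega.
  apply: ge0_le_integral_nm => x _ //; rewrite -EFinD lee_fin normrM.
  have := sqr_ge0 (`|g r x| - `|v x|); have := sqr_ge0 (`|g r x|).
  have := sqr_ge0 (`|v x|).
  rewrite -[g r x ^+ 2]real_normK ?num_real// -[v x ^+ 2]real_normK ?num_real//.
  nra.
have [swap mJ] := Rintegral_slice_swap mD ih.
have JE x : Omega x -> \int[leb1]_(r in D) h (x, r) =
    (\int[leb1]_(r in D) (om r * g r x)) * v x.
  move=> Ox; rewrite mulrC -Rintegral_scale//; last first.
    apply: measurable_funM => //.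
    exact: (measurable_slice_time mD mgD Ox).
  by apply: eq_Rintegral => r _; rewrite /h/= /uncurryQ/=; ring.
rewrite /L2dot; transitivity (\int[leb]_(x in Omega) (C * \int[leb1]_(r in D) h (x, r))).
  apply: eq_Rintegral => x; rewrite inE => Ox; rewrite JE//; ring.
rewrite Rintegral_scale//; last exact: mOmega.
rewrite swap; congr (_ * _); apply: eq_Rintegral => r; rewrite inE => Dr.
rewrite -Rintegral_scale//; first exact: mOmega.
apply: measurable_funM => //.
exact: (measurable_slice_space mD mgD Dr).
Qed.

End space_time.

(** * Parseval's identity in space-time *)

Section parseval.
Context (R : realType) (n : nat).
Variables (Omega : set 'rV[R]_n) (T : R).
Hypotheses (oOmega : open Omega) (T0 : 0 < T).

Local Notation Rn := 'rV[R]_n.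
Local Notation leb := (lebesgue_rV n).
Local Notation leb1 := (@lebesgue_measure R).
Local Notation mR := (measurableTypeR R).
Local Notation lebQ := (leb \x leb1)%E.
Local Notation L2O := (L2 leb Omega).
Local Notation ipO := (L2dot leb Omega).
Local Notation sqO := (L2sqnorm leb Omega).
Local Notation I0T := (`]0, T[%classic : set mR).
Local Notation cyl := (cylinder Omega T).
Local Notation L2Q := (L2Q Omega T).
Local Notation L2Qdot := (L2Qdot Omega T).

Implicit Types (u w z : R -> Rn -> R) (f g v : Rn -> R).

Let mO : measurable Omega := mOmega oOmega.
Let mI : measurable I0T := @mI0T R T.
Let mC := mcyl T oOmega.

Lemma ipO_L2 u v : L2Q u -> L2O v -> L2 leb1 I0T (fun t => ipO (u t) v).
Proof.
move=> Lu Lv.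
have iuv := L2Q_ipO_integrable oOmega Lu (L2Q_const oOmega T0 Lv).
have iuu := L2Q_ipO_integrable oOmega Lu Lu.
have muv : measurable_fun I0T (fun t => ipO (u t) v).
  by apply/measurable_EFinP; case/integrableP : iuv.
have iV := integrable_scale (ipO v v) mI iuu.
apply: (L2_lty mI) => //; rewrite /L2sqnorm.
apply: (@le_lt_trans _ _ (\int[leb1]_(t in I0T) (ipO v v * ipO (u t) (u t))%:E)%E); last first.
  exact: integrable_lty iV.
apply: ae_ge0_le_integral => //.
- by move=> t _; rewrite lee_fin sqr_ge0.
- by apply/measurable_EFinP; exact: measurable_funX.
- by move=> t _; rewrite lee_fin mulr_ge0// L2dot_ge0.
- by case/integrableP : iV.
apply: ae_imp (L2Q_slice oOmega Lu) => t ut It.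
by rewrite lee_fin mulrC; apply: L2_CauchySchwarz => //; exact: ut.
Qed.

Lemma L2Q_sub u w : L2Q u -> L2Q w -> L2Q (fun t x => u t x - w t x).
Proof. exact: (L2_sub mC). Qed.

Lemma L2Q_add u w : L2Q u -> L2Q w -> L2Q (fun t x => u t x + w t x).
Proof. exact: (L2_add mC). Qed.

Lemma L2Q_scale (a : R) u : L2Q u -> L2Q (fun t x => a * u t x).
Proof. exact: (L2_scale mC). Qed.

Lemma costE (mu : R) ud u z : L2Q u -> L2Q ud -> L2Q z ->
  let e := fun t x => u t x - ud t x in
  cost Omega T mu ud u z = 2^-1 * (L2Qdot e e + mu * L2Qdot z z).
Proof.
move=> Lu Lud Lz e; have Le := L2Q_sub Lu Lud.
have iee := L2Q_ipO_integrable oOmega Le Le.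
have izz := L2Q_ipO_integrable oOmega Lz Lz.
have [mee mzz] : measurable_fun I0T (fun t => ipO (e t) (e t)) /\
    measurable_fun I0T (fun t => ipO (z t) (z t)).
  by split; apply/measurable_EFinP; [case/integrableP : iee|case/integrableP : izz].
rewrite (L2QdotE oOmega Le Le) (L2QdotE oOmega Lz Lz).
rewrite -Rintegral_scale// -RintegralD//; last exact: integrable_scale.
Qed.

Variable phi : nat -> Rn -> R.
Hypothesis hphi : orthonormal_basis Omega phi.

Let Lphi k : L2O (phi k). Proof. by case: hphi. Qed.

Let expansion N f x := \sum_(k < N) ipO f (phi k) * phi k x.

Let L2_expansion N f : L2O (expansion N f).
Proof. by apply: (L2_sum mO) => k; apply: (L2_scale mO). Qed.

Let expansion_dot N f g : L2O g ->
  ipO (expansion N f) g = \sum_(k < N) ipO f (phi k) * ipO g (phi k).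
Proof.
move=> Lg; rewrite (L2dot_suml mO)//; last by move=> k; apply: (L2_scale mO).
by apply: eq_bigr => k _; rewrite (L2dotZl mO)// (L2dotC _ _ (phi k)).
Qed.

Lemma parseval f g : L2O f -> L2O g ->
  \sum_(k < N) ipO f (phi k) * ipO g (phi k) @[N --> \oo] --> ipO f g.
Proof.
move=> Lf Lg; have [_ _ /(_ f Lf) fphi] := hphi.
have Ld N : L2O (fun x => f x - expansion N f x) by exact: (L2_sub mO).
have h := L2dot_cvg0 mO (F := \oo) _ Ld Lg fphi.
have E : (fun N => ipO (fun x => f x - expansion N f x) g) =
    (fun N => ipO f g - \sum_(k < N) ipO f (phi k) * ipO g (phi k)).
  by apply/funext => N; rewrite (L2dotBl mO)// expansion_dot.
rewrite E in h.
have : (ipO f g - (ipO f g - \sum_(k < N) ipO f (phi k) * ipO g (phi k)))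
    @[N --> \oo] --> ipO f g - 0.
  by apply: cvgB; [exact: cvg_cst|exact: h].
by rewrite subr0; under eq_fun do rewrite subKr.
Qed.

Lemma bessel f N : L2O f -> \sum_(k < N) ipO f (phi k) ^+ 2 <= ipO f f.
Proof.
move=> Lf; have LN := L2_expansion N f.
have := L2dot_ge0 leb Omega (fun x => f x - expansion N f x).
rewrite (L2dotBl mO)//; last exact: (L2_sub mO).
rewrite (L2dotC _ _ f) (L2dotC _ _ (expansion N f)) !(L2dotBl mO)//.
rewrite (L2dotC _ _ f (expansion N f)) !expansion_dot//.
have -> : \sum_(k < N) ipO f (phi k) * ipO (expansion N f) (phi k) =
    \sum_(k < N) ipO f (phi k) * ipO f (phi k).
  apply: eq_bigr => k _; congr (_ * _); rewrite expansion_dot//.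
  have [_ on _] := hphi.
  rewrite (bigD1 k)//= on eqxx mulr1 big1 ?addr0// => j jk.
  by rewrite on eq_sym (_ : (_ == _) = false) ?mulr0//; exact/negbTE.
by under [in X in _ -> X]eq_bigr do rewrite expr2; lra.
Qed.

Lemma parseval_bound f g N : L2O f -> L2O g ->
  `|\sum_(k < N) ipO f (phi k) * ipO g (phi k)| <= ipO f f + ipO g g.
Proof.
move=> Lf Lg; apply: le_trans (ler_norm_sum _ _ _) _.
apply: le_trans (lerD (bessel N Lf) (bessel N Lg)); rewrite -big_split/=.
apply: ler_sum => k _; rewrite normrM.
set a := ipO f _; set b := ipO g _.
have := sqr_ge0 (`|a| - `|b|); have := sqr_ge0 `|a|; have := sqr_ge0 `|b|.
rewrite -[a ^+ 2]real_normK ?num_real// -[b ^+ 2]real_normK ?num_real//.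
nra.
Qed.

(** Parseval's identity at almost every time, integrated in time. By Bessel's
    inequality the partial sums are dominated by |u|^2 + |w|^2. *)
Lemma L2Qdot_modes u w : L2Q u -> L2Q w ->
  \sum_(k < N) \int[leb1]_(t in I0T) (ipO (u t) (phi k) * ipO (w t) (phi k))
    @[N --> \oo] --> L2Qdot u w.
Proof.
move=> Lu Lw.
have iuw k : leb1.-integrable I0T
    (EFin \o (fun t => ipO (u t) (phi k) * ipO (w t) (phi k))).
  by apply: (L2_mul mI); exact: ipO_L2.
have iuu := L2Q_ipO_integrable oOmega Lu Lu.
have iww := L2Q_ipO_integrable oOmega Lw Lw.
have iu_w := L2Q_ipO_integrable oOmega Lu Lw.
have slices : {ae leb1, forall t, I0T t -> L2O (u t) /\ L2O (w t)}.
  by apply: ae_imp2 (L2Q_slice oOmega Lu) (L2Q_slice oOmega Lw) => t ut wt It; split;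
    [exact: ut|exact: wt].
pose S N t := \sum_(k < N) ipO (u t) (phi k) * ipO (w t) (phi k).
have iS N : leb1.-integrable I0T (EFin \o S N).
  have := @integrable_sum _ _ _ leb1 I0T mI _ (index_enum 'I_N) xpredT
    (fun k t => (ipO (u t) (phi k) * ipO (w t) (phi k))%:E) (fun k _ => iuw k).
  by congr (integrable _ _ _); apply/funext => t; rewrite /= sumEFin.
have SE N : \sum_(k < N) \int[leb1]_(t in I0T) (ipO (u t) (phi k) * ipO (w t) (phi k)) =
    \int[leb1]_(t in I0T) S N t.
  elim: N => [|N IH].
    rewrite big_ord0 /S; under eq_Rintegral do rewrite big_ord0.
    by rewrite Rintegral_cst// mul0r.
  rewrite big_ord_recr/= IH -RintegralD//.
  by apply: eq_Rintegral => t _; rewrite /S big_ord_recr.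
under eq_fun do rewrite SE.
rewrite (L2QdotE oOmega Lu Lw).
have [|||||iF _] := @dominated_convergence _ _ _ leb1 I0T mI
  (fun N t => (S N t)%:E) (fun t => (ipO (u t) (w t))%:E)
  (fun t => (ipO (u t) (u t) + ipO (w t) (w t))%:E).
- by move=> N; case/integrableP : (iS N).
- by case/integrableP : iu_w.
- apply: ae_imp slices => t uw It; have [ut wt] := uw It.
  apply/fine_cvgP; split; first exact: nearW.
  exact: parseval.
- exact: integrable_add.
- apply: ae_imp slices => t uw N It; have [ut wt] := uw It.
  by rewrite lee_fin; exact: parseval_bound.
by rewrite -(EFin_Rintegral mI iu_w) => /fine_cvg.
Qed.

End parseval.

(** * The Gamma function *)

Section Gamma_function.
Context (R : realType).
Local Notation mu := (@lebesgue_measure R).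
Local Notation mR := (measurableTypeR R).

(** A majorant of the form t ^ p near 0 and t ^ q near infinity, integrable at both
    ends. It serves for the Gamma integral and for the norm of H^s. *)
Lemma integral_half_line_le (f : R -> \bar R) (C p q : R) : 0 <= C -> -1 < p -> q < -1 ->
  (forall t : R, (0 < t)%R -> 0 <= f t)%E ->
  (forall t : R, (0 < t)%R -> (t <= 1)%R -> f t <= (C * t `^ p)%R%:E)%E ->
  (forall t : R, (1 <= t)%R -> f t <= (C * t `^ q)%R%:E)%E ->
  (\int[mu]_(t in `]0%R, +oo[) f t <= (C * ((p + 1)^-1 - (q + 1)^-1))%R%:E)%E.
Proof.
move=> C0 p1 q1 f0 fp fq.
pose g1 := ((@powR R ^~ p) \_ (`]0, 1]%classic : set mR)).
pose g2 := ((@powR R ^~ q) \_ (`[1, +oo[%classic : set mR)).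
have mI1 : measurable (`]0, 1]%classic : set mR) by exact: measurable_itv.
have mI2 : measurable (`[1, +oo[%classic : set mR) by exact: measurable_itv.
have mg1 : measurable_fun [set: R] g1.
  by apply/(measurable_restrictT _ mI1); apply: measurable_funTS; exact: measurable_powR.
have mg2 : measurable_fun [set: R] g2.
  by apply/(measurable_restrictT _ mI2); apply: measurable_funTS; exact: measurable_powR.
have g10 t : 0 <= g1 t by rewrite /g1 patchE; case: ifP => // _; exact: powR_ge0.
have g20 t : 0 <= g2 t by rewrite /g2 patchE; case: ifP => // _; exact: powR_ge0.
have fg t : 0 < t -> (f t <= (C * (g1 t + g2 t))%R%:E)%E.
  move=> t0; have [t1|t1] := leP t 1.
    apply: le_trans (fp t t0 t1) _; rewrite lee_fin ler_wpM2l//.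
    rewrite {1}/g1 patchE mem_set ?lerDl//; by rewrite /= in_itv/= t0 t1.
  apply: le_trans (fq t (ltW t1)) _; rewrite lee_fin ler_wpM2l//.
  rewrite {1}/g2 patchE mem_set ?lerDr//; by rewrite /= in_itv/= (ltW t1).
apply: (@le_trans _ _ (\int[mu]_(t in `]0%R, +oo[) (C * (g1 t + g2 t))%R%:E)%E).
  by apply: ge0_le_integral_nm => t /=; rewrite in_itv/= andbT => t0; [exact: f0|exact: fg].
apply: (@le_trans _ _ (\int[mu]_t (C * (g1 t + g2 t))%R%:E)%E).
  apply: ge0_subset_integral => //.
  - by apply/measurable_EFinP; apply: measurable_funM => //; exact: measurable_funD.
  - by move=> t _; rewrite lee_fin mulr_ge0// addr_ge0.
under eq_integral do rewrite EFinM EFinD.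
rewrite ge0_integralZl//=; last 2 first.
- by apply/measurable_EFinP; exact: measurable_funD.
- by move=> t _; rewrite lee_fin addr_ge0.
have e1 : (\int[mu]_t (g1 t)%:E = \int[mu]_(t in `]0%R, 1%R]) (t `^ p)%:E)%E.
  rewrite [RHS]integral_mkcond; apply: eq_integral => t _.
  by rewrite /g1 !patchE; case: ifP.
have e2 : (\int[mu]_t (g2 t)%:E = \int[mu]_(t in `[1%R, +oo[) (t `^ q)%:E)%E.
  rewrite [RHS]integral_mkcond; apply: eq_integral => t _.
  by rewrite /g2 !patchE; case: ifP.
rewrite EFinM lee_wpmul2l// ge0_integralD//; try exact/measurable_EFinP.
rewrite EFinB -EFinN e1 e2 leeD//; last exact: integral_powR_infty.
- by have := integral_powR_near0 p1 ltr01; rewrite powR1 mul1r.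
- by move=> t _; rewrite lee_fin.
- by move=> t _; rewrite lee_fin.
Qed.

(** The real-valued integral would be 0 if it diverged, so the proof has to show
    convergence as well as positivity. *)
Lemma Gamma_neq0 (x : R) : 0 < x <= 1 -> Gamma x != 0.
Proof.
move=> /andP[x0 x1]; pose h t : R := t `^ (x - 1) * expR (- t).
have mh : measurable_fun [set: R] h.
  apply: measurable_funM; first exact: measurable_powR.
  by apply: measurableT_comp => //; exact: oppr_measurable.
have h0 t : 0 <= h t by rewrite mulr_ge0 ?powR_ge0 ?expR_ge0.
have hI : mu.-integrable `]0, +oo[ (EFin \o h).
  apply/integrableP; split.
    by apply/measurable_EFinP; exact: measurable_funTS.
  apply: le_lt_trans (ltry (2 * ((x - 1 + 1)^-1 - (-2 + 1)^-1))).
  apply: integral_half_line_le => //; [lra|lra|..].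
  - move=> t t0 t1; rewrite lee_fin ger0_norm// /h mulrC ler_wpM2r ?powR_ge0//.
    apply: (@le_trans _ _ 1); last by rewrite ler1n.
    by rewrite -expR0 ler_expR oppr_le0 ltW.
  - move=> t t1; have t0 : 0 < t by exact: lt_le_trans t1.
    rewrite lee_fin ger0_norm// /h.
    have : t `^ (x - 1) <= 1.
      by rewrite -[leRHS](powRr0 t); apply: ler_powR => //; lra.
    have : expR (- t) <= 2 * t `^ (-2).
      have := @expR_ge1Dxn R t 1 (ltW t0); rewrite (_ : 2`!%:R = 2)// => e1.
      have t2 : 0 < t ^+ 2 by rewrite exprn_gt0.
      have e0 := expR_gt0 t.
      rewrite expRN (powR_invn 2 (ltW t0)) ler_pdivlMr// mulrC ler_pdivrMr//.
      lra.
    have := powR_ge0 t (x - 1); have := expR_ge0 (- t).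
    by move=> ? ? ? ?; rewrite -[leRHS]mul1r ler_pM.
have m01 : measurable (`]0, 1[%classic : set mR) by exact: measurable_itv.
have sub01 : `]0, 1[%classic `<=` (`]0, +oo[%classic : set mR).
  by move=> t; rewrite /= !in_itv/= andbT => /andP[].
have h01 : mu.-integrable `]0, 1[ (EFin \o h).
  by apply: integrableS hI => //; exact: measurable_itv.
have : \int[mu]_(t in `]0, 1[) (expR (-1) : R) <= \int[mu]_(t in `]0, 1[) h t.
  apply: le_Rintegral => //.
  - apply/integrableP; split; first exact/measurable_EFinP.
    under eq_integral do rewrite /= ger0_norm ?expR_ge0//.
    by rewrite integral_cst//= lebesgue_measure_itv/= lte_fin ltr01 -EFinB -EFinM ltry.
  move=> t /=; rewrite in_itv/= => /andP[t0 t1].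
  rewrite -[leLHS]mul1r ler_pM ?expR_ge0//; last by rewrite ler_expR lerN2 ltW.
  by rewrite -[leLHS](powRr0 t); apply: ger_powR; [rewrite t0 ltW|lra].
rewrite Rintegral_cst// /= lebesgue_measure_itv/= lte_fin ltr01 /= subr0 mulr1 => e1.
have e0 : 0 < expR (-1) :> R by exact: expR_gt0.
rewrite gt_eqF//; apply: lt_le_trans (lt_le_trans e0 e1) _.
rewrite -lee_fin (EFin_Rintegral m01 h01) EFin_Rintegral//.
by apply: ge0_subset_integral => //; [exact/measurable_EFinP/measurable_funTS|move=> t _; rewrite lee_fin].
Qed.

End Gamma_function.

(** * Eigenfunctions as test functions *)

Section spatial_modes.
Context (R : realType) (n : nat).
Variables (Omega : set 'rV[R]_n).
Hypothesis oOmega : open Omega.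

Local Notation Rn := 'rV[R]_n.
Local Notation leb := (lebesgue_rV n).
Local Notation L2O := (L2 leb Omega).
Local Notation ipO := (L2dot leb Omega).
Local Notation sqO := (L2sqnorm leb Omega).
Let mO : measurable Omega := mOmega oOmega.
Implicit Types (w v f : Rn -> R) (G : Rn -> Rn).

Lemma Cn_scale (V : normedModType R) k (a : R) (f : V -> R) :
  Cn k f -> Cn k (fun x => a * f x).
Proof.
elim: k f => [|k IH] f.
  by move=> [cf _]; split => // x; apply: cvgM; [exact: cvg_cst|exact: cf].
move=> [cf df]; split => [x|v]; first by apply: cvgM; [exact: cvg_cst|exact: cf].
have [dfv cdf] := df v; split => [x|]; first exact: derivableZ.
rewrite (_ : (fun x => _) = fun x => a * 'D_v f x); first exact: IH.
by apply/funext => x; rewrite (deriveZ a (dfv x)).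
Qed.

Lemma test_function_scale (V : normedModType R) (U : set V) (a : R) (f : V -> R) :
  test_function U f -> test_function U (fun x => a * f x).
Proof.
move=> [cf kf fU].
have sub : closure [set x | a * f x != 0] `<=` closure [set x | f x != 0].
  by apply: closureS => x /=; apply: contraNN => /eqP ->; rewrite mulr0.
split; first by move=> k; exact: Cn_scale.
- by apply: subclosed_compact sub => //; exact: closed_closure.
- exact: subset_trans sub fU.
Qed.

Lemma H10_scale a w G : H10 Omega w G -> H10 Omega (fun x => a * w x) (fun x => a *: G x).
Proof.
move=> [Lw LG [psi [tpsi psiw dpsi]]]; split.
- exact: (L2_scale mO).
- by move=> i; under eq_fun do rewrite mxE; apply: (L2_scale mO).
have lim0 (h : nat -> Rn -> R) (k : nat -> Rn -> R) :
    (forall j, h j = fun x => a * k j x) -> sqO (k j) @[j --> \oo] --> 0%E ->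
    sqO (h j) @[j --> \oo] --> 0%E.
  move=> hk k0; have ak0 : ((a ^+ 2)%:E * sqO (k j))%E @[j --> \oo] --> 0%E.
    by rewrite -(mule0 (a ^+ 2)%:E); apply: cvgeZl.
  apply: squeeze_cvge (cvg_cst 0%E) ak0; near=> j.
  rewrite hk L2sqnorm_scale_le andbT.
  by apply: integral_ge0 => x _; rewrite lee_fin sqr_ge0.
exists (fun j x => a * psi j x); split.
- by move=> j; exact: test_function_scale.
- by apply: lim0 psiw => j; apply/funext => x; rewrite mulrBr.
- move=> i; apply: lim0 (dpsi i) => j; apply/funext => x.
  have [/(_ 1%N)[_ /(_ (delta_mx ord0 i))[dj _]] _ _] := tpsi j.
  by rewrite mxE (deriveZ a (dj x)) mulrBr.
Unshelve. all: by end_near. Qed.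

Lemma H1sqnorm_scale_le a w G :
  (H1sqnorm Omega (fun x => a * w x)%R (fun x => a *: G x)%R <=
   (a ^+ 2)%:E * H1sqnorm Omega w G)%E.
Proof.
have s0 h : (0 <= sqO h)%E by apply: integral_ge0 => x _; rewrite lee_fin sqr_ge0.
rewrite /H1sqnorm ge0_muleDr//; last by apply: sume_ge0.
rewrite leeD//; first exact: L2sqnorm_scale_le.
rewrite ge0_sume_distrr//; apply: lee_sum => i _.
under [X in (sqO X <= _)%E]eq_fun do rewrite mxE.
exact: L2sqnorm_scale_le.
Qed.

(** For [w] in H^1_0 the K-functional is bounded by t^2 times the H^1 norm (take
    [w] as competitor) and by the L^2 norm (take 0). As 0 < s < 1, the first bound
    is integrable near 0 and the second one at infinity. *)
Lemma Hs_unit_multiple s w G : 0 < s < 1 -> H10 Omega w G ->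
  exists a : R, [/\ 0 < a, Hs Omega s (fun x => a * w x) &
    (Hs_sqnorm Omega s (fun x => a * w x)%R <= 1)%E].
Proof.
move=> /andP[s0 s1] wG.
have [Lw LG _] := wG.
have sq0 h : (0 <= sqO h)%E by apply: integral_ge0 => x _; rewrite lee_fin sqr_ge0.
have H0 v K : (0 <= H1sqnorm Omega v K)%E.
  by rewrite /H1sqnorm adde_ge0// sume_ge0.
have [m m0 mE] : exists2 m : R, 0 <= m & H1sqnorm Omega w G = m%:E.
  rewrite /H1sqnorm ((@L2sqnormE _ _ _ leb Omega mO) _ Lw); under eq_bigr do rewrite (L2sqnormE mO (LG _)).
  rewrite sumEFin -EFinD; eexists; last by [].
  by rewrite addr_ge0 ?L2dot_ge0// sumr_ge0// => i _; exact: L2dot_ge0.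
have swm : (sqO w <= m%:E)%E.
  by rewrite -mE /H1sqnorm leeDl// sume_ge0.
have Ksq0 t v : (0 <= Ksq Omega t v)%E.
  apply: le_ereal_inf_tmp => _ [v' [K [_ ->]]]; rewrite adde_ge0// mule_ge0//.
  by rewrite lee_fin sqr_ge0.
pose C := (1 - 2 * s + 1)^-1 - (- 1 - 2 * s + 1)^-1.
have C0 : 0 <= C.
  by rewrite /C subr_ge0; apply: (@le_trans _ _ 0); [rewrite invr_le0|rewrite invr_ge0]; lra.
have bound a : (Hs_sqnorm Omega s (fun x => a * w x)%R <= (a ^+ 2 * m * C)%:E)%E.
  rewrite /Hs_sqnorm /C; apply: integral_half_line_le.
  - by rewrite mulr_ge0// sqr_ge0.
  - by lra.
  - by lra.
  - by move=> t t0; rewrite mule_ge0// lee_fin powR_ge0.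
  - move=> t t0 t1.
    have -> : (a ^+ 2 * m * t `^ (1 - 2 * s) = t `^ (- 1 - 2 * s) * (t ^+ 2 * (a ^+ 2 * m)))%R.
      have tE : t `^ (1 - 2 * s) = t `^ (- 1 - 2 * s) * t ^+ 2.
        rewrite -[t ^+ 2](powR_mulrn _ (ltW t0)) -powRD; last by rewrite (gt_eqF t0) implybT.
        by congr (_ `^ _); ring.
      by rewrite tE; ring.
    rewrite EFinM lee_wpmul2l ?lee_fin ?powR_ge0//.
    have cE : exists v K, H10 Omega v K /\
        (sqO (fun x => (a * w x) - (a * w x))%R +
         (t ^+ 2)%:E * H1sqnorm Omega (fun x => a * w x)%R (fun x => a *: G x)%R)%E =
        (sqO (fun x => a * w x - v x)%R + (t ^+ 2)%:E * H1sqnorm Omega v K)%E.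
      by exists (fun x => a * w x), (fun x => a *: G x); split => //; exact: H10_scale.
    apply: le_trans (ereal_inf_lbound cE) _.
    have -> : sqO (fun x => a * w x - a * w x) = 0%E.
      by rewrite /L2sqnorm; under eq_integral do rewrite subrr expr0n; rewrite integral0.
    rewrite add0e [leRHS]EFinM lee_wpmul2l ?lee_fin ?sqr_ge0//.
    by apply: le_trans (H1sqnorm_scale_le _ _ _) _; rewrite mE [leRHS]EFinM.
  - move=> t t1; rewrite [X in (_ <= X%:E)%E]mulrC [leRHS]EFinM lee_wpmul2l ?lee_fin ?powR_ge0//.
    have cE : exists v K, H10 Omega v K /\
        (sqO (fun x => (a * w x) - (0 * w x))%R +
         (t ^+ 2)%:E * H1sqnorm Omega (fun x => 0 * w x)%R (fun x => 0 *: G x)%R)%E =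
        (sqO (fun x => a * w x - v x)%R + (t ^+ 2)%:E * H1sqnorm Omega v K)%E.
      by exists (fun x => 0 * w x), (fun x => 0 *: G x); split => //; exact: H10_scale.
    apply: le_trans (ereal_inf_lbound cE) _.
    have -> : H1sqnorm Omega (fun x => 0 * w x) (fun x => 0 *: G x) = 0%E.
      by apply/eqP; rewrite eq_le H0 andbT; apply: le_trans (H1sqnorm_scale_le _ _ _) _;
        rewrite expr0n mul0e.
    rewrite mule0 adde0; under [X in (sqO X <= _)%E]eq_fun do rewrite mul0r subr0.
    have := L2sqnorm_scale_le leb Omega a w; move/le_trans; apply.
    by rewrite [leRHS]EFinM lee_wpmul2l ?lee_fin ?sqr_ge0.
pose a := (m * C + 1)^-1.
have mC : 0 <= m * C by exact: mulr_ge0.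
have a0 : 0 < a by rewrite invr_gt0; lra.
have aw1 : (Hs_sqnorm Omega s (fun x => a * w x)%R <= 1)%E.
  apply: le_trans (bound a) _; rewrite lee_fin -mulrA.
  have a1 : a <= 1 by rewrite invf_le1; lra.
  have : a * (m * C) <= 1 by rewrite /a mulrC ler_pdivrMr; lra.
  by rewrite expr2 -mulrA => h; nra.
exists a; split => //; split; first exact: (L2_scale mO).
by apply: le_lt_trans aw1 _; rewrite ltry.
Qed.

Variables (phi : nat -> Rn -> R) (lam : nat -> R) (s : R).
Hypothesis hphi : orthonormal_basis Omega phi.

(** Orthonormality leaves one term of the series. *)
Lemma fracL_mode k a w : L2O w ->
  fracL Omega lam phi s w (fun x => a * phi k x) =
  lam k `^ s * ipO w (fun x => a * phi k x).
Proof.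
move=> Lw; have [Lphi on _] := hphi.
have E j : ipO (fun x => a * phi k x) (phi j) = a * (k == j)%:R.
  by rewrite (L2dotZl mO)// on.
rewrite (L2dotC _ _ w) (L2dotZl mO)// (L2dotC _ _ (phi k)).
rewrite /fracL; apply: cvg_lim => //.
apply: cvg_near_cst; near=> N.
rewrite /series/= (bigD1_seq k)/= ?mem_index_iota ?iota_uniq//; last first.
  by near: N; exists k.+1.
rewrite E eqxx mulr1 big1 ?addr0; first by ring.
by move=> j jk; rewrite E eq_sym (negbTE jk) !mulr0.
Unshelve. all: by end_near. Qed.

End spatial_modes.

(** * Trajectories tested with one function *)

Section mode_equation.
Context (R : realType) (n : nat).
Variables (Omega : set 'rV[R]_n) (T : R).
Hypotheses (oOmega : open Omega) (T0 : 0 < T).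

Local Notation Rn := 'rV[R]_n.
Local Notation leb := (lebesgue_rV n).
Local Notation leb1 := (@lebesgue_measure R).
Local Notation mR := (measurableTypeR R).
Local Notation L2O := (L2 leb Omega).
Local Notation ipO := (L2dot leb Omega).
Local Notation sqO := (L2sqnorm leb Omega).
Local Notation I0T := (`]0, T[%classic : set mR).
Local Notation cyl := (cylinder Omega T).
Local Notation L2Q := (L2Q Omega T).
Local Notation int f := (leb1.-integrable [set: R] (EFin \o f)).

Implicit Types (u w : R -> Rn -> R) (f g v : Rn -> R).

Let mO : measurable Omega := mOmega oOmega.
Let mI : measurable I0T := @mI0T R T.

(** On the unit ball of H^s the values of a functional are bounded by its norm in
    H^-s. *)
Lemma Hms_time s F v : L2Hms Omega s T F -> Hs Omega s v -> (Hs_sqnorm Omega s v <= 1)%E ->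
  L2 leb1 I0T (fun t => F t v).
Proof.
move=> [mF _ iF] Hv v1; apply: L2_lty => //; first exact: mF.
apply: le_lt_trans iF; apply: ge0_le_integral_nm => t _.
  by rewrite lee_fin sqr_ge0.
by apply: ereal_sup_ubound; exists v.
Qed.

Lemma L2time_restrict h : L2 leb1 I0T h -> L2time T (h \_ I0T).
Proof.
move=> Lh; apply: L2time_of.
  by rewrite /L2 /= patch_setT.
by move=> t tT; rewrite patchE ifF//; apply/negbTE; rewrite notin_setE/= in_itv/=; exact/negP.
Qed.

Lemma L2sqnorm_sub_le f g : L2O f -> L2O g ->
  (sqO (fun x => f x - g x)%R <= (2 * ipO f f + 2 * ipO g g)%:E)%E.
Proof.
move=> Lf Lg.
have Ld := L2_sub mO Lf Lg; have Ls := L2_add mO Lf Lg.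
rewrite (L2sqnormE mO Ld) lee_fin.
have := L2dot_ge0 leb Omega (fun x => f x + g x).
rewrite (L2dotDl mO Lf Lg Ls) (L2dotBl mO Lf Lg Ld).
rewrite !(L2dotC _ _ _ (fun x => f x + g x)) !(L2dotC _ _ _ (fun x => f x - g x)).
rewrite !(L2dotDl mO Lf Lg)// !(L2dotBl mO Lf Lg)// (L2dotC _ _ g f); lra.
Qed.

Lemma CL2_mode_continuous u v : CL2 Omega T u -> L2O v ->
  {within `[0, T], continuous (fun t => ipO (u t) v)}.
Proof.
move=> Cu Lv; apply/subspace_continuousP => t /= tT.
have [Lut ut] := Cu t tT.
(* Square integrability of u r is only known for r in [0, T]. *)
pose h r := if r \in `[0, T] then (fun x => u r x - u t x) else fun=> 0.
have Lh r : L2O (h r).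
  rewrite /h; case: ifPn => [rT|_]; last exact: (L2_cst0 _ mO).
  by apply: (L2_sub mO) => //; exact: (Cu r rT).1.
have h0 : ipO (h r) v @[r --> within `[0, T] (nbhs t)] --> 0.
  apply: (L2dot_cvg0 mO _ Lh Lv); apply: cvg_trans ut.
  apply: near_eq_cvg; near=> r.
  by rewrite /h ifT//; near: r; exact: withinT.
apply/(@cvg_sub0 _ _ _ _ _ _ (fun=> ipO (u t) v)) => //; last exact: cvg_cst.
apply: cvg_trans h0; apply: near_eq_cvg; near=> r.
have rT : r \in `[0, T] by near: r; exact: withinT.
by rewrite /h rT fctE (L2dotBl mO)//; exact: (Cu r rT).1.
Unshelve. all: by end_near. Qed.

Definition mode_increment u v t := if 0 < t < T then ipO (u t) v - ipO (u 0) v else 0.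

Lemma mode_increment_admissible u v : CL2 Omega T u -> LinftyL2 Omega T u -> L2O v ->
  admissible T (mode_increment u v).
Proof.
move=> Cu Lu Lv; have cy := CL2_mode_continuous Cu Lv.
pose y t := ipO (u t) v; rewrite -/y in cy.
split.
- have my : measurable_fun I0T y.
    exact: (L2_measurable mI (ipO_L2 oOmega T0 (LinftyL2_L2Q oOmega T0 Lu) Lv)).
  have -> : mode_increment u v = (fun t => y t - y 0) \_ I0T.
    apply/funext => t; rewrite patchE /mode_increment.
    by congr (if _ then _ else _); apply/idP/idP; rewrite inE/= in_itv.
  apply/(measurable_restrictT _ mI).
  by apply: measurable_funB => //; exact: measurable_cst.
- have [a _ ya] := EVT_max (ltW T0) cy; have [b _ yb] := EVT_min (ltW T0) cy.
  exists (`|y a| + `|y b| + `|y 0|) => t; rewrite /mode_increment.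
  case: ifP => [/andP[t0 tT]|_]; last by rewrite normr0 !addr_ge0.
  have tI : t \in `[0, T] by rewrite in_itv/= !ltW.
  have := ya t tI; have := yb t tI; rewrite -/(y t) -/(y 0) => h1 h2.
  have := ler_norm (y a); have := ler_norm (- y b); rewrite normrN => h3 h4.
  have := ler_norm (y 0); have := ler_norm (- y 0); rewrite normrN => h5 h6.
  have := normr_ge0 (y a); have := normr_ge0 (y b) => h7 h8.
  by rewrite ler_norml; apply/andP; split; lra.
- have [cin c0 _] := (continuous_within_itvP y T0).1 cy.
  move=> t tT; have [t0|t0|t0] := ltgtP t 0.
  + rewrite /prop_for /continuous_at /mode_increment ltNge (ltW t0)/=.
    apply: cvg_near_cst; near=> r.
    have : r < 0 by near: r; exact: lt_nbhsl.
    by move=> /ltW; rewrite leNgt => /negbTE ->.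
  + rewrite /prop_for /continuous_at.
    have tI : 0 < t < T by rewrite t0.
    have cyt : y r @[r --> t] --> y t by have := cin t; rewrite in_itv/= => /(_ tI).
    rewrite {2}/mode_increment tI.
    apply: (cvg_trans _ (cvgB cyt (cvg_cst (y 0)))); apply: near_eq_cvg; near=> r.
    rewrite /mode_increment ifT//; apply/andP; split.
      by near: r; exact: lt_nbhsr.
    by near: r; exact: lt_nbhsl.
  + rewrite t0 /prop_for /continuous_at {2}/mode_increment ltxx/=.
    apply/cvgrPdist_lt => e e0; move/cvgrPdist_lt : c0 => /(_ e e0) c0.
    rewrite /at_right near_withinE in c0; near=> r.
    rewrite /mode_increment; case: ifP => [/andP[r0 _]|_]; last by rewrite subrr normr0.
    rewrite sub0r normrN distrC.
    by move: r0; near: r.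
- by move=> t t0; rewrite /mode_increment ltNge t0.
- by move=> t t0; rewrite /mode_increment [t < T]ltNge t0 andbF.
Unshelve. all: by end_near. Qed.

(** [kappa] inverts the Caputo derivative mode by mode. The property is isolated
    because several trajectories must be represented by one and the same kernel. *)
Definition represents_modes gamma kappa := forall u v Fv,
  CL2 Omega T u -> LinftyL2 Omega T u -> L2O v -> L2 leb1 I0T Fv ->
  (forall eta : R -> R, test_function (I0T : set R^o) eta ->
    \int[leb1]_(t in I0T) (derive1 eta t *
      ipO ((if gamma == 1 then u else
            RL_left (1 - gamma) (fun t x => u t x - u 0 x)) t) v) =
    - \int[leb1]_(t in I0T) (eta t * Fv t)) ->
  {ae leb1, forall t, 0 < t < T ->
    ipO (u t) v - ipO (u 0) v = convol kappa (Fv \_ I0T) t}.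

(** The fractional integral in time commutes with the spatial inner product, so
    that the mode of the Riemann-Liouville integral is the Caputo primitive of the
    mode. *)
Lemma mode_convolution gamma : 0 < gamma <= 1 ->
  exists kappa, [/\ int kappa, causal kappa & represents_modes gamma kappa].
Proof.
move=> g01.
pose c := if gamma == 1 then 1 else (Gamma (1 - gamma))^-1.
have c0 : c != 0.
  rewrite /c; case: ifPn => [_|g1]; first by rewrite oner_eq0.
  by rewrite invr_neq0// Gamma_neq0//; move: g01 g1 => /andP[? ?]; rewrite neq_lt; lra.
have [kappa [ik ck kE]] := caputo_inversion g01 c0 T0.
exists kappa; split=> // u v Fv Cu Lu Lv LF weak.
pose d := if gamma == 1 then ipO (u 0) v else 0.
have LFr := L2time_restrict LF.
have := kE (mode_increment u v) (Fv \_ I0T) _ d (mode_increment_admissible Cu Lu Lv)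
  (L2time_integrable T0 LFr) (L2time_causal LFr).
move=> /(_ (fun t => ipO ((if gamma == 1 then u else
              RL_left (1 - gamma) (fun t x => u t x - u 0 x)) t) v)) H.
apply: ae_imp (H _ _) => [t h tT| |].
- by have := h tT; rewrite /mode_increment tT.
- move=> t tT; rewrite /caputo_primitive /d /c; case: ifPn => [_|g1].
    by rewrite /mode_increment tT subrK.
  rewrite addr0.
  have L0 : L2O (u 0) by apply: (Cu 0 _).1; rewrite in_itv/= lexx ltW.
  have [mu_ [M aeM]] := Lu.
  have mD : measurable (`]0, t[%classic : set mR) by exact: measurable_itv.
  have DI : (`]0, t[%classic : set mR) `<=` I0T.
    move=> r /=; rewrite !in_itv/= => /andP[-> rt] /=; apply: lt_trans rt _.
    by case/andP: tT.
  pose om r := (t - r) `^ (1 - gamma - 1).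
  have omE r : 0 < r < t -> trunc_pow (- gamma) T (t - r) = om r.
    move=> /andP[r0 rt]; rewrite /trunc_pow /om ifT; last by move/andP : tT; lra.
    by congr (_ `^ _); ring.
  have iom : leb1.-integrable (`]0, t[%classic : set mR) (EFin \o om).
    have ip : int (fun r => trunc_pow (- gamma) T (t - r)).
      apply: integrable_reflection; apply: trunc_pow_integrable => //.
      by move: g01 g1 => /andP[? ?]; rewrite neq_lt; lra.
    have ipD := integrableS measurableT mD (@subsetT _ _) ip.
    apply: (eq_integrable mD _ _ _ ipD) => r; rewrite inE/= in_itv/= => rt.
    by rewrite /= omE.
  have mg : measurable_fun cyl (uncurryQ (fun t x => u t x - u 0 x)).
    apply: measurable_funB => //.
    exact: (measurable_space_slab oOmega mI (L2_measurable mO L0)).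
  have gM : {ae leb1, forall r, I0T r ->
      (sqO (fun x => u r x - u 0 x)%R <= (2 * M + 2 * ipO (u 0) (u 0))%:E)%E}.
    apply: ae_imp aeM => r h Ir.
    have Lr : L2O (u r).
      by apply: (Cu r _).1; move: Ir; rewrite /= !in_itv/= => /andP[/ltW -> /ltW ->].
    apply: le_trans (L2sqnorm_sub_le Lr L0) _; rewrite lee_fin.
    by have := h Ir; rewrite (L2sqnormE mO Lr) lee_fin; lra.
  rewrite /RL_left (ipO_time_integral oOmega _ mD DI iom mg gM Lv).
  congr (_ * _); rewrite /convol.
  rewrite [RHS](_ : _ = \int[leb1]_(r in (`]0, t[%classic : set mR))
    (trunc_pow (- gamma) T (t - r) * mode_increment u v r)).
    apply: eq_Rintegral => r; rewrite inE/= in_itv/= => rt.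
    have rI : 0 < r < T by move/andP: rt; move/andP: tT; lra.
    rewrite (omE _ rt) /mode_increment rI (L2dotBl mO)//.
    by apply: (Cu r _).1; move/andP : rI => [/ltW r0 /ltW rT]; rewrite in_itv/= r0.
  rewrite [RHS]Rintegral_mkcond; apply: eq_Rintegral => r _.
  rewrite patchE; case: ifPn => //; rewrite notin_setE/= in_itv/= => /negP.
  rewrite negb_and -!leNgt => /orP[r0|rt].
    by rewrite /mode_increment ltNge r0 mulr0.
  by rewrite causal_trunc_pow ?mul0r// subr_le0.
- move=> eta te; rewrite weak//; congr (- _); apply: eq_Rintegral => t tI.
  by rewrite patchE tI.
Qed.

End mode_equation.

(** * Modes of the state and of the adjoint state *)

Section state_and_adjoint.
Context (R : realType) (n : nat).
Variables (Omega : set 'rV[R]_n) (T : R).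
Hypotheses (oOmega : open Omega) (T0 : 0 < T).

Local Notation Rn := 'rV[R]_n.
Local Notation leb := (lebesgue_rV n).
Local Notation leb1 := (@lebesgue_measure R).
Local Notation mR := (measurableTypeR R).
Local Notation L2O := (L2 leb Omega).
Local Notation ipO := (L2dot leb Omega).
Local Notation sqO := (L2sqnorm leb Omega).
Local Notation I0T := (`]0, T[%classic : set mR).
Local Notation cyl := (cylinder Omega T).
Local Notation L2Q := (L2Q Omega T).

Implicit Types (u w p : R -> Rn -> R) (f g v : Rn -> R).

Let mO : measurable Omega := mOmega oOmega.
Let mI : measurable I0T := @mI0T R T.

Lemma L2time_L2 (f : R -> R) : L2time T f -> L2 leb1 I0T f.
Proof.
move=> Lf; have := L2timeP Lf; rewrite /L2 /= patch_setT.
suff -> : f \_ I0T = f by [].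
case: Lf => _ _ f0; apply/funext => t; rewrite patchE; case: ifPn => //.
by rewrite notin_setE/= in_itv/= => /negP /f0.
Qed.

Lemma restrict_L2time (f : R -> R) : L2time T f -> f \_ I0T = f.
Proof.
case=> _ _ f0; apply/funext => t; rewrite patchE; case: ifPn => //.
by rewrite notin_setE/= in_itv/= => /negP /f0.
Qed.

Lemma L2time_reflection (f : R -> R) : L2time T f -> L2time T (fun t => f (T - t)).
Proof.
move=> [mf f2 f0]; split.
- by apply: measurableT_comp => //; exact: measurable_funB.
- exact: (integrable_reflection T f2).
- by move=> t tT; apply: f0; rewrite subr_gt0 ltrBlDr ltrDl andbC.
Qed.

Lemma ae_ipO f g v : measurable_fun Omega f -> L2O g -> L2O v ->
  {ae leb, forall x, Omega x -> f x = g x} -> ipO f v = ipO g v.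
Proof.
move=> mf Lg Lv fg; apply: ae_eq_Rintegral => //.
- by apply: measurable_funM => //; exact: (L2_measurable mO Lv).
- by apply: measurable_funM; [exact: (L2_measurable mO Lg)|exact: (L2_measurable mO Lv)].
- by apply: ae_imp fg => x h Ox; rewrite h.
Qed.

Variables (phi : nat -> Rn -> R) (lam : nat -> R) (s gamma : R).
Hypothesis hphi : orthonormal_basis Omega phi.
Variables (k : nat) (a : R).
Local Notation v := (fun x => a * phi k x).
Hypotheses (Hv : Hs Omega s v) (v1 : (Hs_sqnorm Omega s (fun x => a * phi k x)%R <= 1)%E).
Variable kappa : R -> R.
Hypothesis kE : represents_modes Omega T gamma kappa.

Let Lv : L2O v. Proof. by case: Hv. Qed.

(** The equation tested with the mode, together with the representation of the
    increment of the mode by the Caputo derivative. *)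
Lemma state_mode (f z : R -> (Rn -> R) -> R) (u0 : Rn -> R) u : L2O u0 ->
  state_solution Omega lam phi s T gamma f z u0 u ->
  exists F, [/\ L2time T F,
    {ae leb1, forall t, 0 < t < T -> F t = f t v + z t v - lam k `^ s * ipO (u t) v} &
    {ae leb1, forall t, 0 < t < T -> ipO (u t) v - ipO u0 v = convol kappa F t}].
Proof.
move=> Lu0 [[Lu _ _] Cu u00 [F [Lu0' [LF weak]] eqF]].
have LFv := Hms_time LF Hv v1.
have inI t : 0 < t < T -> I0T t by rewrite /= in_itv.
exists ((fun t => F t v) \_ I0T); split; first exact: L2time_restrict.
- apply: ae_imp eqF => t h tT.
  rewrite patchE mem_set; last exact: inI.
  have := h (inI _ tT) v Hv; rewrite (fracL_mode oOmega)//; first by move=> <-; ring.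
  by apply: (Cu t _).1; move/andP: tT => [t0 t1]; rewrite in_itv/= !ltW.
- rewrite -(ae_ipO (L2_measurable mO Lu0') Lu0 Lv u00).
  apply: kE => // eta teta; have := weak eta v teta Hv.
  by [].
Qed.

(** The reversed trajectory p (T - t) has a left Caputo derivative, namely the
    reversed right derivative of [p], and starts from 0. *)
Lemma adjoint_mode (ubar ud p : R -> Rn -> R) :
  adjoint_solution Omega lam phi s T gamma ubar ud p ->
  exists E, [/\ L2time T E,
    {ae leb1, forall t, 0 < t < T ->
       E t = ipO (fun x => ubar t x - ud t x) v - lam k `^ s * ipO (p t) v} &
    {ae leb1, forall t, 0 < t < T ->
       ipO (p (T - t)) v = convol kappa (fun r => E (T - r)) t}].
Proof.
move=> [[Lp _ _] Cp pT0 [F [LpT [LF weak]] eqF]].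
have LFv := L2time_restrict (Hms_time LF Hv v1).
have inI t : 0 < t < T -> I0T t by rewrite /= in_itv.
set E := (fun t => F t v) \_ I0T in LFv *.
have EF t : 0 < t < T -> E t = F t v.
  by move=> tT; rewrite /E patchE mem_set//; exact: inI.
exists E; split => //.
  apply: ae_imp eqF => t h tT; rewrite EF//.
  have := h (inI _ tT) v Hv; rewrite (fracL_mode oOmega)//; first by move=> <-; ring.
  by apply: (Cp t _).1; move/andP: tT => [t0 t1]; rewrite in_itv/= !ltW.
pose q t := p (T - t).
have refl t : (0 <= T - t <= T) = (0 <= t <= T).
  by rewrite subr_ge0 lerBlDr lerDl andbC.
have Cq : CL2 Omega T q.
  move=> t; rewrite in_itv/= -refl => tT; have [Lpt pt] := Cp (T - t) tT.
  split => //; rewrite /q.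
  apply: (@cvg_comp _ _ _ (fun r => T - r) (fun r => sqO (fun x => p r x - p (T - t) x)%R)
    _ (within `[0, T] (nbhs (T - t)))); last exact: pt.
  move=> P; rewrite /= /within/= nbhs_simpl/= => nP.
  have cr : (T - r) @[r --> t] --> T - t by apply: cvgB; [exact: cvg_cst|exact: cvg_id].
  have := cr _ nP; rewrite nbhs_simpl/=; apply: filterS => r /= h.
  by rewrite in_itv/= -refl => rT; apply: h; rewrite in_itv.
have Lq : LinftyL2 Omega T q.
  case: Lp => mp [M pM]; split.
    rewrite (_ : uncurryQ q = uncurryQ p \o (fun y : Rn * mR => (y.1, T - y.2 : mR))); last first.
      by apply/funext.
    apply: (measurable_comp _ _ mp) => //; first exact: mcyl.
      by move=> _ [[x t] [/= Ox]] + <-; rewrite /= in_itv/= => tT;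
        split => //=; rewrite in_itv/= subr_gt0 ltrBlDr ltrDl andbC.
    apply: measurable_funTS; apply: measurable_fun_pair => //.
    by apply: measurable_funB => //.
  exists M; apply: ae_imp (ae_reflection T pM) => t h; rewrite /= in_itv/= => tT.
  by apply: h; rewrite /= in_itv/= subr_gt0 ltrBlDr ltrDl andbC.
have LE' := L2time_reflection LFv.
have q0 : ipO (q 0) v = 0.
  rewrite /q subr0 (ae_ipO (L2_measurable mO LpT) (L2_cst0 _ mO) Lv pT0).
  by rewrite /L2dot; under eq_Rintegral do rewrite mul0r; rewrite Rintegral_cst// mul0r.
have := kE Cq Lq Lv (L2time_L2 LE') _.
rewrite (restrict_L2time LE') => H; apply: ae_imp (H _) => [t h tT|eta teta].
  by have := h tT; rewrite q0 subr0.
have [te de] := test_function_reflection teta.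
have {}weak := weak _ v te Hv.
have reflI h : \int[leb1]_(t in I0T) h t = \int[leb1]_(t in I0T) h (T - t).
  by have := Rintegral_itv_reflection T 0 T h; rewrite subrr subr0.
rewrite [LHS]reflI [in RHS]reflI.
transitivity (- \int[leb1]_(t in I0T) (eta (T - t) * F t v)); last first.
  congr (- _); apply: eq_Rintegral => t; rewrite inE/= in_itv/= => tT.
  by rewrite subKr EF.
rewrite -weak -[RHS]opprK -Rintegral_opp -[RHS]Rintegral_opp.
apply: eq_Rintegral => t _; rewrite de mulNr opprK -mulrN; congr (_ * _).
rewrite -L2dot_oppl; congr (ipO _ v); case: ifP => _; apply/funext => x.
  by rewrite opprK /q subKr.
rewrite opprK /RL_left /RL_right; congr (_ * _).
rewrite [RHS](Rintegral_itv_reflection T) subrr.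
by apply: eq_Rintegral => r _; rewrite /q subr0; congr (_ `^ _ * _); ring.
Qed.

End state_and_adjoint.

(** * Second-order expansion of the cost *)

Section optimality.
Context (R : realType) (n : nat).
Variables (Omega : set 'rV[R]_n) (T : R).
Hypotheses (oOmega : open Omega) (T0 : 0 < T).

Local Notation Rn := 'rV[R]_n.
Local Notation leb := (lebesgue_rV n).
Local Notation leb1 := (@lebesgue_measure R).
Local Notation mR := (measurableTypeR R).
Local Notation L2O := (L2 leb Omega).
Local Notation ipO := (L2dot leb Omega).
Local Notation I0T := (`]0, T[%classic : set mR).
Local Notation cyl := (cylinder Omega T).
Local Notation L2Q := (L2Q Omega T).
Local Notation L2Qdot := (L2Qdot Omega T).
Local Notation int f := (leb1.-integrable [set: R] (EFin \o f)).

Implicit Types (u w p z : R -> Rn -> R) (f g v : Rn -> R).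

Let mO : measurable Omega := mOmega oOmega.
Let mI : measurable I0T := @mI0T R T.
Let mC := mcyl T oOmega.

Definition mode u v := (fun t => ipO (u t) v) \_ I0T.

Lemma modeE u v t : 0 < t < T -> mode u v t = ipO (u t) v.
Proof. by move=> tT; rewrite /mode patchE mem_set//= in_itv. Qed.

Lemma L2time_mode u v : L2Q u -> L2O v -> L2time T (mode u v).
Proof. by move=> Lu Lv; exact/L2time_restrict/ipO_L2. Qed.

Lemma mode_sub u w v : L2Q u -> L2Q w -> L2O v ->
  {ae leb1, forall t, 0 < t < T ->
    mode (fun t x => u t x - w t x) v t = mode u v t - mode w v t}.
Proof.
move=> Lu Lw Lv; apply: ae_imp2 (L2Q_slice oOmega Lu) (L2Q_slice oOmega Lw) => t hu hw tT.
by rewrite !modeE// (L2dotBl mO)//; [apply: hu|apply: hw]; rewrite /= in_itv.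
Qed.

Lemma mode_scale u v tau : L2Q u -> L2O v ->
  {ae leb1, forall t, 0 < t < T ->
    mode (fun t x => tau * u t x) v t = tau * mode u v t}.
Proof.
move=> Lu Lv; apply: ae_imp (L2Q_slice oOmega Lu) => t hu tT.
by rewrite !modeE// (L2dotZl mO)//; apply: hu; rewrite /= in_itv.
Qed.

Lemma Rintegral_modes u w v :
  \int[leb1]_(t in I0T) (ipO (u t) v * ipO (w t) v) = \int[leb1]_t (mode u v t * mode w v t).
Proof.
rewrite Rintegral_mkcond; apply: eq_Rintegral => t _; rewrite /mode !patchE.
by case: ifP => //; rewrite mulr0.
Qed.

(** The multiples of [phi k] that are used as test functions change both sides of
    the identities between modes by the same factor. *)
Lemma Rintegral_modes_scale u w f a : L2Q u -> L2Q w -> L2O f ->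
  \int[leb1]_t (mode u (fun x => a * f x) t * mode w (fun x => a * f x) t) =
  a ^+ 2 * \int[leb1]_(t in I0T) (ipO (u t) f * ipO (w t) f).
Proof.
move=> Lu Lw Lf; rewrite -Rintegral_modes -Rintegral_scale//; last first.
  by apply: measurable_funM; apply: (L2_measurable mI); exact: ipO_L2.
have Laf := L2_scale mO a Lf.
apply: ae_eq_Rintegral => //.
- by apply: measurable_funM; apply: (L2_measurable mI); exact: ipO_L2.
- apply: measurable_funM => //.
  by apply: measurable_funM; apply: (L2_measurable mI); exact: ipO_L2.
apply: ae_imp2 (L2Q_slice oOmega Lu) (L2Q_slice oOmega Lw) => t hu hw tI.
rewrite L2dotC (L2dotZl mO)//; last exact: hu.
rewrite [ipO (w t) _]L2dotC (L2dotZl mO)//; last exact: hw.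
by rewrite [ipO f _]L2dotC [ipO f (w t)]L2dotC; ring.
Qed.

Variables (phi : nat -> Rn -> R) (lam : nat -> R) (s gamma : R).
Hypothesis s01 : 0 < s < 1.
Hypothesis hphi : orthonormal_basis Omega phi.
Hypothesis phiH10 : forall k, exists G, H10 Omega (phi k) G.
Variables (f : R -> (Rn -> R) -> R) (u0 : Rn -> R).
Hypothesis Lu0 : L2O u0.

Local Notation state z u :=
  (state_solution Omega lam phi s T gamma f (L2Q_functional Omega z) u0 u).

Lemma state_L2Q z u : state z u -> L2Q u.
Proof. by move=> [[Lu _ _] _ _ _]; exact: LinftyL2_L2Q. Qed.

Let unit_mode k : exists a : R, [/\ 0 < a, Hs Omega s (fun x => a * phi k x) &
  (Hs_sqnorm Omega s (fun x => a * phi k x)%R <= 1)%E].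
Proof. by have [G] := phiH10 k; exact: Hs_unit_multiple. Qed.

Section differences.
Variable kappa : R -> R.
Hypotheses (ik : int kappa) (ck : causal kappa).
Hypothesis kE : represents_modes Omega T gamma kappa.

(** The data [f] and [u0] cancel in the difference of two states. *)
Lemma state_difference_mode z1 z2 u1 u2 k a :
  Hs Omega s (fun x => a * phi k x) -> (Hs_sqnorm Omega s (fun x => a * phi k x)%R <= 1)%E ->
  L2Q z1 -> L2Q z2 -> state z1 u1 -> state z2 u2 ->
  let v := fun x => a * phi k x in
  let w := fun t x => u1 t x - u2 t x in
  exists F, [/\ L2time T F,
    {ae leb1, forall t, 0 < t < T ->
      F t = mode (fun t x => z1 t x - z2 t x) v t - lam k `^ s * mode w v t} &
    {ae leb1, forall t, 0 < t < T -> mode w v t = convol kappa F t}].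
Proof.
move=> Hv v1 Lz1 Lz2 st1 st2 v w.
have Lv : L2O v by case: Hv.
have [F1 [LF1 E1 C1]] := state_mode oOmega hphi Hv v1 kE Lu0 st1.
have [F2 [LF2 E2 C2]] := state_mode oOmega hphi Hv v1 kE Lu0 st2.
have wE := mode_sub (state_L2Q st1) (state_L2Q st2) Lv.
exists (fun t => F1 t - F2 t); split; first exact: L2time_sub.
- have E12 := ae_imp2 (fun t h1 h2 => conj h1 h2) E1 E2.
  have D12 := ae_imp2 (fun t h1 h2 => conj h1 h2) wE (mode_sub Lz1 Lz2 Lv).
  apply: ae_imp2 _ E12 D12 => t [h1 h2] [hw hz] tT.
  rewrite h1// h2// hw// hz// !modeE// /L2Q_functional /v; ring.
- have cs := convol_sub ik (L2time_integrable T0 LF1) (L2time_integrable T0 LF2).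
  have C12 := ae_imp2 (fun t h1 h2 => conj h1 h2) C1 C2.
  have D12 := ae_imp2 (fun t h1 h2 => conj h1 h2) wE cs.
  apply: ae_imp2 _ C12 D12 => t [h1 h2] [hw hc] tT.
  rewrite hw// hc !modeE// -h1// -h2// /v; ring.
Qed.

(** Reciprocity for every mode, summed with Parseval's identity. *)
Lemma mode_pairing z zbar u ubar ud p : L2Q z -> L2Q zbar -> L2Q ud ->
  state z u -> state zbar ubar ->
  adjoint_solution Omega lam phi s T gamma ubar ud p ->
  L2Qdot (fun t x => u t x - ubar t x) (fun t x => ubar t x - ud t x) =
  L2Qdot (fun t x => z t x - zbar t x) p.
Proof.
move=> Lz Lzb Lud st stb adj.
have Lu := state_L2Q st; have Lub := state_L2Q stb.
have Lp : L2Q p by case: adj => [[Lp _ _] _ _ _]; exact: LinftyL2_L2Q.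
have Lw := L2Q_sub oOmega Lu Lub; have Ld := L2Q_sub oOmega Lub Lud.
have Lzeta := L2Q_sub oOmega Lz Lzb.
have c1 := L2Qdot_modes oOmega T0 hphi Lw Ld; have c2 := L2Qdot_modes oOmega T0 hphi Lzeta Lp.
rewrite -(cvg_lim (@Rhausdorff R) c1) -(cvg_lim (@Rhausdorff R) c2); congr (lim (_ @ \oo)).
apply/funext => N; apply: eq_bigr => k _.
have Lk : L2O (phi k) by case: hphi.
have [a [a0 Hv v1]] := unit_mode k; have Lv : L2O (fun x => a * phi k x) by case: Hv.
have a20 : a ^+ 2 != 0 by rewrite expf_neq0// gt_eqF.
apply: (mulfI a20).
rewrite -(Rintegral_modes_scale a Lw Ld Lk) -(Rintegral_modes_scale a Lzeta Lp Lk).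
have [F [LF FE wE]] := state_difference_mode Hv v1 Lz Lzb st stb.
have [E [LE EE pE]] := adjoint_mode oOmega hphi Hv v1 kE adj.
apply: (mode_reciprocity T0 ik (L2time_mode Lw Lv) (L2time_mode Lp Lv)
  (L2time_mode Lzeta Lv) (L2time_mode Ld Lv) LF LE FE _ wE).
- by apply: ae_imp EE => t h tT; rewrite h// !modeE.
- apply: ae_imp pE => t h tT; rewrite -h// modeE//.
  by move: tT => /andP[? ?]; apply/andP; split; lra.
Qed.

(** The states of controls on the line through [zbar] and [z]: the difference to
    [ubar] is homogeneous, mode by mode, by uniqueness for the Volterra equation. *)
Lemma state_difference_scaling z zbar zt u ubar ut tau :
  L2Q z -> L2Q zbar -> L2Q zt -> state z u -> state zbar ubar -> state zt ut ->
  (forall t x, zt t x = zbar t x + tau * (z t x - zbar t x)) ->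
  let w := fun t x => u t x - ubar t x in
  let wt := fun t x => ut t x - ubar t x in
  L2Qdot wt wt = tau ^+ 2 * L2Qdot w w.
Proof.
move=> Lz Lzb Lzt st stb stt ztE w wt.
have Lu := state_L2Q st; have Lub := state_L2Q stb; have Lut := state_L2Q stt.
have Lw : L2Q w := L2Q_sub oOmega Lu Lub; have Lwt : L2Q wt := L2Q_sub oOmega Lut Lub.
have Lzeta := L2Q_sub oOmega Lz Lzb.
have c1 := L2Qdot_modes oOmega T0 hphi Lwt Lwt; have c2 := L2Qdot_modes oOmega T0 hphi Lw Lw.
have {}c2 := @cvgMl_tmp _ _ _ eventually_filter _ (tau ^+ 2) _ c2.
rewrite -(cvg_lim (@Rhausdorff R) c1) -(cvg_lim (@Rhausdorff R) c2); congr (lim (_ @ \oo)).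
apply/funext => N; rewrite [RHS]mulr_sumr; apply: eq_bigr => k _.
have Lk : L2O (phi k) by case: hphi.
have [a [a0 Hv v1]] := unit_mode k; have Lv : L2O (fun x => a * phi k x) by case: Hv.
have a20 : a ^+ 2 != 0 by rewrite expf_neq0// gt_eqF.
apply: (mulfI a20); rewrite mulrCA.
rewrite -(Rintegral_modes_scale a Lwt Lwt Lk) -(Rintegral_modes_scale a Lw Lw Lk).
have [F1 [LF1 FE1 wE1]] := state_difference_mode Hv v1 Lz Lzb st stb.
have [F2 [LF2 FE2 wE2]] := state_difference_mode Hv v1 Lzt Lzb stt stb.
have zE : (fun t x => zt t x - zbar t x) = (fun t x => tau * (z t x - zbar t x)).
  by apply/funext => t; apply/funext => x; rewrite ztE addrAC subrr add0r.
rewrite zE in FE2.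
have sc := mode_scaling T0 ik ck (L2time_mode Lw Lv) (L2time_mode Lwt Lv) LF1 LF2
  FE1 FE2 (mode_scale tau Lzeta Lv) wE1 wE2.
have Lmw := L2time_mode Lw Lv; have Lmwt := L2time_mode Lwt Lv.
have [[m1 _ _] [m2 _ _]] := (Lmw, Lmwt).
have m11 : measurable_fun [set: mR] (fun t => mode w (fun x => a * phi k x) t *
    mode w (fun x => a * phi k x) t) by exact: measurable_funM.
have m22 : measurable_fun [set: mR] (fun t => mode wt (fun x => a * phi k x) t *
    mode wt (fun x => a * phi k x) t) by exact: measurable_funM.
rewrite -Rintegral_scale//; apply: ae_eq_Rintegral => //.
- exact: measurable_funM.
- by apply: ae_imp sc => t -> _; ring.
Qed.

Lemma L2Qdot_sqrD u w : L2Q u -> L2Q w ->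
  L2Qdot (fun t x => u t x + w t x) (fun t x => u t x + w t x) =
  L2Qdot u u + 2 * L2Qdot u w + L2Qdot w w.
Proof.
move=> Lu Lw; have Ls := L2Q_add oOmega Lu Lw.
rewrite [LHS](L2dotDl mC Lu Lw Ls) [X in X + _]L2dotC [X in _ + X]L2dotC.
rewrite [X in X + _](L2dotDl mC Lu Lw Lu) [X in _ + X](L2dotDl mC Lu Lw Lw).
by rewrite [X in _ + X + _ = _]L2dotC /Defs.L2Qdot; ring.
Qed.

(** The adjoint state represents the derivative of the cost, and the cost is
    quadratic, so that its Taylor expansion at [zbar] stops at the second order. *)
Lemma cost_expansion mu z zbar u ubar ud p : L2Q z -> L2Q zbar -> L2Q ud ->
  state z u -> state zbar ubar ->
  adjoint_solution Omega lam phi s T gamma ubar ud p ->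
  let w := fun t x => u t x - ubar t x in
  let zeta := fun t x => z t x - zbar t x in
  cost Omega T mu ud u z - cost Omega T mu ud ubar zbar =
  L2Qdot (fun t x => mu * zbar t x + p t x) zeta +
  2^-1 * (L2Qdot w w + mu * L2Qdot zeta zeta).
Proof.
move=> Lz Lzb Lud st stb adj w zeta.
have Lu := state_L2Q st; have Lub := state_L2Q stb.
have Lp : L2Q p by case: adj => [[Lp _ _] _ _ _]; exact: LinftyL2_L2Q.
have Lw : L2Q w := L2Q_sub oOmega Lu Lub.
have Lzeta : L2Q zeta := L2Q_sub oOmega Lz Lzb.
pose d t x := ubar t x - ud t x.
have Ld : L2Q d := L2Q_sub oOmega Lub Lud.
rewrite (costE oOmega mu Lu Lud Lz) (costE oOmega mu Lub Lud Lzb).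
have -> : (fun t x => u t x - ud t x) = (fun t x => w t x + d t x).
  by apply/funext => t; apply/funext => x; rewrite /w /d; ring.
have -> : L2Qdot z z = L2Qdot (fun t x => zeta t x + zbar t x) (fun t x => zeta t x + zbar t x).
  by congr (L2Qdot _ _); apply/funext => t; apply/funext => x; rewrite /zeta; ring.
rewrite (L2Qdot_sqrD Lw Ld) (L2Qdot_sqrD Lzeta Lzb).
rewrite [L2Qdot w d](mode_pairing Lz Lzb Lud st stb adj) -/zeta -/d.
have -> : L2Qdot (fun t x => mu * zbar t x + p t x) zeta =
    mu * L2Qdot zeta zbar + L2Qdot zeta p.
  rewrite [LHS](L2dotDl mC (L2Q_scale oOmega mu Lzb) Lp Lzeta).
  by rewrite [X in X + _](L2dotZl mC mu Lzb Lzeta) [X in _ * X]L2dotC [X in _ + X]L2dotC.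
by field.
Qed.

End differences.
End optimality.

(** * The variational inequality *)

Section admissible_controls.
Context (R : realType) (n : nat).
Variables (Omega : set 'rV[R]_n) (T : R).
Hypothesis oOmega : open Omega.

Lemma Zad_convex (a b z1 z2 : R -> 'rV[R]_n -> R) (tau : R) : 0 <= tau <= 1 ->
  Zad Omega T a b z1 -> Zad Omega T a b z2 ->
  Zad Omega T a b (fun t x => z1 t x + tau * (z2 t x - z1 t x)).
Proof.
move=> /andP[t0 t1] [L1 b1] [L2' b2]; split.
  exact: (L2Q_add oOmega L1 (L2Q_scale oOmega tau (L2Q_sub oOmega L2' L1))).
apply: filterS2 b1 b2 => y h1 h2 cy.
have /andP[? ?] := h1 cy; have /andP[? ?] := h2 cy.
by apply/andP; split; nra.
Qed.

End admissible_controls.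

(** Divide by [tau] and let it tend to 0. *)
Lemma ge0_of_quadratic (R : realFieldType) (A B : R) : 0 <= B ->
  (forall tau, 0 < tau <= 1 -> 0 <= tau * A + tau ^+ 2 * B) -> 0 <= A.
Proof.
move=> B0 AB; rewrite leNgt; apply/negP => A0.
have D : 0 < 2 * (B - A) by lra.
(* This makes [tau * B] at most half of [- A], and [tau] at most 1 / 2. *)
pose tau := - A / (2 * (B - A)).
have t0 : 0 < tau by rewrite divr_gt0//; lra.
have tD : tau * (2 * (B - A)) = - A by rewrite divfK// gt_eqF.
have t1 : tau <= 1 by rewrite ler_pdivrMr//; lra.
have := AB tau; rewrite t0 t1 => /(_ isT).
by rewrite expr2 -mulrA -mulrDr pmulr_rge0//; nra.
Qed.

Theorem theorem3p9 (R : realType) (n : nat) (hn : (1 <= n)%N)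
  (Omega : set 'rV[R]_n) (hOmega : polyhedral_domain Omega)
  (T : R) (hT : 0 < T)
  (A : 'rV[R]_n -> 'M[R]_n) (c : 'rV[R]_n -> R)
  (hL : elliptic_operator Omega A c)
  (lam : nat -> R) (phi : nat -> 'rV[R]_n -> R)
  (heig : eigenpairs Omega A c lam phi)
  (hphi : orthonormal_basis Omega phi)
  (s : R) (hs : 0 < s < 1)
  (gamma : R) (hgamma : 0 < gamma <= 1)
  (mu : R) (hmu : 0 < mu)
  (f : R -> ('rV[R]_n -> R) -> R) (hf : L2Hms Omega s T f)
  (u0 : 'rV[R]_n -> R) (hu0 : L2 (lebesgue_rV n) Omega u0)
  (ud : R -> 'rV[R]_n -> R) (hud : L2Q Omega T ud)
  (a b : R -> 'rV[R]_n -> R) (ha : L2Q Omega T a) (hb : L2Q Omega T b)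
  (hab : \forall y \ae (lebesgue_rV n \x @lebesgue_measure R)%E,
     cylinder Omega T y -> a y.2 y.1 <= b y.2 y.1)
  (S : (R -> ('rV[R]_n -> R) -> R) -> R -> 'rV[R]_n -> R)
  (hS : control_to_state Omega lam phi s T gamma f u0 a b S)
  (zbar : R -> 'rV[R]_n -> R) (hzbar : Zad Omega T a b zbar)
  (pbar : R -> 'rV[R]_n -> R)
  (hpbar : adjoint_solution Omega lam phi s T gamma
     (S (L2Q_functional Omega zbar)) ud pbar) :
  optimal_control Omega T mu ud a b S zbar <->
  (forall z, Zad Omega T a b z ->
     0 <= L2Qdot Omega T (fun t x => mu * zbar t x + pbar t x)
            (fun t x => z t x - zbar t x)).
Proof.
have oOmega : open Omega by case: hOmega.
have phiH10 k : exists G, H10 Omega (phi k) G by have [G ? _] := heig k; exists G.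
have [kappa [ik ck kE]] := mode_convolution oOmega hT hgamma.
have L2Z z : Zad Omega T a b z -> L2Q Omega T z by case.
have stS z : Zad Omega T a b z -> state_solution Omega lam phi s T gamma f
  (L2Q_functional Omega z) u0 (S (L2Q_functional Omega z)) by move=> /hS[].
have expand z (hz : Zad Omega T a b z) := cost_expansion oOmega hT hs hphi phiH10 hu0
  ik kE mu (L2Z z hz) (L2Z _ hzbar) hud (stS z hz) (stS _ hzbar) hpbar.
split=> [[_ opt] z hz|VI]; last first.
  split; [exact: hzbar|move=> z hz].
  rewrite -subr_ge0 (expand z hz).
  apply: addr_ge0; first exact: VI.
  by rewrite mulr_ge0// addr_ge0 ?L2dot_ge0// mulr_ge0 ?L2dot_ge0// ltW.
have Lzeta := L2Q_sub oOmega (L2Z _ hz) (L2Z _ hzbar).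
set w := fun t x => S (L2Q_functional Omega z) t x - S (L2Q_functional Omega zbar) t x.
set zeta := fun t x => z t x - zbar t x in Lzeta *.
apply: (@ge0_of_quadratic R _ (2^-1 * (L2Qdot Omega T w w + mu * L2Qdot Omega T zeta zeta))).
  by rewrite mulr_ge0// addr_ge0 ?L2dot_ge0// mulr_ge0 ?L2dot_ge0// ltW.
move=> tau /andP[tau0 tau1].
have hzt : Zad Omega T a b (fun t x => zbar t x + tau * (z t x - zbar t x)).
  by apply: Zad_convex => //; rewrite ltW.
have := opt _ hzt; rewrite -subr_ge0 expand//.
rewrite (state_difference_scaling oOmega hT hs hphi phiH10 hu0 ik ck kE
  (L2Z _ hz) (L2Z _ hzbar) (L2Z _ hzt) (stS _ hz) (stS _ hzbar) (stS _ hzt) (fun _ _ => erefl)).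
have mC := mcyl T oOmega.
have zE : (fun t x => zbar t x + tau * (z t x - zbar t x) - zbar t x) =
    (fun t x => tau * zeta t x).
  by apply/funext => t; apply/funext => x; rewrite /zeta; ring.
have Lp : L2Q Omega T pbar by case: hpbar => [[Lp _ _] _ _ _]; exact: LinftyL2_L2Q.
have Lg := L2Q_add oOmega (L2Q_scale oOmega mu (L2Z _ hzbar)) Lp.
have Ltz := L2Q_scale oOmega tau Lzeta.
have dotr h : L2Q Omega T h -> L2Qdot Omega T h (fun t x => tau * zeta t x) =
    tau * L2Qdot Omega T h zeta.
  by move=> Lh; rewrite /L2Qdot L2dotC [LHS](L2dotZl mC tau Lzeta Lh) L2dotC.
rewrite zE (dotr _ Lg) (dotr _ Ltz) [L2Qdot _ _ _ zeta in X in _ + X](L2dotZl mC tau Lzeta Lzeta).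
by move=> h; apply: le_trans h _; rewrite le_eqVlt; apply/orP; left; apply/eqP;
  rewrite /w /L2Qdot; ring.
Qed.
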